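(* Let $\omega_1,\omega_2\in\mathbb{C}\setminus\mathbb{R}$ and $\xi_1,\xi_2\in\mathbb{C}$. Then there exists $\alpha\in\mathrm{GL}_2(\mathbb{C})$ such that $\big(\wp_{\omega_2}(u),e^v\widetilde{\sigma}_{\omega_2,\xi_2}(u)\big)\circ\alpha$ is algebraic over $\mathbb{C}\big(\wp_{\omega_1}(u),e^v\widetilde{\sigma}_{\omega_1,\xi_1}(u)\big)$ if and only if there are $a,b,c,d\in\mathbb{Z}$ such that $ad-bc\neq0$, $\omega_2=\frac{a\omega_1+b}{c\omega_1+d}$ and $(c\omega_1+d)\xi_2\in\Xi(\omega_1,\xi_1)$.
   Context: For a lattice $\Omega$ of $\mathbb{C}$, $\wp_\Omega,\sigma_\Omega$ are the Weierstrass functions and, for $\xi\in\mathbb{C}$, $\widetilde{\sigma}_{\Omega,\xi}(u):=\frac{\sigma_\Omega(u-\xi)}{\sigma_\Omega(u)}$. For $\omega\in\mathbb{C}\setminus\mathbb{R}$, a subscript $\omega$ means the lattice $\langle1,\omega\rangle_{\mathbb{Z}}=\mathbb{Z}+\mathbb{Z}\omega$. A map of $(u,v)\in\mathbb{C}^2$ is algebraic over $\mathbb{C}(g_1,g_2)$ if each of its coordinate functions is algebraic over the field generated over $\mathbb{C}$ by the meromorphic functions $g_1,g_2$. Define $\Xi(\Omega,\xi)$ as the set of $\rho\in\mathbb{C}$ for which there is $\alpha\in\mathrm{GL}_2(\mathbb{C})$ such that $\big(\wp_\Omega(u),e^v\widetilde{\sigma}_{\Omega,\rho}(u)\big)\circ\alpha$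 is algebraic over $\mathbb{C}\big(\wp_\Omega(u),e^v\widetilde{\sigma}_{\Omega,\xi}(u)\big)$, and $\Xi(\omega,\xi):=\Xi(\langle1,\omega\rangle_{\mathbb{Z}},\xi)$. *)

(* Defs.v *)
From HB Require Import structures.
From mathcomp Require Import all_boot all_order all_algebra finmap.
From mathcomp Require Import complex.
From mathcomp Require Import all_classical all_reals topology normedtype.
From mathcomp Require Import sequences exp trigo summability.

Set Implicit Arguments.
Unset Strict Implicit.
Unset Printing Implicit Defensive.

Import Order.TTheory GRing.Theory Num.Theory.
Import numFieldNormedType.Exports.

Local Open Scope classical_set_scope.
Local Open Scope ring_scope.
Local Open Scope complex_scope.

(* [R[i]] gets the topology of its norm, like any numFieldType. *)
HB.instance Definition _ (R : realType) := NormedModule.copy R[i] R[i]^o.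

Section Weierstrass.
Variable R : realType.
Local Notation C := R[i].

Definition cexp (z : C) : C :=
  let: x +i* y := z in (expR x * cos y) +i* (expR x * sin y).

Definition lattice (w1 w2 : C) : set C :=
  [set w | exists m n : int, w = m%:~R * w1 + n%:~R * w2].

(* L is meant to be a lattice; the series and the product then converge
   unconditionally, and limits along [totally] (finite subsets, ordered by
   inclusion) do not depend on an enumeration of L.  At the poles of wp and
   sigmat the values are irrelevant, see mero_eq. *)
Definition wp (L : set C) (u : C) : C :=
  u ^- 2 + lim ((fun A : {fset C} =>
    \sum_(w <- A | w \in L `\ 0) ((u - w) ^- 2 - w ^- 2)) @ totally).

Definition sigma (L : set C) (u : C) : C :=
  u * lim ((fun A : {fset C} =>
    \prod_(w <- A | w \in L `\ 0)
      ((1 - u / w) * cexp (u / w + (u / w) ^+ 2 / 2))) @ totally).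

Definition sigmat (L : set C) (xi u : C) : C := sigma L (u - xi) / sigma L u.

(* The point (u, v) of C^2 is the column vector z with u = z 0 0, v = z 1 0. *)
Definition wp_sigmat (L : set C) (xi : C) (z : 'cV[C]_2) : 'cV[C]_2 :=
  \col_i (if i == 0 then wp L (z 0 0)
          else cexp (z 1 0) * sigmat L xi (z 0 0)).

(* A meromorphic function on C^2 is represented by a total function, with
   arbitrary values on its polar set, which is closed and nowhere dense.  Two
   such representatives define the same meromorphic function exactly when they
   agree on a dense open set. *)
Definition mero_eq (f g : 'cV[C]_2 -> C) : Prop :=
  exists U : set 'cV[C]_2, [/\ open U, dense U & forall z, U z -> f z = g z].

(* The field generated over C by the coordinate functions of G.  Since
   0^-1 = 0, inverting (a representative of) the zero function is harmless. *)
Inductive gen_field (G : 'cV[C]_2 -> 'cV[C]_2) : ('cV[C]_2 -> C) -> Prop :=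
| gen_cst (c : C) : gen_field G (cst c)
| gen_coord (i : 'I_2) : gen_field G (fun z => G z i 0)
| gen_add f g : gen_field G f -> gen_field G g -> gen_field G (f + g)
| gen_opp f : gen_field G f -> gen_field G (- f)
| gen_mul f g : gen_field G f -> gen_field G g -> gen_field G (f * g)
| gen_inv f : gen_field G f -> gen_field G (fun z => (f z)^-1).

Definition algebraic_fun (G : 'cV[C]_2 -> 'cV[C]_2) (f : 'cV[C]_2 -> C) : Prop :=
  exists p : {poly ('cV[C]_2 -> C)},
    [/\ forall i, gen_field G p`_i,
        exists i, ~ mero_eq p`_i 0 &
        mero_eq p.[f] 0].

Definition algebraic_map (G F : 'cV[C]_2 -> 'cV[C]_2) : Prop :=
  forall i, algebraic_fun G (fun z => F z i 0).

Definition Xi (L : set C) (xi : C) : set C :=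
  [set rho | exists alpha : 'M[C]_2, alpha \in unitmx /\
     algebraic_map (wp_sigmat L xi) (wp_sigmat L rho \o mulmx alpha)].

End Weierstrass.

(* Main.v *)
(* If [mu Omega_2] is contained in [Omega_1], then the pair attached to
   [(Omega_1, mu xi)] and the pair attached to [(Omega_2, xi)] are, after a linear
   change of variables, algebraic over each other: the wp-functions are both
   elliptic for [mu Omega_2], and a power of [e^v sigmat] for the second pair
   is, after rescaling [v], [e^v sigmat] for the first pair times an elliptic
   function.  Taking [mu = c omega_1 + d] this turns algebraicity over the pair of
   [omega_1] into membership in [Xi], and proves the theorem once the two lattices
   are known to be commensurable.

   For commensurability, take a nonzero polynomial relation between
   [wp_2 (p u + q v)], [wp_1 u] and [e^v sigmat_1 u].  Periodicity in [v] against
   the growth of [e^v] forces [q = 0] and then gives a relation between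
   [wp_2 (p u)] and [wp_1 u] alone; if some [p l], [l] in [Omega_1], had no multiple
   in [Omega_2], its multiples would accumulate modulo [Omega_2] and the values
   [wp_1 u] and [wp_2 w] would be dependent for independent [u] and [w]. *)

Require Import Defs.
From HB Require Import structures.
From mathcomp Require Import all_boot all_order all_algebra finmap.
From mathcomp Require Import complex.
From mathcomp Require Import all_classical all_reals topology normedtype.
From mathcomp Require Import sequences derive exp trigo summability.
From mathcomp Require Import mxpoly cyclic separable cyclotomic fraction.
From mathcomp Require Import ring lra zify.
Import Order.TTheory GRing.Theory Num.Theory.
Import numFieldNormedType.Exports.
Set Implicit Arguments.
Unset Strict Implicit.
Unset Printing Implicit Defensive.
Local Open Scope classical_set_scope.
Local Open Scope ring_scope.

(** * Entire functions *)

Section Norm.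
Variable R : realType.
Local Notation C := R[i].

(** The complex analysis rests on one estimate, Cauchy's coefficient bound for polynomials, which
    survives uniform limits; Taylor expansions, the identity theorem and the Schwarz lemma follow
    from it. Poles are avoided by working with the entire functions [PiS S] (sigma) and
    [PiS S ^+ 2 * wp S]. The maps of the theorem then become elements of the fraction field of the
    entire functions on C^2, and [represents] ties this field to total functions with junk values.

    The algebraic dependence of two elliptic functions for one lattice is obtained by a count: among
    the monomials of high degree in theta functions with a common factor of automorphy, some
    combination vanishes at 0 to so high an order that the Schwarz lemma, played against
    quasi-periodicity, makes it zero. This covers both the two wp-functions of an isogeny and the
    elliptic factor by which the sigma quotients differ. The latter comes with an exponential linear
    in [u], which is why the change of variables must mix [u] into [v]. *)

Definition nm (z : C) : R := Normc.normc z.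

Lemma normE (z : C) : `|z| = (nm z)%:C%C.
Proof. by []. Qed.
Lemma nm0 : nm 0 = 0. Proof. exact: Normc.normc0. Qed.
Lemma nm1 : nm 1 = 1. Proof. exact: Normc.normc1. Qed.
Lemma nmM x y : nm (x * y) = nm x * nm y. Proof. exact: Normc.normcM. Qed.
Lemma nmV x : nm x^-1 = (nm x)^-1. Proof. exact: Normc.normcV. Qed.
Lemma nmN x : nm (- x) = nm x. Proof. exact: normcN. Qed.
Lemma nmD x y : nm (x + y) <= nm x + nm y. Proof. exact: le_normcD. Qed.
Lemma nmB x y : nm (x - y) <= nm x + nm y.
Proof. by rewrite -(nmN y) nmD. Qed.
Lemma nm_ge0 x : 0 <= nm x.
Proof. by case: x => a b; rewrite /nm /Normc.normc sqrtr_ge0. Qed.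
Lemma nm_eq0 x : (nm x == 0) = (x == 0).
Proof.
by apply/eqP/eqP => [/Normc.eq0_normc|->] //; rewrite nm0.
Qed.
Lemma nm_gt0 x : (0 < nm x) = (x != 0).
Proof. by rewrite lt_def nm_ge0 andbT nm_eq0. Qed.
Lemma nmBC x y : nm (x - y) = nm (y - x).
Proof. by rewrite -opprB nmN. Qed.
Lemma nm_triangle y x z : nm (x - z) <= nm (x - y) + nm (y - z).
Proof. by rewrite -[x in X in X <= _](subrK y) -addrA nmD. Qed.
Lemma nmBge x y : nm x - nm y <= nm (x - y).
Proof. by rewrite lerBlDr -[x in X in X <= _](subrK y) nmD. Qed.
Lemma nmDge x y : nm x - nm y <= nm (x + y).
Proof. by rewrite -(opprK y) nmN nmBge. Qed.
Lemma nmX x n : nm (x ^+ n) = nm x ^+ n.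
Proof. by elim: n => [|n IH]; rewrite ?expr0 ?nm1 // !exprS nmM IH. Qed.
Lemma nm_real (x : R) : nm x%:C%C = `|x|.
Proof. by rewrite /nm /= expr0n addr0 sqrtr_sqr. Qed.
Lemma nm_nat n : nm n%:R = n%:R.
Proof. by rewrite -(rmorph_nat (real_complex R)) nm_real normr_nat. Qed.
Lemma nm_sum I (r : seq I) (P : pred I) (F : I -> C) :
  nm (\sum_(i <- r | P i) F i) <= \sum_(i <- r | P i) nm (F i).
Proof.
elim/big_rec2: _ => [|i y x _ h]; first by rewrite nm0.
by apply: le_trans (nmD _ _) _; rewrite lerD2l.
Qed.
Lemma nm_Re (z : C) : `|complex.Re z| <= nm z.
Proof.
case: z => a b; rewrite /nm /= -sqrtr_sqr ler_sqrt ?lerDl ?sqr_ge0 //.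
by rewrite addr_ge0 ?sqr_ge0.
Qed.
Lemma nm_Im (z : C) : `|complex.Im z| <= nm z.
Proof.
case: z => a b; rewrite /nm /= -sqrtr_sqr ler_sqrt ?lerDr ?sqr_ge0 //.
by rewrite addr_ge0 ?sqr_ge0.
Qed.
Lemma nm_ReIm (z : C) : nm z <= `|complex.Re z| + `|complex.Im z|.
Proof.
have ->: z = (complex.Re z)%:C%C + 'i%C * (complex.Im z)%:C%C.
  by case: z => a b; simpc.
apply: le_trans (nmD _ _) _; rewrite nmM !nm_real /=; simpc.
by rewrite /nm /= expr0n expr1n add0r sqrtr1 mul1r.
Qed.
Lemma nm_eps0 z : (forall e, 0 < e -> nm z <= e) -> z = 0.
Proof.
move=> h; apply/eqP; rewrite -nm_eq0; apply/negPn/negP => nz.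
have z0 : 0 < nm z by rewrite lt_def nz nm_ge0.
by have := h (nm z / 2) (divr_gt0 z0 (ltr0Sn _ _)); lra.
Qed.
End Norm.

(** * Cauchy's bound for the coefficients of a polynomial *)

Section Poly.
Variable R : realType.
Local Notation C := R[i].

(** ['X^n - 1] splits over C and is separable in characteristic 0, and [n] distinct [n]-th roots of
    unity in a field include a primitive one. *)
Lemma prim_root_ex n : (0 < n)%N -> exists z : C, n.-primitive_root z.
Proof.
pose p : {poly C} := 'X^n - 1; have [r Dp] := closed_field_poly_normal p.
move=> n_gt0; rewrite (monicP _) ?monicXnsubC // scale1r in Dp.
have rn1: all n.-unity_root r by apply/allP=> z; rewrite -root_prod_XsubC -Dp.
have sz_r: (n < (size r).+1)%N.
  by rewrite -(size_prod_XsubC r id) -Dp size_XnsubC.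
have [|z] := hasP (has_prim_root n_gt0 rn1 _ sz_r); last by exists z.
by rewrite -separable_prod_XsubC -Dp separable_Xn_sub_1 // pnatr_eq0 -lt0n.
Qed.

Lemma sum_unity_root n (x : C) : x ^+ n = 1 ->
  \sum_(j < n) x ^+ j = if x == 1 then n%:R else 0.
Proof.
move=> xn; case: eqP => [->|/eqP x1].
  by under eq_bigr do rewrite expr1n; rewrite sumr_const card_ord.
have := subrX1 x n; rewrite xn subrr => /esym/eqP.
by rewrite mulf_eq0 subr_eq0 (negbTE x1) => /eqP.
Qed.

(* Averaging [p z * z^-k] over the [n]-th roots of unity, [n] large, isolates
   the [k]-th coefficient. *)
Lemma poly_cauchy (p : {poly C}) (r B : R) k : 0 < r ->
  (forall z, nm z = r -> nm p.[z] <= B) -> nm p`_k * r ^+ k <= B.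
Proof.
(* [n] exceeds [k] and every degree in [p], so for [i < n] the sum [i + (n - k)] is divisible by [n]
   only if [i = k]; the weight [w ^+ (j * (n - k))] stands for [w ^- (j * k)]. *)
move=> r0 hB; pose n := (size p + k).+1.
have n0 : (0 < n)%N by [].
have [w wP] := prim_root_ex n0.
have nw : nm w = 1.
  have : nm w ^+ n = 1 by rewrite -nmX (prim_expr_order wP) nm1.
  by move/eqP; rewrite pexprn_eq1 ?nm_ge0 // => /eqP.
pose z j : C := r%:C%C * w ^+ j.
have nz j : nm (z j) = r.
  by rewrite /z nmM nmX nw expr1n mulr1 nm_real gtr0_norm.
have key : \sum_(j < n) p.[z j] * w ^+ (j * (n - k)) =
   n%:R * (p`_k * (r%:C%C) ^+ k).
  rewrite (eq_bigr (fun j : 'I_n =>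
    \sum_(i < n) p`_i * z j ^+ i * w ^+ (j * (n - k)))); last first.
    move=> j _; rewrite (@horner_coef_wide _ n) ?mulr_suml //.
    by rewrite /n -addnS leq_addr.
  rewrite exchange_big /=.
  have kn : (k < n)%N by rewrite /n ltnS leq_addl.
  rewrite (bigD1 (Ordinal kn)) //= [X in _ + X]big1 ?addr0 => [|m mk].
    rewrite (eq_bigr (fun=> p`_k * (r%:C%C) ^+ k)).
      by rewrite sumr_const card_ord mulr_natl.
    move=> j _; rewrite /z exprMn -mulrA -mulrA -exprM -exprD -mulnDr subnKC ?(ltnW kn) //.
    by rewrite mulnC exprM (prim_expr_order wP) expr1n mulr1.
  have xn : (w ^+ (m + (n - k))) ^+ n = 1.
    by rewrite -exprM mulnC exprM (prim_expr_order wP) expr1n.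
  transitivity (p`_m * (r%:C%C) ^+ m * \sum_(j < n) (w ^+ (m + (n - k))) ^+ j).
    rewrite mulr_sumr; apply: eq_bigr => j _.
    by rewrite /z exprMn -!mulrA -!exprM -exprD -mulnDr mulnC.
  rewrite sum_unity_root // -(prim_order_dvd wP) ifF ?mulr0 //.
  apply/negbTE/negP => /dvdnP [q].
  have := ltn_ord m; have : (nat_of_ord m != k) by [].
  move: (kn) (nat_of_ord m); clear; move: n => b h1 a.
  case: q => [|[|q]]; rewrite ?mul0n ?mul1n ?mulSn => h2 h3 h4; lia.
have : nm (n%:R * (p`_k * (r%:C%C) ^+ k)) <= n%:R * B.
  rewrite -key; apply: le_trans (nm_sum _ _ _) _.
  rewrite mulr_natl -[in X in _ <= X](card_ord n) -sumr_const.
  by apply: ler_sum => j _; rewrite nmM nmX nw expr1n mulr1 hB.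
by rewrite !nmM nm_nat nmX nm_real gtr0_norm // ler_pM2l.
Qed.
End Poly.

Section Entire.
Variable R : realType.
Local Notation C := R[i].
Implicit Types (D : set C) (f g : C -> C) (p q : {poly C}).

Definition disc (r : R) : set C := [set z | nm z <= r].

Definition approx D f :=
  forall e : R, 0 < e -> exists p, forall z, D z -> nm (f z - p.[z]) <= e.

Definition bounded_on D f := exists2 B : R, 0 <= B & forall z, D z -> nm (f z) <= B.

(* Being a locally uniform limit of polynomials replaces complex
   differentiability. *)
Definition entire f := forall r, approx (disc r) f.

Lemma approx_sub D D' f : D `<=` D' -> approx D' f -> approx D f.
Proof. by move=> s h e /h[p hp]; exists p => z /s; exact: hp. Qed.

Lemma approx_eq D f g : (forall z, D z -> f z = g z) -> approx D f -> approx D g.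
Proof.
by move=> s h e /h[p hp]; exists p => z Dz; rewrite -s //; exact: hp.
Qed.

Lemma entire_eq f g : f =1 g -> entire f -> entire g.
Proof. by move=> s h r; apply: approx_eq (h r) => z _; exact: s. Qed.

Lemma approx_poly D p : approx D (fun z => p.[z]).
Proof. by move=> e e0; exists p => z _; rewrite subrr nm0 ltW. Qed.

Lemma approx_lim D f :
  (forall e, 0 < e -> exists2 g, approx D g & forall z, D z -> nm (f z - g z) <= e) ->
  approx D f.
Proof.
move=> h e e0; have e20 : 0 < e / 2 by lra.
have [g ag hg] := h _ e20; have [p hp] := ag _ e20.
exists p => z Dz; apply: le_trans (nm_triangle (g z) _ _) _.
by have := hg _ Dz; have := hp _ Dz; lra.
Qed.

Lemma nm_horner p z : nm p.[z] <= \sum_(i < size p) nm p`_i * nm z ^+ i.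
Proof.
rewrite horner_coef; apply: le_trans (nm_sum _ _ _) _.
by apply: ler_sum => i _; rewrite nmM nmX.
Qed.

Lemma poly_bounded r p : bounded_on (disc r) (fun z => p.[z]).
Proof.
exists (\sum_(i < size p) nm p`_i * `|r| ^+ i).
  by apply: sumr_ge0 => i _; rewrite mulr_ge0 ?nm_ge0 // exprn_ge0.
move=> z zr; apply: le_trans (nm_horner _ _) _.
apply: ler_sum => i _; apply: ler_wpM2l; first exact: nm_ge0.
by rewrite lerXn2r ?nnegrE ?nm_ge0 //; apply: le_trans zr _; exact: ler_norm.
Qed.

Lemma approx_bounded D r f : D `<=` disc r -> approx D f -> bounded_on D f.
Proof.
move=> s /(_ 1 ltr01)[p hp]; have [B B0 hB] := poly_bounded r p.
exists (1 + B) => [|z Dz]; first lra.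
rewrite -[f z](subrK p.[z]); apply: le_trans (nmD _ _) _.
by rewrite lerD ?hp // hB //; exact: s.
Qed.

Lemma approxD D f g : approx D f -> approx D g -> approx D (fun z => f z + g z).
Proof.
move=> hf hg e e0; have e20 : 0 < e / 2 by lra.
have [p hp] := hf _ e20; have [q hq] := hg _ e20.
exists (p + q) => z Dz; rewrite hornerD opprD addrACA.
by apply: le_trans (nmD _ _) _; have := hp _ Dz; have := hq _ Dz; lra.
Qed.

Lemma approxM D r f g : D `<=` disc r ->
  approx D f -> approx D g -> approx D (fun z => f z * g z).
Proof.
move=> s hf hg; have [F F0 hF] := approx_bounded s hf.
have [G G0 hG] := approx_bounded s hg.
(* The three error terms are at most [F * d], [d * G] and [d * d]; the last is below [d] because
   [d <= 1]. *)
move=> e e0; pose d := Num.min 1 (e / (F + G + 1)).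
have d1 : d <= 1 by rewrite /d ge_min lexx.
have d2 : d * (F + G + 1) <= e.
  by rewrite -ler_pdivlMr ?ge_min ?lexx ?orbT //; lra.
have d0 : 0 < d by rewrite lt_min ltr01 /= divr_gt0 //; lra.
have [p hp] := hf _ d0; have [q hq] := hg _ d0.
exists (p * q) => z Dz; rewrite hornerM.
have -> : f z * g z - p.[z] * q.[z] =
   f z * (g z - q.[z]) + (f z - p.[z]) * g z - (f z - p.[z]) * (g z - q.[z]) by ring.
apply: le_trans (nmB _ _) _.
have ht := nmD (f z * (g z - q.[z])) ((f z - p.[z]) * g z).
rewrite !nmM in ht *; have hcd' := hp _ Dz; have hcd := hq _ Dz.
have : nm (f z) * nm (g z - q.[z]) <= F * d by rewrite ler_pM ?nm_ge0 ?hF.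
have : nm (f z - p.[z]) * nm (g z) <= d * G by rewrite ler_pM ?nm_ge0 ?hG.
have : nm (f z - p.[z]) * nm (g z - q.[z]) <= d * 1.
  by rewrite ler_pM ?nm_ge0 // (le_trans hcd).
nra.
Qed.

Lemma approx_cst D c : approx D (fun=> c).
Proof.
by apply: approx_eq (approx_poly D c%:P) => z _; rewrite hornerC.
Qed.

Lemma approxX D r f n : D `<=` disc r -> approx D f -> approx D (fun z => f z ^+ n).
Proof.
move=> s hf; elim: n => [|n IH]; first exact: approx_cst.
by apply: approx_eq (approxM s hf IH) => z _; rewrite exprS.
Qed.

Lemma approx_sum D I (r : seq I) (P : pred I) (F : I -> C -> C) :
  (forall i, P i -> approx D (F i)) -> approx D (fun z => \sum_(i <- r | P i) F i z).
Proof.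
move=> h; elim: r => [|i r IH].
  by apply: approx_eq (approx_cst D 0) => z _; rewrite big_nil.
have [Pi|Pi] := boolP (P i).
  by apply: approx_eq (approxD (h i Pi) IH) => z _; rewrite big_cons Pi.
by apply: approx_eq IH => z _; rewrite big_cons (negbTE Pi).
Qed.

Lemma approx_prod D b I (r : seq I) (P : pred I) (F : I -> C -> C) :
  D `<=` disc b ->
  (forall i, P i -> approx D (F i)) -> approx D (fun z => \prod_(i <- r | P i) F i z).
Proof.
move=> s h; elim: r => [|i r IH].
  by apply: approx_eq (approx_cst D 1) => z _; rewrite big_nil.
have [Pi|Pi] := boolP (P i).
  by apply: approx_eq (approxM s (h i Pi) IH) => z _; rewrite big_cons Pi.
by apply: approx_eq IH => z _; rewrite big_cons (negbTE Pi).
Qed.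

Lemma entire_cst c : entire (fun=> c).
Proof. by move=> r; exact: approx_cst. Qed.
Lemma entire_poly p : entire (fun z => p.[z]).
Proof. by move=> r; exact: approx_poly. Qed.
Lemma entire_id : entire id.
Proof. by apply: entire_eq (entire_poly 'X) => z; rewrite hornerX. Qed.
Lemma entireD f g : entire f -> entire g -> entire (fun z => f z + g z).
Proof. by move=> hf hg r; exact: approxD. Qed.
Lemma entireM f g : entire f -> entire g -> entire (fun z => f z * g z).
Proof. by move=> hf hg r; exact: (@approxM _ r). Qed.
Lemma entireX f n : entire f -> entire (fun z => f z ^+ n).
Proof. by move=> hf r; exact: (@approxX _ r). Qed.
Lemma entireN f : entire f -> entire (fun z => - f z).
Proof.
by move=> hf; apply: entire_eq (entireM (entire_cst (-1)) hf) => z; rewrite mulN1r.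
Qed.
Lemma entire_sum I (r : seq I) (P : pred I) (F : I -> C -> C) :
  (forall i, P i -> entire (F i)) -> entire (fun z => \sum_(i <- r | P i) F i z).
Proof. by move=> h b; apply: approx_sum => i Pi; exact: h. Qed.
Lemma entire_prod I (r : seq I) (P : pred I) (F : I -> C -> C) :
  (forall i, P i -> entire (F i)) -> entire (fun z => \prod_(i <- r | P i) F i z).
Proof. by move=> h b; apply: (@approx_prod _ b) => // i Pi; exact: h. Qed.

Lemma entire_comp f q : entire f -> entire (fun z => f q.[z]).
Proof.
move=> hf r e e0; have [B _ hB] := poly_bounded r q.
have [p hp] := hf B e e0; exists (p \Po q) => z Dz.
by rewrite horner_comp; apply: hp; exact: hB.
Qed.

Lemma entire_affine f a b : entire f -> entire (fun z => f (a * z + b)).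
Proof.
move=> /(entire_comp (a *: 'X + b%:P)); apply: entire_eq => z.
by rewrite hornerD hornerZ hornerX hornerC.
Qed.

Lemma entire_bounded f r : entire f -> bounded_on (disc r) f.
Proof. by move=> hf; exact: (@approx_bounded _ r). Qed.

End Entire.

(** * Completeness and limits over finite subsets *)

Section Complete.
Variable R : realType.
Local Notation C := R[i].

Lemma nat_ge (x : R) : exists N, forall n, (N <= n)%N -> x <= n%:R.
Proof.
exists (Num.bound `|x|) => n hn; apply: le_trans (ler_norm x) _.
by apply/ltW/(lt_le_trans (archi_boundP (normr_ge0 x))); rewrite ler_nat.
Qed.

Definition ivn (n : nat) : R := n.+1%:R^-1.

Lemma ivn_gt0 n : 0 < ivn n.
Proof. by rewrite invr_gt0 ltr0n. Qed.

Lemma ivn_le m n : (n <= m)%N -> ivn m <= ivn n.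
Proof. by move=> h; rewrite lef_pV2 ?posrE ?ltr0n // ler_nat. Qed.

Lemma ivn_small (e : R) : 0 < e ->
  exists N, forall n, (N <= n)%N -> ivn n <= e.
Proof.
move=> e0; have [N hN] := nat_ge e^-1; exists N => n /hN hn; rewrite /ivn.
rewrite -[e]invrK lef_pV2 ?posrE ?invr_gt0 // ?ltr0n //.
by apply: le_trans hn _; rewrite ler_nat.
Qed.

Lemma real_complete (T : Type) (F : set_system T) (FF : ProperFilter F) (f : T -> R) :
  (forall e : R, 0 < e -> exists c, F [set x | `|f x - c| <= e]) ->
  exists l, forall e : R, 0 < e -> F [set x | `|f x - l| <= e].
Proof.
move=> h; have : cvg (f @ F).
  apply/cauchy_cvgP; apply: (@cauchy_exP R R) => e e0.
  have e20 : 0 < e / 2 by rewrite divr_gt0.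
  have [c hc] := h _ e20; exists c.
  suff : [set x | `|f x - c| <= e / 2] `<=` [set x | ball c e (f x)].
    by move=> sub; exact: (filterS sub hc).
  move=> x; rewrite -ball_normE /= distrC => hx.
  by apply: le_lt_trans hx _; lra.
move/cvg_ex => [l /cvgrPdist_le hl]; exists l => e e0.
by have := hl e e0; apply: filterS => x; rewrite /= distrC.
Qed.

Lemma complex_complete (T : Type) (F : set_system T) (FF : ProperFilter F) (f : T -> C) :
  (forall e : R, 0 < e -> exists c, F [set x | nm (f x - c) <= e]) ->
  exists l, forall e : R, 0 < e -> F [set x | nm (f x - l) <= e].
Proof.
move=> h.
have [|a ha] := @real_complete _ _ FF (fun x => complex.Re (f x)).
  move=> e /h[c hc]; exists (complex.Re c); apply: (filterS _ hc) => x /=.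
  by move/(le_trans (nm_Re _)); case: (f x) => ? ?; case: (c).
have [|b hb] := @real_complete _ _ FF (fun x => complex.Im (f x)).
  move=> e /h[c hc]; exists (complex.Im c); apply: (filterS _ hc) => x /=.
  by move/(le_trans (nm_Im _)); case: (f x) => ? ?; case: (c).
exists (a +i* b)%C => e e0; have e20 : 0 < e / 2 by lra.
move: (ha _ e20) (hb _ e20); apply: filterS2 => x /= h1 h2.
apply: le_trans (nm_ReIm _) _; move: h1 h2; case: (f x) => u v /=; lra.
Qed.

Lemma seq_complete (u : nat -> C) :
  (forall e : R, 0 < e -> exists N, forall n, (N <= n)%N -> nm (u n - u N) <= e) ->
  exists l, forall e : R, 0 < e -> exists N, forall n, (N <= n)%N -> nm (u n - l) <= e.
Proof.
move=> h; have [|l hl] := @complex_complete _ \oo _ u.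
  by move=> e /h[N hN]; exists (u N); exists N.
by exists l => e /hl[N _ hN]; exists N => n hn; exact: hN.
Qed.

(** Convergence along [totally] with a real [e]. The epsilons of the topology of [R[i]] are elements
    of [R[i]], but positive ones are real, so [fcvg_lim] recovers the limit of the definitions. *)
Definition fcvg (F : {fset C} -> C) (l : C) :=
  forall e : R, 0 < e -> exists A0, forall A, (A0 `<=` A)%fset -> nm (F A - l) <= e.

Lemma fcvg_lim F l : fcvg F l -> lim (F @ totally) = l.
Proof.
move=> h; apply: (@cvg_lim _ _ _ _ totally_filter); first exact: norm_hausdorff.
have FF : ProperFilter (@totally C) := totally_filter.
apply/cvgrPdist_le => e; case: e => e e'.
rewrite ltcE /= => /andP[/eqP -> /= e0].
have [A0 hA] := h e e0; exists A0 => // A sA /=.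
by rewrite distrC normE lecR hA.
Qed.

Lemma fcvg_complete F :
  (forall e : R, 0 < e -> exists A0, forall A, (A0 `<=` A)%fset -> nm (F A - F A0) <= e) ->
  exists l, fcvg F l.
Proof.
move=> h; have [|l hl] := @complex_complete _ (@totally C) totally_filter F.
  by move=> e /h[A0 hA]; exists (F A0); exists A0 => // A; exact: hA.
by exists l => e /hl[A0 _ hA]; exists A0 => A; exact: hA.
Qed.

Lemma fcvg_uniq F l m : fcvg F l -> fcvg F m -> l = m.
Proof. by move=> /fcvg_lim <- /fcvg_lim <-. Qed.

Lemma fcvg_eq F G l : (exists A0, forall A, (A0 `<=` A)%fset -> F A = G A) ->
  fcvg F l -> fcvg G l.
Proof.
move=> [A0 h] hF e /hF[A1 hA]; exists (A0 `|` A1)%fset => A.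
by rewrite fsubUset => /andP[s0 s1]; rewrite -h // hA.
Qed.

Lemma fcvg_cst c : fcvg (fun=> c) c.
Proof. by move=> e e0; exists fset0 => A _; rewrite subrr nm0 ltW. Qed.

Lemma fcvgD F G l m : fcvg F l -> fcvg G m -> fcvg (fun A => F A + G A) (l + m).
Proof.
move=> hF hG e e0; have e20 : 0 < e / 2 by lra.
have [A0 h0] := hF _ e20; have [A1 h1] := hG _ e20.
exists (A0 `|` A1)%fset => A; rewrite fsubUset => /andP[/h0 ? /h1 ?].
by rewrite opprD addrACA; apply: le_trans (nmD _ _) _; lra.
Qed.

Lemma fcvg_nm_le F l B : fcvg F l -> (exists A0, forall A, (A0 `<=` A)%fset -> nm (F A) <= B) ->
  nm l <= B.
Proof.
move=> hF [A0 h0]; apply/ler_addgt0Pr => e /hF[A1 h1].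
have := h0 (A0 `|` A1)%fset (fsubsetUl _ _).
have := h1 (A0 `|` A1)%fset (fsubsetUr _ _).
by have := nmBge l (F (A0 `|` A1)%fset); rewrite nmBC; lra.
Qed.

Lemma fcvgM F G l m : fcvg F l -> fcvg G m -> fcvg (fun A => F A * G A) (l * m).
Proof.
move=> hF hG e e0; pose d := Num.min 1 (e / (nm l + nm m + 1)).
have l0 := nm_ge0 l; have m0 := nm_ge0 m.
have d1 : d <= 1 by rewrite /d ge_min lexx.
have d2 : d * (nm l + nm m + 1) <= e.
  by rewrite -ler_pdivlMr ?ge_min ?lexx ?orbT //; lra.
have d0 : 0 < d by rewrite lt_min ltr01 /= divr_gt0 //; lra.
have [A0 h0] := hF _ d0; have [A1 h1] := hG _ d0.
exists (A0 `|` A1)%fset => A; rewrite fsubUset => /andP[/h0 hf /h1 hg].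
have -> : F A * G A - l * m = (F A - l) * (G A - m) + l * (G A - m) + (F A - l) * m.
  by ring.
apply: le_trans (nmD _ _) _.
have := nmD ((F A - l) * (G A - m)) (l * (G A - m)); rewrite !nmM.
have : nm (F A - l) * nm (G A - m) <= d * 1 by rewrite ler_pM ?nm_ge0 // (le_trans hg).
have : nm (F A - l) * nm m <= d * nm m by rewrite ler_pM ?nm_ge0.
have : nm l * nm (G A - m) <= nm l * d by rewrite ler_pM ?nm_ge0.
nra.
Qed.

Lemma fcvgZ c F l : fcvg F l -> fcvg (fun A => c * F A) (c * l).
Proof. by move=> h; apply: fcvgM => //; exact: fcvg_cst. Qed.

End Complete.

(** * Taylor expansions, identity theorem, removable singularities *)

Section Taylor.
Variable R : realType.
Local Notation ivn := (ivn R).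
Local Notation C := R[i].
Implicit Types (f g : C -> C) (p q : {poly C}) (S : set C).

Definition taylor f (a : nat -> C) := forall r e : R, 0 < r -> 0 < e ->
  exists N, forall n, (N <= n)%N -> forall u, nm u <= r ->
    nm (f u - \sum_(k < n) a k * u ^+ k) <= e.

Lemma taylor_cauchy f a r B k : 0 < r -> taylor f a ->
  (forall u, nm u = r -> nm (f u) <= B) -> nm (a k) * r ^+ k <= B.
Proof.
move=> r0 ta hB; apply/ler_addgt0Pr => e e0; have [N hN] := ta r e r0 e0.
pose n := maxn N k.+1; pose p := \poly_(i < n) a i.
have <- : p`_k = a k by rewrite coef_poly leq_max ltnSn orbT.
apply: poly_cauchy => // z nz; rewrite horner_poly.
have := hN n (leq_maxl _ _) z; rewrite nz => /(_ (lexx _)) h.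
have := hB z nz; rewrite nmBC in h; have := nmBge (\sum_(i < n) a i * z ^+ i) (f z).
by lra.
Qed.

Lemma taylor_eq0 f a : taylor f a -> (forall k, a k = 0) -> forall z, f z = 0.
Proof.
move=> ta a0 z; apply: nm_eps0 => e e0.
have [N /(_ N (leqnn _) z)] := ta (nm z + 1) e (ltr_wpDl (nm_ge0 _) ltr01) e0.
rewrite big1 ?subr0 => [h|i _]; last by rewrite a0 mul0r.
by apply: h; rewrite lerDl.
Qed.

Lemma taylorD f g a b : taylor f a -> taylor g b ->
  taylor (fun z => f z + g z) (fun k => a k + b k).
Proof.
move=> ta tb r e r0 e0; have e20 : 0 < e / 2 by lra.
have [N hN] := ta r _ r0 e20; have [M hM] := tb r _ r0 e20.
exists (maxn N M) => n; rewrite geq_max => /andP[/hN{}hN /hM{}hM] u ur.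
under eq_bigr do rewrite mulrDl.
rewrite big_split /= opprD addrACA; apply: le_trans (nmD _ _) _.
by have := hN _ ur; have := hM _ ur; lra.
Qed.

Lemma taylorZ f a c : taylor f a -> taylor (fun z => c * f z) (fun k => c * a k).
Proof.
move=> ta r e r0 e0; have c0 := nm_ge0 c.
have [N hN] := ta r (e / (nm c + 1)) r0 (divr_gt0 e0 (ltr_wpDl c0 ltr01)).
exists N => n /hN{}hN u /hN; rewrite ler_pdivlMr ?ltr_wpDl // => h.
under eq_bigr do rewrite -mulrA.
rewrite -mulr_sumr -mulrBr nmM; apply: le_trans h.
rewrite mulrC; apply: ler_wpM2l; [exact: nm_ge0 | lra].
Qed.

Lemma taylor_sum I (s : seq I) (F : I -> C -> C) (a : I -> nat -> C) :
  (forall i, taylor (F i) (a i)) ->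
  taylor (fun z => \sum_(i <- s) F i z) (fun k => \sum_(i <- s) a i k).
Proof.
move=> h; elim: s => [|i s IH].
  move=> r e r0 e0; exists 0%N => n _ u _; rewrite big_nil big1 ?subrr ?nm0 ?ltW //.
  by move=> k _; rewrite big_nil mul0r.
have := taylorD (h i) IH; congr (taylor _ _); apply/funext => z /=; by rewrite big_cons.
Qed.

(** By Cauchy's bound, the coefficients of polynomials approximating [f] on growing discs form
    Cauchy sequences. Their limits differ from the coefficients of [P n] by so little,
    [2 * ivn n / n.+1 ^ k], that the errors sum to a geometric series on half the disc. *)
Lemma entire_taylor f : entire f -> exists a, taylor f a.
Proof.
move=> hf.
have /choice[P hP] : forall n, exists p : {poly C}, forall z, nm z <= n.+1%:R ->
    nm (f z - p.[z]) <= ivn n.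
  by move=> n; apply: (hf n.+1%:R); exact: ivn_gt0.
have n0 n : 0 < n.+1%:R :> R by rewrite ltr0n.
have nV m n : (n <= m)%N -> ivn m <= ivn n.
  exact: ivn_le.
have cP m n k : (n <= m)%N -> nm ((P m)`_k - (P n)`_k) * n.+1%:R ^+ k <= 2 * ivn n.
  move=> lenm; rewrite -coefB; apply: poly_cauchy => // z nz.
  rewrite hornerD hornerN; apply: le_trans (nm_triangle (f z) _ _) _.
  have h1 := hP n z; rewrite nz lexx in h1; have {}h1 := h1 isT.
  have h2 := hP m z; rewrite nz ler_nat ltnS lenm in h2; have {}h2 := h2 isT.
  by rewrite nmBC in h2; have := nV _ _ lenm; lra.
have cP1 m n k : (n <= m)%N -> nm ((P m)`_k - (P n)`_k) <= 2 * ivn n.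
  move=> lenm; apply: le_trans (cP m n k lenm); rewrite ler_peMr ?nm_ge0 //.
  by rewrite exprn_ege1 // ler1n.
have /choice[a ha] : forall k, exists l, forall e : R, 0 < e ->
    exists N, forall n, (N <= n)%N -> nm ((P n)`_k - l) <= e.
  move=> k; apply: seq_complete => e e0.
  have e20 : 0 < e / 2 by lra.
  have [N hN] := ivn_small e20; exists N => n Nn.
  by apply: le_trans (cP1 _ _ _ Nn) _; have := hN N (leqnn _); lra.
have aP n k : nm (a k - (P n)`_k) * n.+1%:R ^+ k <= 2 * ivn n.
  apply/ler_addgt0Pr => e e0.
  have q0 : 0 < n.+1%:R ^+ k :> R by rewrite exprn_gt0.
  have [N hN] := ha k _ (divr_gt0 e0 q0).
  have h1 := hN (maxn n N) (leq_maxr _ _).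
  have h2 := cP (maxn n N) n k (leq_maxl _ _).
  rewrite ler_pdivlMr // in h1; rewrite nmBC in h1.
  have := ler_wpM2r (ltW q0) (nm_triangle (P (maxn n N))`_k (a k) (P n)`_k).
  by rewrite mulrDl; lra.
exists a => r e r0 e0.
(* Five shares: [ivn n] for the distance of [f] to [P n], and [4 * ivn n] for the geometric series
   of ratio 1/2 below. *)
have e50 : 0 < e / 5 by lra.
have [N1 hN1] := ivn_small e50; have [N2 hN2] := nat_ge (2 * r).
pose n := maxn N1 N2; exists (size (P n)) => K hK u ur.
have n2r : 2 * r <= n.+1%:R by apply: hN2; rewrite leqW ?leq_maxr.
apply: le_trans (nm_triangle (P n).[u] _ _) _.
have h1 : nm (f u - (P n).[u]) <= ivn n by apply: hP; lra.
have h2 : nm ((P n).[u] - \sum_(k < K) a k * u ^+ k) <= 4 * ivn n.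
  rewrite (horner_coef_wide _ hK) -sumrB.
  apply: le_trans (nm_sum _ _ _) _.
  have -> : 4 * ivn n = 2 * ivn n * 2 by ring.
  apply: le_trans (_ : 2 * ivn n * \sum_(i < K) (1 / 2) ^+ i <= _).
    rewrite mulr_sumr; apply: ler_sum => k _.
    rewrite -mulrBl nmM nmX nmBC.
    apply: le_trans (_ : _ <= nm (a k - (P n)`_k) * (n.+1%:R ^+ k * (1 / 2) ^+ k)) _.
      apply: ler_wpM2l; first exact: nm_ge0.
      rewrite -exprMn lerXn2r ?nnegrE ?nm_ge0 ?mulr_ge0 //; lra.
    by rewrite mulrA ler_wpM2r ?exprn_ge0 ?aP //; lra.
  apply: ler_wpM2l; first by rewrite mulr_ge0 // ltW // ivn_gt0.
  have h : \sum_(i < K) (1 / 2) ^+ i = 2 - 2 * (1 / 2) ^+ K :> R.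
    elim: (K) => [|k IH]; first by rewrite big_ord0 expr0; lra.
    by rewrite big_ord_recr /= IH exprS; lra.
  by rewrite h gerBl mulr_ge0 // exprn_ge0 //; lra.
by have := hN1 n (leq_maxl _ _); lra.
Qed.

(** Cauchy's bound with [B = 0] on a circle around [c] kills every Taylor coefficient at [c]. *)
Lemma entire_ident f c r : 0 < r -> entire f ->
  (forall z, nm (z - c) <= r -> f z = 0) -> forall z, f z = 0.
Proof.
move=> r0 hf h; have hg := entire_affine 1 c hf.
have [a ta] := entire_taylor hg.
have a0 k : a k = 0.
  apply/eqP; rewrite -nm_eq0 eq_le nm_ge0 andbT.
  have : nm (a k) * r ^+ k <= 0.
    apply: taylor_cauchy r0 ta _ => u nu; rewrite mul1r h ?nm0 //.
    by rewrite addrK nu.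
  by rewrite pmulr_lle0 // exprn_gt0.
move=> z; have := taylor_eq0 ta a0 (z - c).
by rewrite mul1r subrK.
Qed.

(** Continuity is inherited from an approximating polynomial, whose increment is [w - z] times a
    cofactor bounded on a disc. *)
Lemma entire_cont f z e : entire f -> 0 < e ->
  exists2 d, 0 < d & forall w, nm (w - z) <= d -> nm (f w - f z) <= e.
Proof.
move=> hf e0; have e40 : 0 < e / 4 by lra.
have [p hp] := hf (nm z + 1) _ e40.
have /factor_theorem[q Dq] : root (p - p.[z]%:P) z.
  by rewrite rootE hornerD hornerN hornerC subrr.
have [B B0 hB] := poly_bounded (nm z + 1) q.
have B10 : 0 < 2 * (B + 1) by lra.
exists (Num.min 1 (e / (2 * (B + 1)))); first by rewrite lt_min ltr01 divr_gt0.
move=> w; rewrite le_min => /andP[h1 h2]; rewrite ler_pdivlMr // in h2.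
have nw : nm w <= nm z + 1 by have := nmBge w z; lra.
have := hp w nw; have := hp z (ler_wpDr ler01 (lexx _)).
have : nm (p.[w] - p.[z]) <= e / 2.
  have -> : p.[w] - p.[z] = q.[w] * (w - z).
    have := congr1 (fun p => p.[w]) Dq; rewrite /= hornerD hornerN hornerC => ->.
    by rewrite hornerM hornerXsubC.
  rewrite nmM; have := hB w nw; have := nm_ge0 (w - z); have := nm_ge0 q.[w]; nra.
have := nm_triangle p.[w] (f w) (f z); have := nm_triangle p.[z] p.[w] (f z).
by rewrite (nmBC p.[z]); lra.
Qed.

(** Removable singularities: polynomials approximating [f] off [S] are also uniformly Cauchy on [S],
    since their differences are continuous and the complement of [S] is dense. *)
Lemma entire_extend S f :
  (forall z e, 0 < e -> exists2 w, ~ S w & nm (w - z) <= e) ->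
  (forall r, approx (disc r `\` S) f) ->
  exists2 g, entire g & forall z, ~ S z -> g z = f z.
Proof.
move=> dS hf.
have /choice[P hP] : forall n, exists p : {poly C}, forall z, nm z <= n.+1%:R -> ~ S z ->
    nm (f z - p.[z]) <= ivn n.
  move=> n; have [|p hp] := hf n.+1%:R (ivn n); first exact: ivn_gt0.
  by exists p => z nz Sz; apply: hp.
have nV m n : (n <= m)%N -> ivn m <= ivn n.
  exact: ivn_le.
(* The radius drops from [n.+1] to [n] to leave room for a point [w] off [S] at distance at most 1
   from [z]. *)
have cP m n z : (n <= m)%N -> nm z <= n%:R -> nm ((P m).[z] - (P n).[z]) <= 2 * ivn n.
  move=> lenm zn; apply/ler_addgt0Pr => e e0.
  have [d d0 hd] := entire_cont z (entire_poly (P m - P n)) e0.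
  have d10 : 0 < Num.min 1 d by rewrite lt_min ltr01.
  have [w Sw] := dS z _ d10; rewrite le_min => /andP[w1 wd].
  have wn : nm w <= n.+1%:R.
    by have := nmBge w z; rewrite -addn1 natrD; lra.
  have wm : nm w <= m.+1%:R by rewrite (le_trans wn) // ler_nat.
  have h1 := hP n w wn Sw; have h2 := hP m w wm Sw.
  have := hd w wd; rewrite !hornerE nmBC => h3.
  have := nmBge ((P m).[z] - (P n).[z]) ((P m).[w] - (P n).[w]).
  have := nm_triangle (f w) (P m).[w] (P n).[w]; rewrite (nmBC _ (f w)).
  by have := nV _ _ lenm; lra.
have /choice[g hg] : forall z, exists l, forall e : R, 0 < e ->
    exists N, forall n, (N <= n)%N -> nm ((P n).[z] - l) <= e.
  move=> z; apply: seq_complete => e e0.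
  have e20 : 0 < e / 2 by lra.
  have [N1 hN1] := ivn_small e20; have [N2 hN2] := nat_ge (nm z).
  exists (maxn N1 N2) => n Nn.
  apply: le_trans (cP _ _ _ Nn (hN2 _ (leq_maxr _ _))) _.
  by have := hN1 _ (leq_maxl N1 N2); lra.
have gP n z : nm z <= n%:R -> nm (g z - (P n).[z]) <= 2 * ivn n.
  move=> zn; apply/ler_addgt0Pr => e e0; have [N hN] := hg z _ e0.
  have h1 := hN (maxn n N) (leq_maxr _ _).
  have h2 := cP (maxn n N) n z (leq_maxl _ _) zn.
  have := nm_triangle (P (maxn n N)).[z] (g z) (P n).[z].
  by rewrite (nmBC (g z) (P (maxn n N)).[z]); lra.
exists g.
  move=> r e e0; have e20 : 0 < e / 2 by lra.
  have [N1 hN1] := ivn_small e20; have [N2 hN2] := nat_ge r.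
  exists (P (maxn N1 N2)) => z zr.
  apply: le_trans (gP _ _ (le_trans zr (hN2 _ (leq_maxr _ _)))) _.
  by have := hN1 _ (leq_maxl N1 N2); lra.
move=> z Sz; apply/eqP; rewrite -subr_eq0; apply/eqP/nm_eps0 => e e0.
have e30 : 0 < e / 3 by lra.
have [N1 hN1] := ivn_small e30; have [N2 hN2] := nat_ge (nm z).
have hz := hN2 _ (leq_maxr N1 N2).
have h1 := gP _ _ hz; have h2 := hP _ _ (le_trans hz _) Sz.
have {h2} := h2 (maxn N1 N2); rewrite ler_nat leqnSn => /(_ isT).
have := hN1 _ (leq_maxl N1 N2).
have := nm_triangle (P (maxn N1 N2)).[z] (g z) (f z).
by rewrite (nmBC (P (maxn N1 N2)).[z] (f z)); lra.
Qed.

End Taylor.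

(** * The exponential function *)

Section RealBounds.
Variable R : realType.

(** Each remainder estimated below has, up to sign, an earlier one as derivative, so they follow
    from one another; the factorials are given up. *)
Lemma mvt_bound (f df : R -> R) (B x : R) :
  (forall y : R, is_derive y 1 f (df y)) -> f 0 = 0 ->
  (forall y, `|y| <= `|x| -> `|df y| <= B) -> `|f x| <= B * `|x|.
Proof.
move=> hd f0 hB.
have hc a b : {within `[a, b], continuous f}.
  apply: continuous_subspaceT => y; apply: differentiable_continuous.
  by apply/derivable1_diffP; have [] := hd y.
have [x0|x0] := leP 0 x.
  have [c] := MVT_segment x0 (fun y _ => hd y) (hc 0 x).
  rewrite f0 !subr0 => /itvP cx ->; rewrite normrM; apply: ler_wpM2r => //.
  by apply: hB; rewrite !ger0_norm ?cx.
have [c] := MVT_segment (ltW x0) (fun y _ => hd y) (hc x 0).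
rewrite f0 !sub0r => /itvP cx h; rewrite -normrN h normrM normrN; apply: ler_wpM2r => //.
by apply: hB; rewrite !ler0_norm ?cx ?(ltW x0) // lerN2 cx.
Qed.

Lemma sin_le_norm (x : R) : `|sin x| <= `|x|.
Proof.
rewrite -[leRHS]mul1r; apply: (@mvt_bound sin cos); last by move=> y _; exact: cos_max.
exact: sin0.
Qed.

Lemma cosB1_le (x : R) : `|cos x - 1| <= `|x| ^+ 2.
Proof.
rewrite expr2; apply: (@mvt_bound (fun x => cos x - 1) (fun x => - sin x)).
- by move=> y; apply: is_derive_eq; rewrite subr0.
- by rewrite cos0 subrr.
by move=> y yx; rewrite normrN; apply: le_trans (sin_le_norm _) yx.
Qed.

Lemma sinB_le (x : R) : `|sin x - x| <= `|x| ^+ 3.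
Proof.
rewrite [leRHS]exprSr; apply: (@mvt_bound (fun x => sin x - x) (fun x => cos x - 1)).
by rewrite sin0 subrr.
by move=> y yx; apply: le_trans (cosB1_le _) _; rewrite lerXn2r ?nnegrE.
Qed.

Lemma cosB2_le (x : R) : `|cos x - 1 + x ^+ 2 / 2| <= `|x| ^+ 4.
Proof.
rewrite [leRHS]exprSr; apply: (@mvt_bound (fun x => cos x - 1 + x ^+ 2 / 2) (fun x => - (sin x - x))).
- by move=> y; apply: is_derive_eq; rewrite /GRing.scale /=; lra.
- by rewrite cos0 subrr expr0n mul0r addr0.
by move=> y yx; rewrite normrN; apply: le_trans (sinB_le _) _; rewrite lerXn2r ?nnegrE.
Qed.

Lemma expRB1_le (x : R) : `|x| <= 1 -> `|expR x - 1| <= expR 1 * `|x|.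
Proof.
move=> x1; apply: (@mvt_bound (fun x => expR x - 1) expR).
- by move=> y; apply: is_derive_eq; rewrite /GRing.scale /=; lra.
- by rewrite expR0 subrr.
move=> y yx; rewrite ger0_norm ?expR_ge0 // ler_expR.
by apply: le_trans (ler_norm _) (le_trans yx x1).
Qed.

Lemma expRB2_le (x : R) : `|x| <= 1 -> `|expR x - 1 - x| <= expR 1 * `|x| ^+ 2.
Proof.
move=> x1; rewrite expr2 mulrA.
apply: (@mvt_bound (fun x => expR x - 1 - x) (fun x => expR x - 1)).
- by move=> y; apply: is_derive_eq; rewrite /GRing.scale /=; lra.
- by rewrite expR0 !subrr.
move=> y yx; apply: le_trans (expRB1_le (le_trans yx x1)) _.
by rewrite ler_wpM2l ?expR_ge0.
Qed.

Lemma expRB3_le (x : R) : `|x| <= 1 ->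
  `|expR x - 1 - x - x ^+ 2 / 2| <= expR 1 * `|x| ^+ 3.
Proof.
move=> x1; rewrite [leRHS](_ : _ = expR 1 * `|x| ^+ 2 * `|x|); last by rewrite -mulrA -exprSr.
apply: (@mvt_bound (fun x => expR x - 1 - x - x ^+ 2 / 2) (fun x => expR x - 1 - x)).
- by move=> y; apply: is_derive_eq; rewrite /GRing.scale /=; lra.
- by rewrite expR0 !subrr expr0n mul0r subr0.
move=> y yx; apply: le_trans (expRB2_le (le_trans yx x1)) _.
by rewrite ler_wpM2l ?expR_ge0 // lerXn2r ?nnegrE.
Qed.
End RealBounds.

Section Cexp.
Variable R : realType.
Local Notation C := R[i].
Implicit Types (z w : C).

Lemma cexpD z w : cexp (z + w) = cexp z * cexp w.
Proof.
case: z w => [a b] [c d]; rewrite /cexp /= expRD cosD sinD.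
by apply/eqP; rewrite eq_complex /=; apply/andP; split; apply/eqP; ring.
Qed.
Lemma cexp0 : cexp 0 = 1 :> C.
Proof.
by apply/eqP; rewrite eq_complex /= expR0 cos0 sin0 mulr1 mulr0 !eqxx.
Qed.
Lemma nm_cexp z : nm (cexp z) = expR (complex.Re z).
Proof.
case: z => a b; rewrite /nm /= !exprMn -mulrDr cos2Dsin2 mulr1.
by rewrite sqrtr_sqr ger0_norm ?expR_ge0.
Qed.
Lemma nm_cexp_le z : nm (cexp z) <= expR (nm z).
Proof. by rewrite nm_cexp ler_expR (le_trans (ler_norm _)) ?nm_Re. Qed.
Lemma cexp_neq0 z : cexp z != 0.
Proof. by rewrite -nm_gt0 nm_cexp expR_gt0. Qed.
Lemma cexpN z : cexp (- z) = (cexp z)^-1.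
Proof.
by apply: (mulIf (cexp_neq0 z)); rewrite -cexpD addNr cexp0 mulVf ?cexp_neq0.
Qed.
Lemma cexpB z w : cexp (z - w) = cexp z / cexp w.
Proof. by rewrite cexpD cexpN. Qed.
Lemma cexp_nat n z : cexp (n%:R * z) = cexp z ^+ n.
Proof.
elim: n => [|n IH]; first by rewrite mul0r cexp0.
by rewrite -natr1 mulrDl mul1r cexpD IH exprSr.
Qed.
Lemma cexp_sum I (r : seq I) (P : pred I) (F : I -> C) :
  cexp (\sum_(i <- r | P i) F i) = \prod_(i <- r | P i) cexp (F i).
Proof. by elim/big_rec2: _ => [|i y x _ <-]; rewrite ?cexp0 ?cexpD. Qed.
Lemma cexp_eq1 z : cexp z = 1 -> complex.Re z = 0.
Proof.
by move/(congr1 (@nm R)); rewrite nm_cexp nm1 -(expR0 R) => /expR_inj.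
Qed.

Lemma cexp_taylor2 z : nm z <= 1 ->
  nm (cexp z - 1 - z - z ^+ 2 / 2) <= 10 * (expR 1 + 1) * nm z ^+ 3.
Proof.
have half : (2^-1 : C) = (2^-1)%:C%C by rewrite fmorphV rmorph_nat.
set t := nm z => t1; have t0 : 0 <= t by exact: nm_ge0.
have zr := nm_Re z; have zi := nm_Im z; rewrite -/t in zr zi.
case: z @t t1 t0 zr zi => x y t t1 t0 xt yt.
have {}xt : `|x| <= t by []. have {}yt : `|y| <= t by [].

apply: le_trans (nm_ReIm _) _.
set M := expR 1; have M0 : 0 < M by exact: expR_gt0.
have h1 := expRB3_le (le_trans xt t1); have h2 := cosB2_le y; have h3 := sinB_le y.
have e1 : `|expR x - 1 - x - x ^+ 2 / 2| <= M * t ^+ 3.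
  by apply: le_trans h1 _; rewrite ler_wpM2l ?(ltW M0) // lerXn2r ?nnegrE.
have e2 : `|cos y - 1 + y ^+ 2 / 2| <= t ^+ 3.
  apply: le_trans h2 _; rewrite exprSr.
  have := @lerXn2r _ 3 _ _ (normr_ge0 y) t0 yt.
  have : 0 <= `|y| ^+ 3 by rewrite exprn_ge0.
  by have := normr_ge0 y; nra.
have e3 : `|sin y - y| <= t ^+ 3 by apply: le_trans h3 _; rewrite lerXn2r ?nnegrE.
have tt : t ^+ 3 = t * t * t by rewrite !exprS expr0 mulr1 mulrA.
have xx : `|x| * `|x| <= t * t by rewrite ler_pM.
have yy : `|y| * `|y| <= t * t by rewrite ler_pM.
have xyy : `|x * y * y| <= t ^+ 3 by rewrite !normrM -mulrA tt -mulrA ler_pM ?mulr_ge0.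
have xxy : `|x * x * y| <= t ^+ 3 by rewrite !normrM tt ler_pM ?mulr_ge0.
have P0 : `|1 + x + x ^+ 2 / 2| <= 5 / 2.
  have x1 : `|x| <= 1 by lra.
  by move: x1; rewrite !ler_norml => /andP[? ?]; apply/andP; split; nra.
have t30 : 0 <= t ^+ 3 by rewrite exprn_ge0.
have mx : forall a b : R, 0 <= a -> 0 <= b -> a * b <= a * b by [].
(* Both expansions replace [expR x], [cos y] and [sin y] by their Taylor polynomials plus
   remainders; all terms of total degree below 3 cancel. *)
have -> : complex.Re (cexp (x +i* y)%C - 1 - (x +i* y)%C - (x +i* y)%C ^+ 2 / 2) =
    - (x * y * y) / 2 - (x * x * y) * y / 4
    + (1 + x + x ^+ 2 / 2) * (cos y - 1 + y ^+ 2 / 2)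
    + (expR x - 1 - x - x ^+ 2 / 2) * cos y.
  by rewrite half /= expr2 /=; simpc; field.
have -> : complex.Im (cexp (x +i* y)%C - 1 - (x +i* y)%C - (x +i* y)%C ^+ 2 / 2) =
    (x * x * y) / 2 + (1 + x + x ^+ 2 / 2) * (sin y - y)
    + (expR x - 1 - x - x ^+ 2 / 2) * sin y.
  by rewrite half /= expr2 /=; simpc; field.
have q1 : `|(1 + x + x ^+ 2 / 2) * (cos y - 1 + y ^+ 2 / 2)| <= 5 / 2 * t ^+ 3.
  by rewrite normrM ler_pM.
have q2 : `|(expR x - 1 - x - x ^+ 2 / 2) * cos y| <= M * t ^+ 3.
  by rewrite normrM -[leRHS]mulr1 ler_pM // cos_max.
have q3 : `|(1 + x + x ^+ 2 / 2) * (sin y - y)| <= 5 / 2 * t ^+ 3.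
  by rewrite normrM ler_pM.
have q4 : `|(expR x - 1 - x - x ^+ 2 / 2) * sin y| <= M * t ^+ 3.
  by rewrite normrM -[leRHS]mulr1 ler_pM // sin_max.
have q5 : `|(x * x * y) * y| <= t ^+ 3.
  by rewrite normrM -[leRHS]mulr1 ler_pM // (le_trans yt).
have n4 (a b c d : R) : `|a + b + c + d| <= `|a| + `|b| + `|c| + `|d|.
  apply: le_trans (ler_normD _ _) _; rewrite lerD2r.
  by apply: le_trans (ler_normD _ _) _; rewrite lerD2r ler_normD.
have n3 (a b c : R) : `|a + b + c| <= `|a| + `|b| + `|c|.
  by apply: le_trans (ler_normD _ _) _; rewrite lerD2r ler_normD.
apply: le_trans (lerD (n4 _ _ _ _) (n3 _ _ _)) _.
rewrite normrN !normf_div normrN !normr_nat.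
by have := mulr_ge0 (ltW M0) t30; lra.
Qed.

Lemma nmV2 : nm (2^-1 : C) = 2^-1.
Proof. by rewrite nmV nm_nat. Qed.

Lemma cexp_taylor1 z : nm z <= 1 ->
  nm (cexp z - 1 - z) <= 10 * (expR 1 + 2) * nm z ^+ 2.
Proof.
move=> z1; have h := cexp_taylor2 z1; have e0 := expR_gt0 (1 : R); have z0 := nm_ge0 z.
have -> : cexp z - 1 - z = (cexp z - 1 - z - z ^+ 2 / 2) + z ^+ 2 / 2 by ring.
apply: le_trans (nmD _ _) _; rewrite nmM nmV2 nmX.
have h3 : nm z ^+ 3 <= nm z ^+ 2 by rewrite exprS ler_piMl ?exprn_ge0.
have h2 : 0 <= nm z ^+ 2 by rewrite exprn_ge0.
by move: h h3 h2; move: (nm z ^+ 3) (nm z ^+ 2) (expR 1) e0 => a b c c0; nra.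
Qed.

Lemma nm_expr_sub z w (B : R) n : nm z <= B -> nm w <= B ->
  nm (z ^+ n.+1 - w ^+ n.+1) <= n.+1%:R * nm (z - w) * B ^+ n.
Proof.
move=> zB wB; rewrite subrXX nmM.
have -> : n.+1%:R * nm (z - w) * B ^+ n = nm (z - w) * (n.+1%:R * B ^+ n) by ring.
rewrite ler_wpM2l ?nm_ge0 //; apply: le_trans (nm_sum _ _ _) _.
rewrite -[X in X%:R](card_ord n.+1) mulr_natl -sumr_const; apply: ler_sum => i _.
have -> : B ^+ n = B ^+ (n - i) * B ^+ i by rewrite -exprD subnK // -ltnS.
rewrite nmM !nmX /=.
have B0 := le_trans (nm_ge0 _) zB.
by rewrite ler_pM ?exprn_ge0 ?nm_ge0 // lerXn2r ?nnegrE ?nm_ge0.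
Qed.

(** The approximants are [(1 + z / n.+1) ^+ n.+1]. As [cexp z] is the same power of [cexp h] with
    [h = z / n.+1], the difference of the powers is [n.+1] times an error of order [h ^+ 2], times a
    factor bounded by [expR r]. *)
Lemma entire_cexp : entire (@cexp R).
Proof.
move=> r0 e e0; pose r := `|r0| + 1.
have r1 : 1 <= r by rewrite lerDr.
pose K := 10 * (expR 1 + 2) * r ^+ 2 * expR r.
have a0 := expR_gt0 (1 : R); have r00 : 0 < r by lra.
have K0 : 0 < K by rewrite !mulr_gt0 ?expR_gt0 ?exprn_gt0 //; lra.
have [N1 hN1] := ivn_small (divr_gt0 e0 K0).
have [N2 hN2] := nat_ge r.
pose n := maxn N1 N2; have := hN1 n (leq_maxl _ _); have := hN2 n (leq_maxr _ _).
move=> nr; rewrite ler_pdivlMr // => ne.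
exists ((1 + n.+1%:R^-1 *: 'X) ^+ n.+1) => z zr.
have {}zr : nm z <= r by apply: le_trans zr (le_trans (ler_norm _) _); rewrite lerDl.
rewrite horner_exp !hornerE.
have n0 : n.+1%:R != 0 :> C by rewrite pnatr_eq0.
set h := n.+1%:R^-1 * z; have zh : z = n.+1%:R * h by rewrite /h mulrA divff // mul1r.
have nh : nm h = ivn R n * nm z by rewrite /h nmM nmV nm_nat.
have i0 := ivn_gt0 R n; have z0 := nm_ge0 z.
have inr : ivn R n * r <= 1.
  by rewrite mulrC ler_pdivrMr ?ltr0n // mul1r (le_trans nr) // ler_nat.
have h1 : nm h <= 1 by rewrite nh; nra.
rewrite {1}zh cexp_nat.
apply: le_trans (@nm_expr_sub _ _ (expR (nm h)) _ (nm_cexp_le _) _) _.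
  by apply: le_trans (nmD _ _) _; rewrite nm1 expR_ge1Dx.
have t1 := cexp_taylor1 h1; rewrite -addrA -opprD in t1.
rewrite -expRM_natl.
have er : expR (n%:R * nm h) <= expR r.
  rewrite ler_expR; apply: le_trans zr; have -> : nm z = n.+1%:R * nm h.
    by rewrite nh mulrA divff ?mul1r ?pnatr_eq0.
  by rewrite ler_wpM2r ?nm_ge0 // ler_nat.
apply: le_trans (_ : n.+1%:R * (10 * (expR 1 + 2) * nm h ^+ 2) * expR r <= _).
  by rewrite ler_pM ?mulr_ge0 ?expR_ge0 ?nm_ge0 // ler_wpM2l.
apply: le_trans ne; rewrite /K.
have -> : n.+1%:R * (10 * (expR 1 + 2) * nm h ^+ 2) * expR r =
   (n.+1%:R * ivn R n) * ivn R n * (10 * (expR 1 + 2) * nm z ^+ 2 * expR r).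
  by rewrite nh; ring.
rewrite divff ?pnatr_eq0 // mul1r ler_wpM2l ?(ltW i0) // ler_wpM2r ?expR_ge0 //.
apply: ler_wpM2l; first by apply: mulr_ge0 => //; lra.
by rewrite lerXn2r ?nnegrE // (le_trans z0).
Qed.

(* The Weierstrass elementary factor of genus 2. *)
Definition E2 z := (1 - z) * cexp (z + z ^+ 2 / 2).

Lemma E2_eq0 z : (E2 z == 0) = (z == 1).
Proof. by rewrite /E2 mulf_eq0 (negbTE (cexp_neq0 _)) orbF subr_eq0 eq_sym. Qed.

Lemma entire_E2 : entire E2.
Proof.
apply: entireM; first by apply: entire_eq (entire_poly (1 - 'X)) => z; rewrite !hornerE.
apply: entire_eq (entire_comp ('X + 2^-1 *: 'X ^+ 2) entire_cexp) => z.
by rewrite hornerD hornerZ horner_exp hornerX [2^-1 * _]mulrC.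
Qed.

(** The exponent [z + z ^+ 2 / 2] cancels the logarithm of [1 - z] to second order; the cubic order
    is what [sum3] can absorb. *)
Lemma E2_small : exists2 K : R, 0 <= K &
  forall z, nm z <= 1 / 2 -> nm (E2 z - 1) <= K * nm z ^+ 3.
Proof.
have a0 := expR_gt0 (1 : R).
(* 160 = 2 * 10 * 8: 2 bounds [1 - z], 10 is the constant of [cexp_taylor2], and 8 comes from
   [nm y <= 2 * t]. The initial 1 covers the polynomial part. *)
exists (1 + 160 * (expR 1 + 1)) => [|z zh]; first lra.
have z0 := nm_ge0 z; set t := nm z in zh z0 *.
pose y := z + z ^+ 2 / 2.
have yt : nm y <= 2 * t.
  by apply: le_trans (nmD _ _) _; rewrite nmM nmV2 nmX -/t; nra.
have y1 : nm y <= 1 by lra.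
have h := cexp_taylor2 y1.
have -> : E2 z - 1 = - (z ^+ 3) / 2 - z ^+ 4 * (3 / 8) - z ^+ 5 / 8
   + (1 - z) * (cexp y - 1 - y - y ^+ 2 / 2).
  rewrite /E2 -/y; set c := cexp y.
  have cy : c = (c - 1 - y - y ^+ 2 / 2) + 1 + y + y ^+ 2 / 2 by ring.
  by rewrite {1}cy; move: (c - 1 - y - _) => d; rewrite /y; field.
have y3 : nm y ^+ 3 <= 8 * t ^+ 3.
  have -> : 8 * t ^+ 3 = (2 * t) ^+ 3 by rewrite exprMn; congr (_ * _); ring.
  by rewrite lerXn2r ?nnegrE ?nm_ge0 //; lra.
have t30 : 0 <= t ^+ 3 by rewrite exprn_ge0.
have t4 : t ^+ 4 <= t ^+ 3 by rewrite exprS ler_piMl //; lra.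
have t5 : t ^+ 5 <= t ^+ 3 by rewrite exprS; apply: le_trans t4; rewrite ler_piMl ?exprn_ge0 //; lra.
apply: le_trans (nmD _ _) _.
have n1 : nm (- (z ^+ 3) / 2 - z ^+ 4 * (3 / 8) - z ^+ 5 / 8) <= t ^+ 3.
  apply: le_trans (nmB _ _) _; have := nmB (- (z ^+ 3) / 2) (z ^+ 4 * (3 / 8)).
  by rewrite !nmM nmN !nmV !nm_nat !nmX -/t; lra.
have n2 : nm ((1 - z) * (cexp y - 1 - y - y ^+ 2 / 2)) <= 2 * (10 * (expR 1 + 1) * nm y ^+ 3).
  rewrite nmM ler_pM ?nm_ge0 //; have := nmB 1 z; rewrite nm1 -/t; lra.
have n3 : (expR 1 + 1) * nm y ^+ 3 <= (expR 1 + 1) * (8 * t ^+ 3).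
  by rewrite ler_wpM2l //; lra.
by move: n1 n2 n3; move: (nm _) (nm _) => u v; lra.
Qed.

End Cexp.

(** * Weierstrass products and series over a lattice *)

Section Families.
Variable R : realType.
Local Notation C := R[i].
Implicit Types (S : set C) (A B : {fset C}) (u w z : C).

Lemma big_fset_split (T : Type) (idx : T) (op : Monoid.com_law idx) A B
    (P : pred C) (F : C -> T) : (A `<=` B)%fset ->
  \big[op/idx]_(w <- B | P w) F w =
  op (\big[op/idx]_(w <- A | P w) F w)
     (\big[op/idx]_(w <- B | P w && (w \notin A)) F w).
Proof.
move=> AB; rewrite (bigID (fun w => w \in A)) /=; congr (op _ _).
rewrite -big_filter -[in RHS]big_filter; apply: perm_big; apply: uniq_perm.
- by rewrite filter_uniq // fset_uniq.
- by rewrite filter_uniq // fset_uniq.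
move=> w; rewrite !mem_filter -andbA; case: (P w) => //=.
by case wA: (w \in A) => //=; rewrite (fsubsetP AB).
Qed.

Definition wt w : R := (nm w ^+ 3)^-1.

Lemma wt_ge0 w : 0 <= wt w.
Proof. by rewrite invr_ge0 exprn_ge0 // nm_ge0. Qed.

(* The genus 2 condition, i.e. convergence of the sum of [|w| ^ -3]; the term
   [w = 0] is the junk value 0. *)
Definition sum3 S := exists M, forall A, \sum_(w <- A | w \in S) wt w <= M.

Lemma sum3_sub S S' : S `<=` S' -> sum3 S' -> sum3 S.
Proof.
move=> h [M hM]; exists M => A; apply: le_trans (hM A).
rewrite [leRHS](bigID (fun w => w \in S)) /= -[leLHS]addr0.
apply: lerD; last by apply: sumr_ge0 => *; exact: wt_ge0.
rewrite le_eqVlt; apply/orP; left; apply/eqP/eq_bigl => w.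
by apply/idP/andP => [wS|[]//]; split=> //; move: wS; rewrite !inE => /h.
Qed.

(** A finite set whose partial sum is within [e] of the supremum leaves at most [e] for all other
    points together. *)
Lemma sum3_tail S (e : R) : sum3 S -> 0 < e ->
  exists A0, forall A, \sum_(w <- A | (w \in S) && (w \notin A0)) wt w <= e.
Proof.
move=> [M hM] e0.
pose E := [set x | exists A, x = \sum_(w <- A | w \in S) wt w].
have supE : has_sup E.
  split; first by exists (\sum_(w <- fset0 | w \in S) wt w); exists fset0.
  by exists M => _ [A ->].
have [_ [A0 ->] hA0] := sup_adherent e0 supE.
exists A0 => A.
have h : \sum_(w <- (A `|` A0)%fset | w \in S) wt w <= sup E.
  by apply: sup_upper_bound => //; exists (A `|` A0)%fset.
rewrite (big_fset_split _ _ _ (fsubsetUr A A0)) /= in h.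
have : \sum_(w <- A | (w \in S) && (w \notin A0)) wt w <=
       \sum_(w <- (A `|` A0)%fset | (w \in S) && (w \notin A0)) wt w.
  rewrite (big_fset_split _ _ _ (fsubsetUl A A0)) /= lerDl.
  by apply: sumr_ge0 => *; exact: wt_ge0.
lra.
Qed.

(** A single point of modulus below [r1] contributes more than [r1 ^- 3] to a tail. The point 0 has
    junk weight 0 and is put into the finite set by hand. *)
Lemma sum3_disc S (r : R) : sum3 S ->
  exists A0, forall w, S w -> w \notin A0 -> r < nm w.
Proof.
move=> s3; pose r1 := `|r| + 1; have r10 : 0 < r1 by rewrite ltr_wpDl.
have e0 : 0 < (r1 ^+ 3)^-1 by rewrite invr_gt0 exprn_gt0.
have [A0 hA0] := sum3_tail s3 e0; exists (0 |` A0)%fset => w Sw.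
rewrite in_fset1U negb_or => /andP[w0 wA0].
have := hA0 [fset w]%fset; rewrite big_mkcond big_seq_fset1 mem_set // wA0 /=.
rewrite lef_pV2 ?posrE ?exprn_gt0 ?nm_gt0 // ler_pXn2r ?nnegrE ?nm_ge0 ?(ltW r10) //.
by move=> h; apply: lt_le_trans h; rewrite /r1; have := ler_norm r; lra.
Qed.

(** Infinitely many points [z + e / n.+1] lie in the disc, but only finitely many points of [S]. *)
Lemma sum3_dense S z (e : R) : sum3 S -> 0 < e ->
  exists2 w, ~ S w & nm (w - z) <= e.
Proof.
move=> s3 e0; have [A0 hA0] := sum3_disc (nm z + e) s3.
pose f n : C := z + (e * ivn R n)%:C%C.
have fz n : nm (f n - z) <= e.
  rewrite /f addrC addKr nm_real normrM !gtr0_norm ?ivn_gt0 //.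
  rewrite ler_piMr ?(ltW e0) //; apply: le_trans (ivn_le R (leq0n n)) _.
  by rewrite /ivn invr1.
apply: contrapT => hno.
have fA n : f n \in A0.
  apply/negPn/negP => fn; apply: hno; exists (f n) => // Sf.
  have := hA0 _ Sf fn; have := nmBge (f n) z; have := fz n; lra.
have : (size (map f (iota 0 #|` A0|.+1)) <= size A0)%N.
  apply: uniq_leq_size => [|_ /mapP[n _ ->]]; last exact: fA.
  rewrite map_inj_uniq ?iota_uniq // => m n /addrI/(congr1 (@complex.Re R)) /=.
  move/(mulfI (lt0r_neq0 e0))/invr_inj/eqP; rewrite eqr_nat.
  by move=> /eqP[].
by rewrite size_map size_iota ltnn.
Qed.

(** * The Weierstrass M-test for sums and products *)

Section Sums.
Variables (S : set C) (D : set C) (A0 : {fset C}) (K r : R) (F : C -> C -> C).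
Hypothesis s3 : sum3 S.
Hypothesis K0 : 0 <= K.

Lemma tail_bound (e : R) : 0 < e -> exists A1, forall A,
   K * \sum_(w <- A | (w \in S) && (w \notin A1)) wt w <= e.
Proof.
move=> e0; have K10 : 0 < K + 1 by rewrite ltr_wpDl.
have [A1 hA1] := sum3_tail s3 (divr_gt0 e0 K10); exists A1 => A.
have := hA1 A; rewrite ler_pdivlMr //; apply: le_trans.
by rewrite mulrC ler_wpM2l ?lerDl // sumr_ge0 // => *; exact: wt_ge0.
Qed.

Section Sum.
Hypothesis hF : forall w u, S w -> w \notin A0 -> D u -> nm (F w u) <= K * wt w.

Lemma sum_unif (e : R) : 0 < e -> exists A1, (A0 `<=` A1)%fset /\
  forall A u, (A1 `<=` A)%fset -> D u ->
  nm (\sum_(w <- A | w \in S) F w u - \sum_(w <- A1 | w \in S) F w u) <= e.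
Proof.
move=> e0; have [A1 hA1] := tail_bound e0.
exists (A0 `|` A1)%fset; split=> [|A u sA Du]; first exact: fsubsetUl.
rewrite (big_fset_split _ _ _ sA) /= addrAC subrr add0r.
apply: le_trans (nm_sum _ _ _) _; apply: le_trans (hA1 A).
rewrite mulr_sumr [leRHS](bigID (fun w => w \notin A0)) /= -[leLHS]addr0.
apply: lerD; last by apply: sumr_ge0 => *; rewrite mulr_ge0 ?wt_ge0.
rewrite (eq_bigl (fun w => (w \in S) && (w \notin A1) && (w \notin A0))).
  by apply: ler_sum => w /andP[/andP[]]; rewrite inE => *; exact: hF.
by move=> w; rewrite in_fsetU negb_or -andbA [(w \notin A0) && _]andbC.
Qed.

Lemma sum_cvg u : D u -> exists l, fcvg (fun A => \sum_(w <- A | w \in S) F w u) l.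
Proof.
move=> Du; apply: fcvg_complete => e /sum_unif[A1 [_ hA1]].
by exists A1 => A sA; exact: hA1.
Qed.

Lemma sum_approx (f : C -> C) : D `<=` disc r ->
  (forall w, S w -> approx D (F w)) ->
  (forall u, D u -> fcvg (fun A => \sum_(w <- A | w \in S) F w u) (f u)) ->
  approx D f.
Proof.
move=> sD aF hf; apply: approx_lim => e /sum_unif[A1 [_ hA1]].
exists (fun u => \sum_(w <- A1 | w \in S) F w u).
  by apply: approx_sum => w; rewrite inE => /aF.
move=> u Du; apply: fcvg_nm_le (_ : fcvg (fun A => \sum_(w <- A | w \in S) F w u
      - \sum_(w <- A1 | w \in S) F w u) _) _.
  by apply: fcvgD; [exact: hf | exact: fcvg_cst].
by exists A1 => A sA; exact: hA1.
Qed.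
End Sum.

(** The induction closes because [2 * t <= 1] makes the cross term [(a i - 1) * (Q - 1)] no larger
    than [nm (a i - 1)]. *)
Lemma prod_near1 (I : Type) (s : seq I) (P : pred I) (a : I -> C) :
  \sum_(i <- s | P i) nm (a i - 1) <= 1 / 2 ->
  nm (\prod_(i <- s | P i) a i - 1) <= 2 * \sum_(i <- s | P i) nm (a i - 1).
Proof.
elim: s => [|i s IH]; first by rewrite !big_nil subrr nm0 mulr0.
rewrite !big_cons; case: (P i) => // h.
have x0 := nm_ge0 (a i - 1).
have s0 : 0 <= \sum_(j <- s | P j) nm (a j - 1) by apply: sumr_ge0 => *; exact: nm_ge0.
have := IH (le_trans _ h); rewrite lerDr => /(_ x0).
move: (\prod_(j <- s | P j) a j) => Q; move: s0 h; move: (\sum_(j <- s | _) _) => t t0 h hQ.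
have -> : a i * Q - 1 = (a i - 1) * (Q - 1) + (a i - 1) + (Q - 1) by ring.
apply: le_trans (nmD _ _) _; have := nmD ((a i - 1) * (Q - 1)) (a i - 1).
by rewrite nmM; have := nm_ge0 (Q - 1); nra.
Qed.

Section Prod.
Hypothesis hF : forall w u, S w -> w \notin A0 -> D u -> nm (F w u - 1) <= K * wt w.

Lemma prod_tail (e : R) : 0 < e -> e <= 1 -> exists A1, (A0 `<=` A1)%fset /\
  forall A2 A u, (A1 `<=` A2)%fset -> D u ->
  nm (\prod_(w <- A | (w \in S) && (w \notin A2)) F w u - 1) <= e.
Proof.
move=> e0 e1; have e20 : 0 < e / 2 by lra.
have [A1 hA1] := tail_bound e20.
exists (A0 `|` A1)%fset; split=> [|A2 A u sA Du]; first exact: fsubsetUl.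
have h : \sum_(w <- A | (w \in S) && (w \notin A2)) nm (F w u - 1) <= e / 2.
  apply: le_trans (hA1 A).
  rewrite mulr_sumr [leRHS](bigID (fun w => w \notin A2)) /= -[leLHS]addr0.
  apply: lerD; last by apply: sumr_ge0 => *; rewrite mulr_ge0 ?wt_ge0.
  rewrite (eq_bigl (fun w => (w \in S) && (w \notin A1) && (w \notin A2))).
    apply: ler_sum => w /andP[/andP[]]; rewrite inE => Sw _ wA2; apply: hF => //.
    by apply: contra wA2 => wA0; rewrite (fsubsetP sA) // in_fsetU wA0.
  move=> w; case wA2: (w \in A2); rewrite /= ?andbF ?andbT //.
  have wA1 : w \notin A1.
    by apply/negP => wA1; move: wA2; rewrite (fsubsetP sA) // in_fsetU wA1 orbT.
  by rewrite wA1 andbT.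
by apply: le_trans (prod_near1 _) _; lra.
Qed.

Hypothesis sD : D `<=` disc r.
Hypothesis aF : forall w, S w -> approx D (F w).

Lemma prod_unif (e : R) : 0 < e -> exists A1,
  forall A u, (A1 `<=` A)%fset -> D u ->
  nm (\prod_(w <- A | w \in S) F w u - \prod_(w <- A1 | w \in S) F w u) <= e.
Proof.
(* The tail bound serves twice: with 1, to bound the partial product over [A2] and [A3] by [B * 2],
   and then with a [d] chosen against that bound. *)
move=> e0; have [A2 [_ hA2]] := prod_tail ltr01 (lexx _).
have [|B B0 hB] := @approx_bounded _ D r (fun u => \prod_(w <- A2 | w \in S) F w u) sD.
  by apply: (@approx_prod _ D r) => // w; rewrite inE => /aF.
have B10 : 0 < 2 * (B + 1) by lra.
pose d := Num.min 1 (e / (2 * (B + 1))).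
have d0 : 0 < d by rewrite lt_min ltr01 divr_gt0.
have d1 : d <= 1 by rewrite ge_min lexx.
have de : d * (2 * (B + 1)) <= e by rewrite -ler_pdivlMr // ge_min lexx orbT.
have [A3 [_ hA3]] := prod_tail d0 d1.
exists (A2 `|` A3)%fset => A u sA Du.
rewrite (big_fset_split _ _ _ sA) /= -[X in _ - X]mulr1 -mulrBr nmM.
have h1 := hA3 (A2 `|` A3)%fset A u (fsubsetUr _ _) Du.
have h2 : nm (\prod_(w <- (A2 `|` A3)%fset | w \in S) F w u) <= B * 2.
  rewrite (big_fset_split _ _ _ (fsubsetUl A2 A3)) /= nmM ler_pM ?nm_ge0 ?hB //.
  have := hA2 A2 (A2 `|` A3)%fset u (fsubset_refl _) Du.
  by have := nmBge (\prod_(w <- (A2 `|` A3)%fset | (w \in S) && (w \notin A2)) F w u) 1;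
     rewrite nm1; lra.
apply: le_trans (ler_pM (nm_ge0 _) (nm_ge0 _) h2 h1) _; nra.
Qed.

Lemma prod_cvg u : D u -> exists l, fcvg (fun A => \prod_(w <- A | w \in S) F w u) l.
Proof.
move=> Du; apply: fcvg_complete => e /prod_unif[A1 hA1].
by exists A1 => A sA; exact: hA1.
Qed.

Lemma prod_approx (f : C -> C) :
  (forall u, D u -> fcvg (fun A => \prod_(w <- A | w \in S) F w u) (f u)) ->
  approx D f.
Proof.
move=> hf; apply: approx_lim => e /prod_unif[A1 hA1].
exists (fun u => \prod_(w <- A1 | w \in S) F w u).
  by apply: (@approx_prod _ D r) => // w; rewrite inE => /aF.
move=> u Du; apply: fcvg_nm_le (_ : fcvg (fun A => \prod_(w <- A | w \in S) F w u
      - \prod_(w <- A1 | w \in S) F w u) _) _.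
  by apply: fcvgD; [exact: hf | exact: fcvg_cst].
by exists A1 => A sA; exact: hA1.
Qed.

Lemma prod_neq0 u l : D u -> (forall w, S w -> F w u != 0) ->
  fcvg (fun A => \prod_(w <- A | w \in S) F w u) l -> l != 0.
Proof.
move=> Du nz hl; have e0 : 0 < 1 / 2 :> R by lra.
(* Beyond [A1] the product stays within 1/2 of 1, so partial products keep at least half the modulus
   of [p]. *)
have [|A1 [_ hA1]] := prod_tail e0; first lra.
pose p := \prod_(w <- A1 | w \in S) F w u.
have p0 : 0 < nm p.
  by rewrite nm_gt0; rewrite prodf_seq_neq0; apply/allP => w _; apply/implyP; rewrite inE => /nz.
have p20 : 0 < nm p / 4 by lra.
have [A2 hA2] := hl _ p20.
have := hA2 (A1 `|` A2)%fset (fsubsetUr _ _).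
rewrite (big_fset_split _ _ _ (fsubsetUl A1 A2)) /= -/p.
have := hA1 A1 (A1 `|` A2)%fset u (fsubset_refl _) Du.
move: (\prod_(w <- _ | _ && _) _) => q hq.
have : nm p / 2 <= nm (p * q).
  rewrite nmM ler_pM2l //; have := nmBge 1 (1 - q).
  by rewrite subKr nm1 nmBC; lra.
move=> h1 h2; rewrite -nm_gt0; have := nmBge (p * q) l; lra.
Qed.
End Prod.
End Sums.
End Families.

(** * The sigma product and its translates *)

Section SigmaProduct.
Variable R : realType.
Local Notation C := R[i].
Implicit Types (S : set C) (A B : {fset C}) (u w z : C).

Lemma fcvg_entire (F : {fset C} -> C) l (f : C -> C) :
  entire f -> fcvg F l -> fcvg (fun A => f (F A)) (f l).
Proof.
move=> hf hF e e0; have [d d0 hd] := entire_cont l hf e0.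
by have [A0 hA] := hF _ d0; exists A0 => A /hA/hd.
Qed.

Lemma fcvg_bij (idx : C) (op : Monoid.com_law idx) S S' (F : C -> C) l (g h : C -> C) :
  cancel g h -> cancel h g -> (forall w, S' (g w) <-> S w) ->
  fcvg (fun A => \big[op/idx]_(w <- A | w \in S') F w) l ->
  fcvg (fun A => \big[op/idx]_(w <- A | w \in S) F (g w)) l.
Proof.
move=> gh hg SS hF e /hF[A0 hA0]; exists (h @` A0)%fset => A sA.
have -> : \big[op/idx]_(w <- A | w \in S) F (g w) =
          \big[op/idx]_(w <- (g @` A)%fset | w \in S') F w.
  rewrite big_mkcond [RHS]big_mkcond big_imfset /=; last first.
    by move=> x y _ _; exact: (can_inj gh).
  apply: eq_bigr => w _; congr (if _ then _ else _).
  by apply/idP/idP; rewrite !inE => /SS.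
apply: hA0; apply/fsubsetP => w wA; rewrite -(hg w).
by apply: in_imfset; apply: (fsubsetP sA); exact: in_imfset.
Qed.

Definition fac w u := if w == 0 then u else E2 (u / w).

Lemma entire_fac w : entire (fac w).
Proof.
rewrite /fac; case: eqP => _; first exact: entire_id.
apply: entire_eq (entire_affine w^-1 0 (@entire_E2 R)) => u.
by rewrite addr0 mulrC.
Qed.

Lemma fac_eq0 w u : (fac w u == 0) = (u == w).
Proof.
rewrite /fac; case: (eqVneq w 0) => [->//|w0]; rewrite E2_eq0.
by rewrite -(inj_eq (mulIf w0)) divfK // mul1r.
Qed.

Lemma wtM w (x : R) : x * wt w = x / nm w ^+ 3.
Proof. by []. Qed.

Lemma fac_near S (r : R) : sum3 S -> exists A0 (K : R), [/\ 0 <= K, 0 \in A0 &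
  forall w u, S w -> w \notin A0 -> disc r u -> nm (fac w u - 1) <= K * wt w].
Proof.
move=> s3; have [K K0 hK] := E2_small R.
have [A0 hA0] := sum3_disc (2 * r) s3.
exists (0 |` A0)%fset, (K * `|r| ^+ 3); split; rewrite ?mulr_ge0 ?exprn_ge0 //.
  by rewrite fset1U1.
move=> w u Sw; rewrite in_fset1U negb_or => /andP[w0 wA] ur.
rewrite /fac (negbTE w0); have := hA0 w Sw wA => rw.
have nw : 0 < nm w by rewrite nm_gt0.
have u0 := nm_ge0 u; have ur' : nm u <= r by [].
have h : nm (u / w) <= 1 / 2 by rewrite nmM nmV ler_pdivrMr //; lra.
apply: le_trans (hK _ h) _; rewrite nmM nmV -mulrA ler_wpM2l // exprMn exprVn.
rewrite ler_wpM2r ?wt_ge0 // lerXn2r ?nnegrE // (le_trans ur') ?ler_norm //.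
Qed.

(* The sigma function, with its factor [u] absorbed in the product, see
   [fac 0]. *)
Definition PiS S u := lim ((fun A : {fset C} => \prod_(w <- A | w \in S) fac w u) @ totally).

Lemma PiS_cvg S u : sum3 S -> fcvg (fun A => \prod_(w <- A | w \in S) fac w u) (PiS S u).
Proof.
move=> s3; have [A0 [K [K0 _ hK]]] := fac_near (nm u) s3.
have [|l hl] := prod_cvg s3 K0 hK (fun u h => h) _ (lexx (nm u)).
  by move=> w _; exact: entire_fac.
by rewrite /PiS (fcvg_lim hl).
Qed.

Lemma entire_PiS S : sum3 S -> entire (PiS S).
Proof.
move=> s3 r; have [A0 [K [K0 _ hK]]] := fac_near r s3.
apply: (prod_approx s3 K0 hK (fun u h => h)) => [w _|u _]; first exact: entire_fac.
exact: PiS_cvg.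
Qed.

Lemma PiS_eq0 S u : sum3 S -> PiS S u = 0 <-> S u.
Proof.
move=> s3; split=> [|Su].
  move=> h; apply: contrapT => Su; move/eqP: h; apply/negP.
  have [A0 [K [K0 _ hK]]] := fac_near (nm u) s3.
  apply: (prod_neq0 s3 K0 hK (lexx (nm u)) _ (PiS_cvg u s3)).
  by move=> w Sw; rewrite fac_eq0; apply/eqP => uw; apply: Su; rewrite uw.
apply: (fcvg_uniq (PiS_cvg u s3)).
apply: fcvg_eq (fcvg_cst 0); exists [fset u]%fset => A sA; symmetry; apply/eqP.
rewrite prodf_seq_eq0; apply/hasP; exists u.
  by apply: (fsubsetP sA); rewrite inE.
by rewrite fac_eq0 eqxx andbT inE.
Qed.

Lemma prod_fac0 S A u : S 0 -> ([fset 0] `<=` A)%fset ->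
  \prod_(w <- A | w \in S) fac w u =
  u * \prod_(w <- A | (w \in S) && (w \notin [fset 0]%fset)) fac w u.
Proof.
move=> S0 sA; rewrite (big_fset_split _ _ _ sA) /=; congr (_ * _).
by rewrite big_mkcond big_seq_fset1 mem_set // /fac eqxx.
Qed.

Lemma sigmaE S u : sum3 S -> S 0 -> sigma S u = PiS S u.
Proof.
move=> s3 S0; have s3' : sum3 (S `\ 0) by apply: sum3_sub s3 => x [].
rewrite /sigma; set F := fun A : {fset C} => _.
have FE A : F A = \prod_(w <- A | w \in S `\ 0) fac w u.
  apply: eq_bigr => w; rewrite inE => -[_ /eqP w0].
  by rewrite /fac (negbTE w0).
rewrite (fcvg_lim (l := PiS (S `\ 0) u)); last first.
  by apply: fcvg_eq (PiS_cvg u s3'); exists fset0 => A _; rewrite FE.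
symmetry; apply: fcvg_uniq (PiS_cvg u s3) _; apply: fcvg_eq (fcvgZ u (PiS_cvg u s3')).
exists [fset 0]%fset => A sA; rewrite [RHS]prod_fac0 //=; congr (_ * _).
by apply: eq_bigl => w; rewrite in_fset1; apply/idP/andP; rewrite !inE => -[Sw /eqP w0].
Qed.

(** The factors of [w] at [u] and of [- w] at [- u] agree for [w != 0]; the sign comes from the
    factor [u] of [w = 0] alone. *)
Lemma PiS_odd S u : sum3 S -> S 0 -> (forall w, S (- w) <-> S w) ->
  PiS S (- u) = - PiS S u.
Proof.
move=> s3 S0 SN; apply: fcvg_uniq (PiS_cvg (- u) s3) _.
have h := @fcvg_bij _ *%R S S (fun w => fac w u) _ -%R -%R (@opprK _) (@opprK _) SN
  (PiS_cvg u s3).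
have := fcvgZ (-1) h; rewrite mulN1r; apply: fcvg_eq.
exists [fset 0]%fset => A sA; rewrite /= !prod_fac0 //.
rewrite (big_fset_split _ _ _ sA) /= [X in _ * (X * _)]big_mkcond big_seq_fset1 mem_set //.
rewrite {1}/fac oppr0 eqxx mulrA mulN1r; congr (_ * _).
apply: eq_bigr => w /andP[_]; rewrite inE => w0.
by rewrite /fac oppr_eq0 (negbTE w0) invrN mulrN mulNr.
Qed.

Section Shift.
Variables (S S' : set C) (t : C).
Hypotheses (s3 : sum3 S) (s3' : sum3 S') (SS : forall w, S' (w - t) <-> S w).

(** The exponents and the constant that turn [E2 ((u + t) / w)] into [E2 (u / (w - t))]. With
    [0^-1 = 0] the exponents are also right at [w = 0] and [w = t], where only the constant needs
    its own value; [3 / 2 = 1 + 1 / 2] is the exponent of [E2] at 1. *)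
Let lin w := w^-1 + t / w ^+ 2 - (w - t)^-1.
Let quad w := (w ^- 2 - (w - t) ^- 2) / 2.
Let cst w := if w == 0 then t else if w == t then - cexp (3 / 2) / t else E2 (t / w).

Lemma fac_shift w u : t != 0 ->
  fac w (u + t) = cst w * cexp (u * lin w + u ^+ 2 * quad w) * fac (w - t) u.
Proof.
move=> t0; rewrite /fac /lin /quad /cst; case: (eqVneq w 0) => [->|w0].
  have z2 : 0 ^+ 2 = 0 :> C by rewrite expr0n.
  rewrite sub0r oppr_eq0 (negbTE t0) /E2 z2 !invr0 !mulr0 !add0r.
  set P := _ + u ^+ 2 * _; set Q := _ + _ / 2.
  have PQ : cexp P * cexp Q = 1.
    by rewrite -cexpD (_ : P + Q = 0) ?cexp0 // /P /Q; field.
  rewrite [RHS](_ : _ = t * (1 - u / - t) * (cexp P * cexp Q)); last by ring.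
  by rewrite PQ; field.
rewrite subr_eq0; case: (eqVneq w t) => [->|wt].
  have z2 : 0 ^+ 2 = 0 :> C by rewrite expr0n.
  rewrite subrr z2 !invr0 !subr0 /E2.
  have -> : 1 - (u + t) / t = - (u / t) by field.
  have -> : (u + t) / t + ((u + t) / t) ^+ 2 / 2 =
     3 / 2 + (u * (t^-1 + t / t ^+ 2) + u ^+ 2 * (t ^- 2 / 2)) by field.
  by rewrite cexpD; move: (cexp _) (cexp _) => a b; field.
have wt' : w - t != 0 by rewrite subr_eq0.
rewrite /E2.
have -> : 1 - (u + t) / w = (1 - t / w) * (1 - u / (w - t)).
  by field; rewrite w0 wt'.
have -> : (u + t) / w + ((u + t) / w) ^+ 2 / 2 =
  (t / w + (t / w) ^+ 2 / 2) +
  (u * (w^-1 + t / w ^+ 2 - (w - t)^-1) + u ^+ 2 * ((w ^- 2 - (w - t) ^- 2) / 2))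
  + (u / (w - t) + (u / (w - t)) ^+ 2 / 2).
  by field; rewrite w0 wt'.
by rewrite !cexpD; ring.
Qed.

Lemma far_bounds (M : R) : exists A0, [/\ 0 \in A0, t \in A0 & forall w, S w -> w \notin A0 ->
  [/\ 0 < nm w, nm w / 2 <= nm (w - t) & nm t <= nm w / 2]].
Proof.
have [A0 hA0] := sum3_disc (2 * nm t) s3.
exists (t |` (0 |` A0))%fset; split; rewrite ?in_fset1U ?eqxx ?orbT //.
move=> w Sw; rewrite !in_fset1U !negb_or => /and3P[wt w0 wA].
have h := hA0 _ Sw wA; rewrite nm_gt0 w0.
by have := nmBge w t; split=> //; lra.
Qed.

Lemma lin_cvg : exists l, fcvg (fun A => \sum_(w <- A | w \in S) lin w) l.
Proof.
have [A0 [A00 A0t hA0]] := far_bounds 0.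
have K0 : 0 <= 2 * nm t ^+ 2 by rewrite mulr_ge0 ?exprn_ge0 ?nm_ge0.
apply: (@sum_cvg _ S setT A0 _ (fun w _ => lin w) s3 K0 _ 0) => // w _ Sw wA _.
have [w0 wt1 wt2] := hA0 w Sw wA.
have w0' : w != 0 by rewrite -nm_gt0.
have wt' : w - t != 0 by rewrite -nm_gt0; lra.
have -> : lin w = - t ^+ 2 / (w ^+ 2 * (w - t)).
  by rewrite /lin; field; rewrite w0' wt'.
rewrite nmM nmN nmV nmM !nmX wtM ler_pdivrMr; last by rewrite mulr_gt0 ?exprn_gt0 ?nm_gt0.
rewrite mulrAC ler_pdivlMr ?exprn_gt0 //.
have h : nm w ^+ 2 * nm w <= nm w ^+ 2 * (2 * nm (w - t)).
  by rewrite ler_wpM2l ?exprn_ge0 ?nm_ge0 //; lra.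
have T0 : 0 <= nm t ^+ 2 by rewrite exprn_ge0 ?nm_ge0.
by have := ler_wpM2l T0 h; rewrite -exprSr; lra.
Qed.

Lemma quad_cvg : exists l, fcvg (fun A => \sum_(w <- A | w \in S) quad w) l.
Proof.
have [A0 [A00 A0t hA0]] := far_bounds 0.
have K0 : 0 <= 5 * nm t by rewrite mulr_ge0 ?nm_ge0.
apply: (@sum_cvg _ S setT A0 _ (fun w _ => quad w) s3 K0 _ 0) => // w _ Sw wA _.
have [w0 wt1 wt2] := hA0 w Sw wA.
have w0' : w != 0 by rewrite -nm_gt0.
have wt' : w - t != 0 by rewrite -nm_gt0; lra.
have -> : quad w = t * (t - 2 * w) / (2 * w ^+ 2 * (w - t) ^+ 2).
  by rewrite /quad; field; rewrite w0' wt'.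
have p0 : 0 < nm w ^+ 3 by rewrite exprn_gt0.
have q0 : 0 < nm w ^+ 2 by rewrite exprn_gt0.
have r0 : 0 < nm (w - t) by lra.
rewrite nmM nmV (nmM t) (nmM (2 * _)) (nmM 2) !nmX nm_nat wtM ler_pdivrMr; last by rewrite !mulr_gt0 ?exprn_gt0.
rewrite mulrAC ler_pdivlMr //.
have h1 : nm (t - 2 * w) <= 5 / 2 * nm w by have := nmB t (2 * w); rewrite nmM nm_nat; lra.
have h2 : nm w ^+ 2 / 4 <= nm (w - t) ^+ 2.
  have -> : nm w ^+ 2 / 4 = (nm w / 2) ^+ 2 by field.
  by rewrite lerXn2r ?nnegrE ?nm_ge0 //; lra.
have h3 : nm (t - 2 * w) * nm w ^+ 3 <= 5 / 2 * nm w * nm w ^+ 3 by rewrite ler_wpM2r // ltW.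
have h4 : nm w ^+ 2 * (nm w ^+ 2 / 4) <= nm w ^+ 2 * nm (w - t) ^+ 2 by rewrite ler_wpM2l // ltW.
have e4 : nm w * nm w ^+ 3 = nm w ^+ 2 * nm w ^+ 2 by rewrite -exprS -exprD.
have h5 : nm (t - 2 * w) * nm w ^+ 3 <= 10 * (nm w ^+ 2 * nm (w - t) ^+ 2).
  by apply: le_trans h3 _; rewrite -mulrA e4; lra.
by have := ler_wpM2l (nm_ge0 t) h5; lra.
Qed.

Lemma cst_cvg : t != 0 -> exists2 l, l != 0 & fcvg (fun A => \prod_(w <- A | w \in S) cst w) l.
Proof.
move=> t0; have [A0 [K [K0 A00 hK]]] := fac_near (nm t) s3.
have hF w (u : C) : S w -> w \notin (t |` A0)%fset -> disc 0 u -> nm (cst w - 1) <= K * wt w.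
  rewrite in_fset1U negb_or => Sw /andP[wt wA] _.
  have w0 : w != 0 by apply: contraNneq wA => ->.
  by have := hK w t Sw wA (lexx _); rewrite /cst /fac (negbTE w0) (negbTE wt).
have d0 : disc 0 (0 : C) by rewrite /disc /mkset nm0.
have aF w : S w -> approx (disc 0) (fun=> cst w) by move=> _; exact: approx_cst.
have [l hl] := @prod_cvg _ S _ _ K 0 (fun w _ => cst w) s3 K0 hF (fun _ h => h) aF 0 d0.
exists l => //.
apply: (@prod_neq0 _ S _ _ K (fun w _ => cst w) s3 K0 hF 0 l d0 _ hl) => w _.
rewrite /cst; case: (eqVneq w 0) => // w0; case: (eqVneq w t) => [_|wt].
  by rewrite mulf_eq0 oppr_eq0 (negbTE (cexp_neq0 _)) invr_eq0.
by rewrite E2_eq0 -(inj_eq (mulIf w0)) divfK // mul1r eq_sym.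
Qed.

(** The correcting exponents [lin w] and [quad w] are of order [|w| ^ -3], hence summable under
    [sum3] alone. No group structure enters, so the lemma also applies to cosets of a sublattice. *)
Lemma PiS_shift : exists c a b : C, c != 0 /\
  forall u, PiS S (u + t) = c * cexp (a * u + b * u ^+ 2) * PiS S' u.
Proof.
have [t0|t0] := eqVneq t 0.
  have -> : S' = S.
    by apply/funext => w; apply/propext; rewrite -SS t0 subr0.
  exists 1, 0, 0; split=> [|u]; first exact: oner_neq0.
  by rewrite t0 !mul0r !addr0 cexp0 !mul1r.
have [c c0 hc] := cst_cvg t0; have [a ha] := lin_cvg; have [b hb] := quad_cvg.
exists c, a, b; split=> // u.
apply: fcvg_uniq (PiS_cvg (u + t) s3) _.
have hx := fcvgD (fcvgZ u ha) (fcvgZ (u ^+ 2) hb).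
have hs := @fcvg_bij _ *%R S S' (fun w => fac w u) _ (fun w => w - t) (fun w => w + t)
  (subrK t) (addrK t) SS (PiS_cvg u s3').
rewrite [a * u]mulrC [b * _]mulrC.
apply: fcvg_eq (fcvgM (fcvgM hc (fcvg_entire (@entire_cexp R) hx)) hs).
exists fset0 => A _; rewrite !mulr_sumr -big_split cexp_sum -!big_split /=.
by apply: eq_bigr => w _; rewrite fac_shift.
Qed.
End Shift.
End SigmaProduct.

(** * The series of wp and its poles *)

Section WpSeries.
Variable R : realType.
Local Notation C := R[i].
Implicit Types (S : set C) (A B : {fset C}) (u w z : C).

(* As [0^-1 = 0], the term [w = 0] is [u ^- 2]. *)
Definition pterm w u : C := (u - w) ^- 2 - w ^- 2.

Lemma pterm_le w u : w != 0 -> 2 * nm u <= nm w -> nm (pterm w u) <= 10 * nm u * wt w.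
Proof.
move=> w0 uw; have u0 := nm_ge0 u.
have nw : 0 < nm w by rewrite nm_gt0.
have nuw : nm w / 2 <= nm (u - w) by rewrite nmBC; have := nmBge w u; lra.
have uw0 : u - w != 0 by rewrite -nm_gt0; lra.
have -> : pterm w u = u * (2 * w - u) / ((u - w) ^+ 2 * w ^+ 2).
  by rewrite /pterm; field; rewrite w0 uw0.
have q0 : 0 < nm w ^+ 2 by rewrite exprn_gt0.
have r0 : 0 < nm (u - w) by lra.
rewrite nmM nmV (nmM u) (nmM (_ ^+ 2)) !nmX wtM ler_pdivrMr; last by rewrite !mulr_gt0 ?exprn_gt0.
rewrite mulrAC ler_pdivlMr ?exprn_gt0 //.
have h1 : nm (2 * w - u) <= 5 / 2 * nm w by have := nmB (2 * w) u; rewrite nmM nm_nat; lra.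
have h2 : nm w ^+ 2 / 4 <= nm (u - w) ^+ 2.
  have -> : nm w ^+ 2 / 4 = (nm w / 2) ^+ 2 by field.
  by rewrite lerXn2r ?nnegrE ?nm_ge0 //; lra.
have h3 : nm (2 * w - u) * nm w ^+ 3 <= 5 / 2 * nm w * nm w ^+ 3.
  by rewrite ler_wpM2r // exprn_ge0 // ltW.
have h4 := ler_wpM2r (ltW q0) h2.
have e4 : nm w * nm w ^+ 3 = nm w ^+ 2 * nm w ^+ 2 by rewrite -exprS -exprD.
have h5 : nm (2 * w - u) * nm w ^+ 3 <= 10 * (nm (u - w) ^+ 2 * nm w ^+ 2).
  by apply: le_trans h3 _; rewrite -mulrA e4; lra.
by have := ler_wpM2l u0 h5; lra.
Qed.

Lemma pterm_near S (r : R) : sum3 S -> exists A0 (K : R), [/\ 0 <= K, 0 \in A0,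
  (forall w, S w -> w \notin A0 -> 2 * r <= nm w) &
  forall w u, S w -> w \notin A0 -> disc r u -> nm (pterm w u) <= K * wt w].
Proof.
move=> s3; have [A0 hA0] := sum3_disc (2 * r) s3.
exists (0 |` A0)%fset, (10 * `|r|); split; rewrite ?fset1U1 ?mulr_ge0 //.
  by move=> w Sw; rewrite in_fset1U negb_or => /andP[w0 wA]; apply/ltW/hA0.
move=> w u Sw; rewrite in_fset1U negb_or => /andP[w0 wA] ur.
have ur' : nm u <= r by [].
apply: le_trans (pterm_le w0 _) _; first by have := hA0 w Sw wA; lra.
by rewrite ler_wpM2r ?wt_ge0 // ler_wpM2l // (le_trans ur') // ler_norm.
Qed.

Lemma wp_cvg S u : sum3 S -> S 0 -> fcvg (fun A => \sum_(w <- A | w \in S) pterm w u) (wp S u).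
Proof.
move=> s3 S0; have s3' : sum3 (S `\ 0) by apply: sum3_sub s3 => x [].
have [A0 [K [K0 _ _ h]]] := pterm_near (nm u) s3'.
have [l hl] := sum_cvg s3' K0 h (lexx (nm u)).
have -> : wp S u = u ^- 2 + l by rewrite /wp (fcvg_lim hl).
apply: fcvg_eq (fcvgD (fcvg_cst (u ^- 2)) hl); exists [fset 0]%fset => A sA /=.
rewrite [RHS](big_fset_split _ _ _ sA) /= [X in _ = X + _]big_mkcond big_seq_fset1 mem_set //.
congr (_ + _); first by rewrite /pterm subr0 expr0n invr0 subr0.
by apply: eq_bigl => w; rewrite in_fset1; apply/idP/andP; rewrite !inE => -[Sw /eqP w0].
Qed.

Lemma wp_even S u : sum3 S -> S 0 -> (forall w, S (- w) <-> S w) -> wp S (- u) = wp S u.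
Proof.
move=> s3 S0 SN; apply: fcvg_uniq (wp_cvg (- u) s3 S0) _.
have := @fcvg_bij _ _ +%R S S (fun w => pterm w u) _ -%R -%R (@opprK _) (@opprK _) SN
  (wp_cvg u s3 S0).
apply: fcvg_eq; exists fset0 => A _ /=; apply: eq_bigr => w _.
by rewrite /pterm opprK -opprD !sqrrN.
Qed.

(** Reindexing the differences shows that a translation by [v] changes wp by a constant; evenness
    makes this constant 0. No derivative is involved. *)
Lemma wp_period S u v : sum3 S -> S 0 ->
  (forall w w', S w -> S w' -> S (w - w')) -> S v -> wp S (u + v) = wp S u.
Proof.
move=> s3 S0 SB Sv.
have SN w : S (- w) <-> S w.
  by split=> /(SB _ _ S0); rewrite sub0r ?opprK.
have shift w : S (w - v) <-> S w.
  split=> [Sw|Sw]; last exact: SB.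
  have -> : w = (w - v) - (- v) by rewrite opprK subrK.
  by apply: SB => //; apply/SN.
have diff x y : wp S (x + v) - wp S (y + v) = wp S x - wp S y.
  have cv a b := fcvgD (wp_cvg a s3 S0) (fcvgZ (-1) (wp_cvg b s3 S0)).
  have cvD a b : fcvg (fun A => \sum_(w <- A | w \in S) ((a - w) ^- 2 - (b - w) ^- 2))
      (wp S a - wp S b).
    rewrite -[- wp S b]mulN1r; apply: fcvg_eq (cv a b); exists fset0 => A _ /=.
    rewrite mulN1r -sumrB; apply: eq_bigr => w _.
    by rewrite /pterm opprB addrA subrK.
  have := @fcvg_bij _ _ +%R S S _ _ (fun w => w - v) (fun w => w + v)
    (subrK v) (addrK v) shift (cvD x y).
  move=> h; apply: fcvg_uniq (cvD _ _) _; apply: fcvg_eq h; exists fset0 => A _ /=.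
  by apply: eq_bigr => w _; rewrite !opprB !addrA.
(* For this pair the translation exchanges the two points up to sign, so the constant equals its own
   opposite. *)
have := diff u (- u - v); rewrite subrK -opprD !wp_even // => h.
have : (wp S (u + v) - wp S u) *+ 2 = 0.
  by rewrite mulr2n {2}h; ring.
by move/eqP; rewrite mulrn_eq0 /= subr_eq0 => /eqP.
Qed.

Lemma approx_inv w (r : R) : 0 < r -> 2 * r <= nm w ->
  approx (disc r) (fun u => (u - w)^-1).
Proof.
move=> r0 rw e e0; have w0 : w != 0 by rewrite -nm_gt0; lra.
have nw : 0 < nm w by rewrite nm_gt0.
have [N hN] := ivn_small (mulr_gt0 e0 r0).
exists (- \poly_(i < N.+1) (w^-1) ^+ i.+1) => u ur.
have ur' : nm u <= r by [].
have uw0 : u - w != 0 by rewrite -nm_gt0 nmBC; have := nmBge w u; lra.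
have nuw : r <= nm (u - w) by rewrite nmBC; have := nmBge w u; lra.
rewrite hornerN opprK horner_poly.
have -> : (u - w)^-1 + \sum_(i < N.+1) w^-1 ^+ i.+1 * u ^+ i = (u / w) ^+ N.+1 / (u - w).
  apply: (mulIf uw0); rewrite mulrDl mulVf // divfK //.
  have -> : \sum_(i < N.+1) w^-1 ^+ i.+1 * u ^+ i = w^-1 * \sum_(i < N.+1) (u / w) ^+ i.
    rewrite mulr_sumr; apply: eq_bigr => i _; rewrite exprS exprMn; ring.
  have h : (u / w) ^+ N.+1 = 1 + (u / w - 1) * \sum_(i < N.+1) (u / w) ^+ i.
    by rewrite -subrX1 addrC subrK.
  by rewrite h; move: (\sum_(i < _) _) => s; field.
rewrite nmM nmV nmX nmM nmV.
have x0 : 0 <= nm u / nm w by rewrite divr_ge0 ?nm_ge0.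
have x1 : nm u / nm w <= 1 / 2 by rewrite ler_pdivrMr //; lra.
have hp : (nm u / nm w) ^+ N.+1 <= ivn R N.
  apply: le_trans (_ : (1 / 2) ^+ N.+1 <= _).
    by rewrite lerXn2r ?nnegrE //; lra.
  rewrite div1r exprVn /ivn lef_pV2 ?posrE ?exprn_gt0 ?ltr0n //.
  by rewrite -natrX ler_nat ltnW // ltn_expl.
rewrite ler_pdivrMr; last by lra.
apply: le_trans hp (le_trans (hN N (leqnn N)) _).
by rewrite ler_wpM2l // ltW.
Qed.

Lemma approx_pterm w (r : R) : 0 < r -> 2 * r <= nm w -> approx (disc r) (pterm w).
Proof.
move=> r0 rw; apply: (@approx_eq _ _ (fun u => (u - w)^-1 ^+ 2 + (- w ^- 2))).
  by move=> u _; rewrite exprVn.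
apply: approxD; last exact: approx_cst.
by apply: (@approxX _ _ r) => //; exact: approx_inv.
Qed.

(* Near the disc only finitely many terms of the series are singular, and each
   of these poles is cancelled by a zero of the corresponding factor of the
   product. *)
Lemma wp_extend S : sum3 S -> S 0 ->
  exists2 H, entire H & forall u, ~ S u -> H u = PiS S u ^+ 2 * wp S u.
Proof.
move=> s3 S0; apply: (@entire_extend _ S); first by move=> z e; exact: sum3_dense.
move=> r00; pose r := `|r00| + 1.
have r0 : 0 < r by rewrite ltr_wpDl.
pose D := disc r `\` S; have sD : D `<=` disc r by move=> z [].
suff : approx D (fun u => PiS S u ^+ 2 * wp S u).
  apply: approx_sub => z [zr Sz]; split => //.
  by rewrite /disc /= (le_trans zr) // (le_trans (ler_norm _)) // lerDl.
have [A0 [K [K0 A00 far hK]]] := pterm_near r s3.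
pose S' := S `\` [set` A0].
have s3' : sum3 S' by apply: sum3_sub s3 => z [].
pose T u := wp S u - \sum_(w <- A0 | w \in S) pterm w u.
have memS' w : (w \in S') = (w \in S) && (w \notin A0).
  by apply/idP/andP; rewrite !inE => -[Sw wA]; split=> //; [apply/negP | move: wA => /negP].
have cvT u : fcvg (fun A => \sum_(w <- A | w \in S') pterm w u) (T u).
  apply: fcvg_eq (fcvgD (wp_cvg u s3 S0) (fcvg_cst (- \sum_(w <- A0 | w \in S) pterm w u))).
  exists A0 => A sA /=; rewrite (big_fset_split _ _ _ sA) /= addrAC subrr add0r.
  by apply: eq_bigl => w; rewrite memS'.
have aT : approx D T.
  apply: (@sum_approx _ S' D A0 K r pterm s3' K0) => //.
    by move=> w u [Sw _] wA [ur _]; exact: hK.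
  move=> w [Sw /negP wA]; apply: approx_sub (approx_pterm r0 _); first by move=> z [].
  exact: far.
have ePi := entire_PiS s3; have ePi' := entire_PiS s3'.
have PiE u : PiS S u = (\prod_(w <- A0 | w \in S) fac w u) * PiS S' u.
  apply: fcvg_uniq (PiS_cvg u s3) _.
  apply: fcvg_eq (fcvgZ _ (PiS_cvg u s3')); exists A0 => A sA /=.
  by rewrite [RHS](big_fset_split _ _ _ sA) /=; congr (_ * _); apply: eq_bigl => w; rewrite memS'.
(* [g w] is the zero-free cofactor of [u - w] in [fac w]; its square is what remains of
   [fac w u ^+ 2] against the double pole at [w]. *)
pose g w u := if w == 0 then 1 else - w^-1 * cexp (u / w + (u / w) ^+ 2 / 2).
have gE w u : fac w u = (u - w) * g w u.
  rewrite /fac /g; case: (eqVneq w 0) => [->|w0]; first by rewrite subr0 mulr1.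
  by rewrite /E2 mulrA; congr (_ * _); field.
have eg w : entire (g w).
  rewrite /g; case: eqP => _; first exact: entire_cst.
  apply: entireM; first exact: entire_cst.
  apply: entire_eq (entire_comp (w^-1 *: 'X + 2^-1 *: (w^-1 *: 'X) ^+ 2) (@entire_cexp R)) => u.
  by rewrite hornerD !hornerZ horner_exp hornerZ hornerX [w^-1 * _]mulrC [2^-1 * _]mulrC.
have epart w u : u != w -> w \in A0 -> w \in S ->
    (\prod_(w <- A0 | w \in S) fac w u) ^+ 2 * pterm w u =
    (g w u * \prod_(x <- A0 | (x \in S) && (x \notin [fset w]%fset)) fac x u) ^+ 2 -
    (\prod_(w <- A0 | w \in S) fac w u) ^+ 2 * w ^- 2.
  move=> uw wA wS; rewrite /pterm mulrBr; congr (_ - _).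
  have sw : ([fset w] `<=` A0)%fset by rewrite fsub1set.
  rewrite (big_fset_split _ _ _ sw) /=.
  rewrite (_ : \prod_(x <- [fset w]%fset | x \in S) fac x u = (u - w) * g w u); last first.
    by rewrite big_mkcond big_seq_fset1 wS gE.
  have uw0 : u - w != 0 by rewrite subr_eq0.
  by move: (g w u) (\prod_(x <- A0 | _) _) => x y; field.
apply: (@approx_eq _ _ (fun u => PiS S' u ^+ 2 * (\sum_(w <- A0 | w \in S)
   ((g w u * \prod_(x <- A0 | (x \in S) && (x \notin [fset w]%fset)) fac x u) ^+ 2 -
    (\prod_(w <- A0 | w \in S) fac w u) ^+ 2 * w ^- 2)) + PiS S u ^+ 2 * T u)).
  move=> u [ur Su].
  rewrite [X in _ * X + _](_ : _ = (\prod_(w <- A0 | w \in S) fac w u) ^+ 2 *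
     \sum_(w <- A0 | w \in S) pterm w u); last first.
    rewrite mulr_sumr big_seq_cond [RHS]big_seq_cond; apply: eq_bigr => w /andP[wA wS].
    rewrite epart //; apply/eqP => uw; apply: Su; rewrite uw.
    by move: wS; rewrite inE.
  by rewrite /T PiE; ring.
apply: approxD; last first.
  by apply: (approxM sD) => //; apply: (approxX _ sD); apply: approx_sub (ePi r).
apply: (approxM sD); first by apply: (approxX _ sD); apply: approx_sub (ePi' r).
apply: approx_sub sD _; apply: approx_sum => w _.
apply: approxD.
  apply: (@approxX _ _ r) => //; apply: (@approxM _ _ r) => //; first exact: eg.
  by apply: (@approx_prod _ _ r) => // x _; exact: entire_fac.
apply: (@approx_eq _ _ (fun u => (\prod_(x <- A0 | x \in S) fac x u) ^+ 2 * - w ^- 2)).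
  by move=> u _; rewrite mulrN.
apply: (@approxM _ _ r) => //; last exact: approx_cst.
apply: (@approxX _ _ r) => //; apply: (@approx_prod _ _ r) => // x _; exact: entire_fac.
Qed.

(** A single term is bounded by the total, which bounds [nm w ^+ 3] below; enlarging [M] to at least
    1 lets [M'^-1] replace its cube root. *)
Lemma sum3_gap S : sum3 S -> exists2 d : R, 0 < d & forall w, S w -> w != 0 -> d <= nm w.
Proof.
move=> [M hM]; pose M' := Num.max M 1.
have M1 : 1 <= M' by rewrite le_max lexx orbT.
have M0 : 0 < M' by lra.
exists M'^-1; rewrite ?invr_gt0 // => w Sw w0.
have := hM [fset w]%fset; rewrite big_mkcond big_seq_fset1 mem_set // => h.
have nw : 0 < nm w by rewrite nm_gt0.
have {}h : M'^-1 <= nm w ^+ 3.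
  by rewrite -[_ ^+ 3]invrK lef_pV2 ?posrE ?invr_gt0 ?exprn_gt0 // (le_trans h) // le_max lexx.
have m1 : M'^-1 <= 1 by rewrite invf_le1.
have [//|lt1] := leP (M'^-1) (nm w).
have : nm w ^+ 3 <= nm w.
  by rewrite -[leRHS]expr1 ler_wiXn2l ?nm_ge0 //; lra.
lra.
Qed.

(** Near 0 the pole [u ^- 2] dominates: for [nm u <= d / 4] the other terms sum to at most
    [10 * d * W]. *)
Lemma wp_large S (M : R) : sum3 S -> S 0 -> exists2 r, 0 < r &
  forall u, u != 0 -> nm u <= r -> ~ S u /\ M <= nm (wp S u).
Proof.
move=> s3 S0; have [d d0 hd] := sum3_gap s3; have [W hW] := s3.
have W0 : 0 <= W by have := hW fset0; rewrite big_mkcond big_seq_fset0.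
pose B := 10 * d * W + `|M| + 1.
have B1 : 1 <= B by rewrite lerDr addr_ge0 // mulr_ge0 //; lra.
exists (Num.min (d / 4) B^-1); first by rewrite lt_min invr_gt0; lra.
move=> u u0; rewrite le_min => /andP[ud uB].
have nu : 0 < nm u by rewrite nm_gt0.
split; first by move=> /hd/(_ u0); lra.
have h : nm (wp S u - u ^- 2) <= 10 * d * W.
  apply: fcvg_nm_le (fcvgD (wp_cvg u s3 S0) (fcvg_cst (- u ^- 2))) _.
  exists [fset 0]%fset => A sA /=.
  rewrite (big_fset_split _ _ _ sA) /= [X in X + _ + _]big_mkcond big_seq_fset1 mem_set //.
  rewrite {1}/pterm subr0 expr0n invr0 subr0 addrAC subrr add0r.
  apply: le_trans (nm_sum _ _ _) _.
  apply: (@le_trans _ _ (10 * d * \sum_(w <- A | w \in S) wt w)); last first.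
    by rewrite ler_wpM2l //; lra.
  rewrite mulr_sumr [leRHS](bigID (fun w => w \notin [fset 0]%fset)) /= -[leLHS]addr0.
  apply: lerD; last by apply: sumr_ge0 => *; rewrite mulr_ge0 ?wt_ge0 //; lra.
  apply: ler_sum => w /andP[]; rewrite inE in_fset1 => Sw w0.
  have := hd w Sw w0 => dw; apply: le_trans (pterm_le w0 _) _; first lra.
  by rewrite ler_wpM2r ?wt_ge0 //; lra.
have h2 : B <= nm (u ^- 2).
  rewrite nmV nmX -[leLHS]invrK lef_pV2 ?posrE ?invr_gt0 ?exprn_gt0 //; last lra.
  apply: (le_trans _ uB); rewrite expr2 ler_piMr ?nm_ge0 // (le_trans uB) // invf_le1 //; lra.
have := nmBge (u ^- 2) (wp S u); rewrite nmBC in h.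
have := nmBge (u ^- 2) (u ^- 2 - wp S u); rewrite subKr.
by have := ler_norm M; rewrite /B in h2 *; lra.
Qed.
End WpSeries.

(** * Algebraic dependence of theta functions *)

Section Theta.
Variable R : realType.
Local Notation C := R[i].
Implicit Types (S : set C) (u w z : C).

Lemma entire_off0 S (f : C -> C) : sum3 S -> entire f -> (forall u, ~ S u -> f u = 0) ->
  forall u, f u = 0.
Proof.
move=> s3 hf h u; apply: nm_eps0 => e e0.
have [d d0 hd] := entire_cont u hf e0.
have [w Sw wu] := sum3_dense u s3 d0.
by have := hd w wu; rewrite h // sub0r nmN.
Qed.

Lemma entire_off_eq S (f g : C -> C) : sum3 S -> entire f -> entire g ->
  (forall u, ~ S u -> f u = g u) -> forall u, f u = g u.
Proof.
move=> s3 hf hg h u; apply/eqP; rewrite -subr_eq0; apply/eqP.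
apply: (entire_off0 s3 (entireD hf (entireN hg))) => z Sz.
by rewrite h // subrr.
Qed.

(* The axioms of a lattice of C that are used: discreteness enters through
   [sum3], the rank through cocompactness. *)
Definition latt S := [/\ sum3 S, S 0, (forall w w', S w -> S w' -> S (w - w')) &
  exists2 r : R, 0 < r & forall u, exists2 l, S l & nm (u - l) <= r].

Lemma lattN S w : latt S -> S (- w) <-> S w.
Proof. by move=> [_ S0 SB _]; split=> /(SB _ _ S0); rewrite sub0r ?opprK. Qed.

Lemma lattD S w w' : latt S -> S w -> S w' -> S (w + w').
Proof.
move=> lS Sw Sw'; rewrite -[w']opprK; have [_ _ SB _] := lS.
by apply: SB => //; apply/lattN.
Qed.

(** Applying the translation formula at [u] and at [- u - l], with oddness, shows that
    [c ^+ 2 * cexp (q u)] is identically 1; a quadratic [q] would be nonconstant. *)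
Lemma PiS_period S l : latt S -> S l -> exists c a : C, c != 0 /\
  forall u, PiS S (u + l) = c * cexp (a * u) * PiS S u.
Proof.
move=> lS Sl; have [s3 S0 SB _] := lS.
have SS w : S (w - l) <-> S w.
  split=> [h|h]; last exact: SB.
  by have := lattD lS h Sl; rewrite subrK.
have [c [a [b [c0 h]]]] := PiS_shift s3 s3 SS.
have odd u := PiS_odd u s3 S0 (fun w => lattN w lS).
suff b0 : b = 0.
  by exists c, a; split=> // u; rewrite h b0 mul0r addr0.
pose q u := - (a * l) + b * ((u + l) ^+ 2 + u ^+ 2).
have key u : c ^+ 2 * cexp (q u) - 1 = 0.
  apply: (@entire_off0 S (fun u => c ^+ 2 * cexp (q u) - 1) s3) => [|{}u Su].
    apply: entireD; last exact: entire_cst.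
    apply: entireM; first exact: entire_cst.
    pose p : {poly C} := (- (a * l))%:P + b *: (('X + l%:P) ^+ 2 + 'X ^+ 2).
    apply: entire_eq (entire_comp p (@entire_cexp R)) => z.
    by rewrite /p hornerD hornerC hornerZ hornerD !horner_exp hornerD hornerC hornerX.
  have Pu : PiS S u != 0 by apply/eqP => /(PiS_eq0 u s3).
  apply: (mulIf Pu); rewrite mul0r mulrBl mul1r; apply/eqP; rewrite subr_eq0; apply/eqP.
  have := h (- u - l); rewrite subrK -opprD !odd mulrN => /oppr_inj e.
  rewrite [RHS]e h mulrA mulrACA -expr2 -cexpD; congr (_ * cexp _ * _).
  by rewrite /q; ring.
apply/eqP/negPn/negP => b0.
(* [v] solves [q v = q 0 + 1], which contradicts [cexp 1 != 1]. *)
pose v := (- l + sqrtC (l ^+ 2 + 2 / b)) / 2.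
have vE : b * ((v + l) ^+ 2 + v ^+ 2) = b * l ^+ 2 + 1.
  have -> : b * ((v + l) ^+ 2 + v ^+ 2) = b * ((l ^+ 2 + sqrtC (l ^+ 2 + 2 / b) ^+ 2) / 2).
    by rewrite /v; field.
  by rewrite sqrtCK; field.
have := key v; have := key 0; rewrite /q vE add0r expr0n addr0 addrA [cexp (_ + 1)]cexpD.
move=> /eqP; rewrite subr_eq0 => /eqP k0; rewrite mulrA k0 mul1r => /eqP.
rewrite subr_eq0 => /eqP/cexp_eq1 /= /eqP.
by rewrite oner_eq0.
Qed.

(** Cauchy's bound on the circle of radius [3 * r] makes the [k]-th term at most [M / 3 ^ k] on the
    disc of radius [r], and the series starts at [m]. *)
Lemma schwarz_bound (f : C -> C) a (M r : R) m : 0 < r -> 0 <= M -> taylor f a ->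
  (forall k, (k < m)%N -> a k = 0) ->
  (forall u, nm u = 3 * r -> nm (f u) <= M) ->
  forall u, nm u <= r -> nm (f u) <= 2 * M * (1 / 3) ^+ m.
Proof.
move=> r0 M0 ta a0 hM u ur; have t0 : 0 <= 1 / 3 :> R by lra.
have r30 : 0 < 3 * r by lra.
have hk k : nm (a k * u ^+ k) <= M * (1 / 3) ^+ k.
  have h := taylor_cauchy k r30 ta hM; rewrite exprMn in h.
  rewrite nmM nmX; have h2 : nm u ^+ k <= r ^+ k by rewrite lerXn2r ?nnegrE ?nm_ge0 // ltW.
  apply: le_trans (ler_wpM2l (nm_ge0 _) h2) _.
  rewrite expr_div_n expr1n mulrA mulr1 ler_pdivlMr ?exprn_gt0 //.
  by rewrite -mulrA [r ^+ k * _]mulrC.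
apply/ler_addgt0Pr => e e0; have [N hN] := ta r e r0 e0.
have := hN N (leqnn N) u ur => h1.
have h2 : nm (\sum_(k < N) a k * u ^+ k) <= 2 * M * (1 / 3) ^+ m.
  apply: le_trans (nm_sum _ _ _) _.
  (* The induction on [N] needs the exact truncated geometric series; it is 0 as long as
     [N <= m]. *)
  suff : \sum_(k < N) nm (a k * u ^+ k) <= 3 / 2 * M * ((1 / 3) ^+ m - (if (N <= m)%N then (1/3) ^+ m else (1 / 3) ^+ N)).
    move=> h; apply: le_trans h _.
    have : 0 <= M * (1 / 3) ^+ m by rewrite mulr_ge0 ?exprn_ge0.
    have : 0 <= M * (if (N <= m)%N then (1/3) ^+ m else (1 / 3) ^+ N).
      by rewrite mulr_ge0 //; case: ifP; rewrite exprn_ge0.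
    lra.
  elim: {h1 hN} N => [|N IH]; first by rewrite big_ord0 leq0n subrr mulr0.
  rewrite big_ord_recr /=; case: (ltnP N m) => Nm.
    by move: IH; rewrite (ltnW Nm) a0 // mul0r nm0 addr0.
  apply: le_trans (lerD IH (hk N)) _; rewrite exprS.
  move: Nm; rewrite leq_eqVlt => /orP[/eqP <-|Nm]; first by rewrite leqnn; lra.
  by rewrite leqNgt Nm /=; lra.
have := nmDge (\sum_(k < N) a k * u ^+ k) (f u - \sum_(k < N) a k * u ^+ k).
have := nmD (\sum_(k < N) a k * u ^+ k) (f u - \sum_(k < N) a k * u ^+ k).
by rewrite addrC subrK; lra.
Qed.

Lemma wide_kernel (F : fieldType) n m (A : 'M[F]_(n, m)) : (m < n)%N ->
  exists2 x : 'rV[F]_n, x != 0 & x *m A = 0.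
Proof.
move=> mn; have : kermx A != 0.
  rewrite -mxrank_eq0 mxrank_ker subn_eq0 -ltnNge.
  exact: leq_ltn_trans (rank_leq_col A) mn.
move=> /rowV0Pn[x xk x0]; exists x => //.
exact/sub_kermxP.
Qed.

(** A point of modulus at most [3 * r] is moved into the disc of radius [r] by a lattice point of
    modulus at most [4 * r]. There are finitely many of these, and each factor of automorphy is
    bounded on the small disc. The same [k] serves every [E i], so a monomial of degree [n] picks up
    [k ^+ n]. *)
Lemma theta_bound S (I : finType) (E : I -> C -> C) : latt S ->
  (forall l, S l -> exists2 c, entire c & forall i u, E i (u + l) = c u * E i u) ->
  exists (r A : R), [/\ 0 < r, 1 <= A & forall z, nm z <= 3 * r ->
    exists k y, [/\ nm k <= A, nm y <= r & forall i, E i z = k * E i y]].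
Proof.
move=> [s3 S0 SB [r r0 hr]] hE; have [A0 hA0] := sum3_disc (4 * r) s3.
have [A A1 hA] : exists2 A : R, 1 <= A & forall l, l \in enum_fset A0 -> S l -> forall u, nm u <= r ->
    exists2 k, nm k <= A & forall i, E i (u + l) = k * E i u.
  elim: (enum_fset A0) => [|l s [A A1 IH]]; first by exists 1.
  have [Sl|Sl] := pselect (S l); last first.
    exists A => // l'; rewrite inE => /orP[/eqP -> //|]; exact: IH.
  have [c ec hc] := hE l Sl; have [B B0 hB] := entire_bounded r ec.
  exists (A + B) => [|l']; first lra.
  rewrite inE => /orP[/eqP -> _ u ur|l's Sl' u ur].
    by exists (c u) => // ; have := hB u ur; lra.
  by have [k kA hk] := IH l' l's Sl' u ur; exists k => //; lra.
exists r, A; split=> // z zr; have [l Sl lz] := hr z.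
have lA : l \in A0.
  apply/negPn/negP => /(hA0 _ Sl); have := nmB z (z - l); rewrite subKr; lra.
have [k kA hk] := hA l lA Sl (z - l) lz.
by exists k, (z - l); split=> // i; rewrite -hk subrK.
Qed.

(* Theta functions of weight [n] for a fixed factor of automorphy are determined
   by O(n) Taylor coefficients at 0, whereas there are about [n ^ 2 / 4]
   monomials below. *)
Lemma theta_dep S (E : 'I_3 -> C -> C) : latt S -> (forall i, entire (E i)) ->
  (forall l, S l -> exists2 c, entire c & forall i u, E i (u + l) = c u * E i u) ->
  exists d (Q : 'I_d.+1 * 'I_d.+1 -> C), (exists t, Q t != 0) /\
    forall u, \sum_t Q t * (E 1 u ^+ t.1 * E 2%:R u ^+ t.2 * E 0 u ^+ (d - t.1 + (d - t.2))) = 0.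
Proof.
move=> lS eE hE; have [r [A [r0 A1 hA]]] := theta_bound lS hE.
have [L0 hL0] := nat_ge A; pose L := L0.+1.
have AL : A <= 3 ^+ L.
  apply: le_trans (hL0 L (leqnSn _)) _.
  by rewrite -natrX ler_nat ltnW // ltn_expl.
(* Quasi-periodicity costs [A ^+ n <= 3 ^ (L * n)] and the Schwarz lemma gains [3 ^ m]; the extra 2
   in [m] leaves 2/9 < 1/2. With [d = 2 * L] there are [4 L^2 + 4 L + 1] monomials for
   [m = 4 L^2 + 2] conditions, so [L >= 1] suffices. *)
pose d := (2 * L)%N; pose n := (d + d)%N; pose m := (L * n + 2)%N.
pose T : finType := ('I_d.+1 * 'I_d.+1)%type.
pose mon (t : T) u := E 1 u ^+ t.1 * E 2%:R u ^+ t.2 * E 0 u ^+ (d - t.1 + (d - t.2)).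
have emon t : entire (mon t).
  by apply: entireM; [apply: entireM|]; apply: entireX.
have /choice[a ha] : forall t, exists a, taylor (mon t) a by move=> t; exact: entire_taylor.
pose M := \matrix_(p < #|T|, k < m) a (enum_val p) k.
have mT : (m < #|T|)%N.
  by rewrite card_prod !card_ord /m /n /d /L; lia.
have [x x0 xM] := wide_kernel M mT.
pose Q t := x 0 (enum_rank t).
exists d, Q; split.
  have [p xp] : exists p, x 0 p != 0.
    apply: contrapT => h; move/eqP: x0; apply; apply/rowP => p; rewrite mxE.
    by apply/eqP/negPn/negP => xp; apply: h; exists p.
  by exists (enum_val p); rewrite /Q enum_valK.
pose f u := \sum_t Q t * mon t u.
have ef : entire f by apply: entire_sum => t _; apply: entireM => //; exact: entire_cst.
have tf : taylor f (fun k => \sum_t Q t * a t k).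
  by apply: taylor_sum => t; exact: taylorZ.
have f0 k : (k < m)%N -> \sum_t Q t * a t k = 0.
  move=> km; have := congr1 (fun y : 'rV_m => y 0 (Ordinal km)) xM; rewrite !mxE; apply: etrans.
  rewrite (reindex (@enum_val T (mem T))) /=; last first.
    by apply: onW_bij; exact: enum_val_bij.
  by apply: eq_bigr => p _; rewrite mxE /Q enum_valK.
have fper z : nm z <= 3 * r -> exists y, nm y <= r /\ nm (f z) <= A ^+ n * nm (f y).
  move=> /hA[k [y [kA yr hk]]]; exists y; split=> //.
  have -> : f z = k ^+ n * f y.
    rewrite /f mulr_sumr; apply: eq_bigr => -[i j] _; rewrite /mon /= !hk !exprMn.
    have -> : k ^+ n = k ^+ i * k ^+ j * k ^+ (d - i + (d - j)).
      rewrite -!exprD; congr (_ ^+ _); have := ltn_ord i; have := ltn_ord j.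
      by rewrite !ltnS /n => jd id; move: (nat_of_ord i) (nat_of_ord j) jd id => a' b'; lia.
    by ring.
  rewrite nmM nmX ler_wpM2r ?nm_ge0 // lerXn2r ?nnegrE ?nm_ge0 //; lra.
have An : A ^+ n <= 3 ^+ (L * n) by rewrite exprM lerXn2r ?nnegrE //; lra.
(* Any bound of [f] on the disc of radius [r] can be halved, so [f] vanishes there. *)
have half B : 0 <= B -> (forall u, nm u <= r -> nm (f u) <= B) ->
    forall u, nm u <= r -> nm (f u) <= B / 2.
  move=> B0 hB u ur.
  have AB0 : 0 <= A ^+ n * B by rewrite mulr_ge0 // exprn_ge0 //; lra.
  have := schwarz_bound r0 AB0 tf f0 _ ur.
  have -> : 2 * (A ^+ n * B) * (1 / 3) ^+ m = 2 / 9 * B * (A ^+ n / 3 ^+ (L * n)).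
    have X0 : 3 ^+ (L * n) != 0 :> R by rewrite expf_neq0 // pnatr_eq0.
    have -> : (1 / 3) ^+ m = (1 / 3 / 3) / 3 ^+ (L * n) :> R.
      by rewrite /m addnC exprD !div1r !exprVn expr2 invfM.
    by move: (3 ^+ (L * n)) X0 => X X0; field.
  move=> h; apply: le_trans (h _) _.
    move=> z zr; have [|y [yr fy]] := fper z; first by rewrite zr.
    apply: le_trans fy _; rewrite ler_wpM2l ?hB // exprn_ge0 //; lra.
  have : A ^+ n / 3 ^+ (L * n) <= 1 by rewrite ler_pdivrMr ?exprn_gt0 // mul1r.
  have : 0 <= A ^+ n / 3 ^+ (L * n) by rewrite divr_ge0 ?exprn_ge0 //; lra.
  by move: (A ^+ n / _) => x' ? ?; nra.
have [B B0 hB] := entire_bounded r ef.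
have iter j u : nm u <= r -> nm (f u) <= B * (1 / 2) ^+ j.
  elim: j u => [|j IH] u ur; first by rewrite expr0 mulr1 hB.
  have Bj : 0 <= B * (1 / 2) ^+ j by rewrite mulr_ge0 // exprn_ge0 //; lra.
  by apply: le_trans (half _ Bj IH u ur) _; rewrite exprSr; lra.
have fr u : nm u <= r -> f u = 0.
  move=> ur; apply: nm_eps0 => e e0.
  have B10 : 0 < B + 1 by lra.
  have [N hN] := ivn_small (divr_gt0 e0 B10).
  apply: le_trans (iter N.+1 u ur) _.
  have : (1 / 2) ^+ N.+1 <= ivn R N.
    rewrite div1r exprVn /ivn lef_pV2 ?posrE ?exprn_gt0 ?ltr0n //.
    by rewrite -natrX ler_nat ltnW // ltn_expl.
  have := hN N (leqnn _); rewrite ler_pdivlMr // => h1 h2.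
  have := ivn_gt0 R N; nra.
apply: (entire_ident (c := 0) r0 ef) => z; rewrite subr0; exact: fr.
Qed.
End Theta.

(** * The sigma function of a sublattice *)

Section Sublattice.
Variable R : realType.
Local Notation C := R[i].
Implicit Types (S : set C) (u w z : C).

(** The index is finite: by cocompactness of [S'] every coset meets the disc of radius [r], where
    [S] has finitely many points; [prune] keeps one per coset. *)
Lemma transversal_ex S S' : latt S -> latt S' -> S' `<=` S ->
  exists T : seq C, [/\ uniq T, T != [::],
    forall w, S w -> exists2 t, t \in T & S' (w - t),
    forall t, t \in T -> S t &
    forall t t', t \in T -> t' \in T -> S' (t - t') -> t = t'].
Proof.
move=> lS lS' SS; have [s3 S0 SB _] := lS; have [_ S0' SB' [r r0 hr]] := lS'.
have [A0 hA0] := sum3_disc r s3.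
have prune (s : seq C) : exists T : seq C, [/\ uniq T, {subset T <= s},
    forall w, w \in s -> exists2 t, t \in T & S' (w - t) &
    forall t t', t \in T -> t' \in T -> S' (t - t') -> t = t'].
  elim: s => [|x s [T [uT sT hT pT]]]; first by exists [::].
  have [[t tT xt]|hx] := pselect (exists2 t, t \in T & S' (x - t)).
    exists T; split=> //; first by move=> t' /sT h; rewrite inE h orbT.
    by move=> w; rewrite inE => /orP[/eqP ->|/hT //]; exists t.
  have xT : x \notin T by apply/negP => xT; apply: hx; exists x; rewrite ?subrr.
  exists (x :: T); split=> /=; first by rewrite xT.
  - by move=> t; rewrite !inE => /orP[->//|/sT ->]; rewrite orbT.
  - move=> w; rewrite inE => /orP[/eqP ->|/hT[t tT wt]].
      by exists x; rewrite ?mem_head ?subrr.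
    by exists t; rewrite ?inE ?tT ?orbT.
  move=> t t'; rewrite !inE => /orP[/eqP ->|tT] /orP[/eqP ->|tT'] // h.
  - by case: hx; exists t'.
  - by case: hx; exists t => //; rewrite -opprB; apply/lattN.
  - exact: pT.
have [T [uT sT hT pT]] := prune [seq w <- enum_fset A0 | w \in S].
have hS w : S w -> exists2 t, t \in T & S' (w - t).
  move=> Sw; have [l Sl wl] := hr w; have Swl : S (w - l) by apply: SB => //; exact: SS.
  have wA : w - l \in A0 by apply/negPn/negP => /(hA0 _ Swl); lra.
  have [|t tT h] := hT (w - l); first by rewrite mem_filter wA mem_set.
  exists t => //; have -> : w - t = (w - l - t) + l by ring.
  exact: lattD.
exists T; split=> //.
  by have [t tT _] := hS _ S0; apply/eqP => T0; rewrite T0 in tT.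
by move=> t /sT; rewrite mem_filter => /andP[/set_mem].
Qed.

Lemma prod_transversal S S' (T : seq C) u : sum3 S -> uniq T ->
  (forall w, S w -> exists2 t, t \in T & S' (w - t)) ->
  (forall t w, t \in T -> S' (w - t) -> S w) ->
  (forall t t' w, t \in T -> t' \in T -> S' (w - t) -> S' (w - t') -> t = t') ->
  PiS S u = \prod_(t <- T) PiS [set w | S' (w - t)] u.
Proof.
move=> s3 uT hS hT pT.
have s3t t : t \in T -> sum3 [set w | S' (w - t)].
  by move=> tT; apply: sum3_sub s3 => w /=; exact: hT.
have cv : fcvg (fun A => \prod_(t <- T) \prod_(w <- A | w \in [set w | S' (w - t)]) fac w u)
               (\prod_(t <- T) PiS [set w | S' (w - t)] u).
  elim: (T) s3t => [_|t T' IH h].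
    by rewrite big_nil; apply: fcvg_eq (fcvg_cst 1); exists fset0 => A _; rewrite big_nil.
  rewrite big_cons; apply: fcvg_eq (fcvgM (PiS_cvg u (h t (mem_head _ _))) (IH _)).
    by exists fset0 => A _; rewrite big_cons.
  by move=> t' t'T; apply: h; rewrite inE t'T orbT.
apply: fcvg_uniq (PiS_cvg u s3) _; apply: fcvg_eq cv; exists fset0 => A _ /=.
under eq_bigr do rewrite big_mkcond.
rewrite exchange_big [RHS]big_mkcond /=; apply: eq_bigr => w _.
have [Sw|Sw] := boolP (w \in S).
  move: Sw; rewrite inE => /hS[t tT wt].
  rewrite (bigD1_seq t) //= mem_set // big1_seq ?mulr1 // => t' /andP[t't t'T].
  by rewrite memNset //= => wt'; move: t't; rewrite (pT t' t w) ?eqxx.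
rewrite big1_seq // => t /andP[_ tT]; rewrite memNset //= => wt.
by move: Sw; rewrite notin_setE; apply; exact: hT wt.
Qed.

(** Sigma of [S] is the product of the sigma products of the cosets of [S'], and each of these is a
    translate of [PiS S'] up to the exponential of a quadratic. *)
Lemma PiS_sublattice S S' : latt S -> latt S' -> S' `<=` S ->
  exists (T : seq C) (c a b : C), [/\ T != [::], c != 0 &
  forall u, PiS S u = c * cexp (a * u + b * u ^+ 2) * \prod_(t <- T) PiS S' (u - t)].
Proof.
move=> lS lS' SS; have [s3 _ SB _] := lS; have [s3' S0' SB' _] := lS'.
have [T [uT T0 hS hT pT]] := transversal_ex lS lS' SS.
have TS t w : t \in T -> S' (w - t) -> S w.
  by move=> tT /SS h; rewrite -(subrK t w); apply: lattD => //; exact: hT.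
have [c [a [b [c0 h]]]] : exists c a b : C, c != 0 /\ forall u,
    \prod_(t <- T) PiS [set w | S' (w - t)] u =
    c * cexp (a * u + b * u ^+ 2) * \prod_(t <- T) PiS S' (u - t).
  have : forall t, t \in T -> sum3 [set w | S' (w - t)].
    by move=> t tT; apply: sum3_sub s3 => w /=; exact: TS.
  elim: (T) => [_|t T' IH h].
    exists 1, 0, 0; split=> [|u]; first exact: oner_neq0.
    by rewrite !big_nil !mul0r addr0 cexp0 !mulr1.
  have [|c [a [b [c0 hc]]]] := IH; first by move=> t' t'T; apply: h; rewrite inE t'T orbT.
  have [c1 [a1 [b1 [c10 hc1]]]] := PiS_shift (h t (mem_head _ _)) s3' (fun w => iff_refl _).
  exists (c * (c1 * cexp (b1 * t ^+ 2 - a1 * t))), (a + a1 - 2 * b1 * t), (b + b1); split.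
    by rewrite !mulf_neq0 // cexp_neq0.
  move=> u; rewrite !big_cons hc -{1}(subrK t u) hc1.
  have -> : cexp ((a + a1 - 2 * b1 * t) * u + (b + b1) * u ^+ 2) =
    cexp (a * u + b * u ^+ 2) * cexp (a1 * (u - t) + b1 * (u - t) ^+ 2) / cexp (b1 * t ^+ 2 - a1 * t).
    by rewrite -cexpD -cexpB; congr cexp; ring.
  have := cexp_neq0 (b1 * t ^+ 2 - a1 * t).
  move: (cexp _) (cexp _) (cexp _) (PiS _ _) (\prod_(_ <- _) _) => x y z p q z0.
  by field.
exists T, c, a, b; split=> // u; rewrite -h; apply: prod_transversal => //.
move=> t t' w tT tT' wt wt'; apply: pT => //.
have -> : t - t' = (w - t') - (w - t) by ring.
exact: SB'.
Qed.

(** [f] is nonzero on a whole disc around [u], and there [g] cannot vanish identically. *)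
Lemma entire_mul_neq0 (f g : C -> C) : entire f -> entire g ->
  (exists u, f u != 0) -> (exists u, g u != 0) -> exists u, f u * g u != 0.
Proof.
move=> ef eg [u fu] [v gv]; apply: contrapT => h.
have e0 : 0 < nm (f u) / 2 by rewrite divr_gt0 // nm_gt0.
have [d d0 hd] := entire_cont u ef e0.
move/eqP: gv; apply; apply: (entire_ident (c := u) d0 eg) => z zd.
apply/eqP/negPn/negP => gz; apply: h; exists z; rewrite mulf_neq0 //.
rewrite -nm_gt0; have := hd z zd; have := nmBge (f u) (f z); rewrite nmBC.
have : 0 < nm (f u) by rewrite nm_gt0.
lra.
Qed.

Lemma entire_prod_neq0 (I : Type) (s : seq I) (F : I -> C -> C) :
  (forall i, entire (F i)) -> (forall i, exists u, F i u != 0) ->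
  exists u, \prod_(i <- s) F i u != 0.
Proof.
move=> eF nF; elim: s => [|i s IH]; first by exists 0; rewrite big_nil oner_neq0.
have [u hu] := entire_mul_neq0 (eF i) (@entire_prod _ _ s xpredT F (fun i _ => eF i)) (nF i) IH.
by exists u; rewrite big_cons.
Qed.

Lemma prodr_const_size (s : seq C) (x : C) : \prod_(t <- s) x = x ^+ size s.
Proof. by elim: s => [|t s IH]; rewrite ?big_nil ?expr0 // big_cons IH exprS. Qed.

Lemma PiS_shift_entire S x : latt S -> entire (fun u => PiS S (u - x)).
Proof.
move=> [s3 _ _ _]; apply: entire_eq (entire_affine 1 (- x) (entire_PiS s3)) => u.
by rewrite mul1r.
Qed.

Lemma PiS_shift_neq0 S x : latt S -> exists u, PiS S (u - x) != 0.
Proof.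
move=> [s3 _ _ _]; have [u Su _] := sum3_dense 0 s3 ltr01.
by exists (u + x); rewrite addrK; apply/eqP => /(PiS_eq0 u s3).
Qed.

(* [F1 / F0] is elliptic for [S']; the factor [cexp (c * u)] makes up for the
   difference of the quasi-periods of the two sigma functions. *)
Lemma sigmat_ratio S S' rho : latt S -> latt S' -> S' `<=` S ->
  exists (n : nat) (c k : C) (F : bool -> C -> C),
  [/\ (0 < n)%N, k != 0, forall i, entire (F i) /\ (exists u, F i u != 0),
    forall l, S' l -> exists2 e, entire e & forall i u, F i (u + l) = e u * F i u &
    forall u, PiS S (u - rho) * PiS S' u ^+ n * F false u =
      k * cexp (c * u) * PiS S u * PiS S' (u - rho) ^+ n * F true u].
Proof.
move=> lS lS' SS.
have [T [c0 [a [b [T0 c00 hT]]]]] := PiS_sublattice lS lS' SS.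
pose n := size T.
(* For each [t], the two products have zeros [rho + t], 0 and [t], [rho], with equal sums; hence
   equal factors of automorphy. *)
pose F i u := if i then \prod_(t <- T) (PiS S' (u - (rho + t)) * PiS S' (u - 0))
              else \prod_(t <- T) (PiS S' (u - t) * PiS S' (u - rho)).
have eP x := PiS_shift_entire x lS'.
have nP x := PiS_shift_neq0 x lS'.
(* [b * (u - rho) ^+ 2] and [b * u ^+ 2] differ by [- 2 * b * rho * u] plus a constant. *)
exists n, (- 2 * b * rho), (cexp (b * rho ^+ 2 - a * rho)), F; split.
- by rewrite /n lt0n size_eq0.
- exact: cexp_neq0.
- case; rewrite /F; split.
  + by apply: entire_prod => t _; exact: entireM.
  + by apply: entire_prod_neq0 => t; [exact: entireM|exact: entire_mul_neq0].
  + by apply: entire_prod => t _; exact: entireM.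
  + by apply: entire_prod_neq0 => t; [exact: entireM|exact: entire_mul_neq0].
- move=> l Sl; have [c [a' [c0' hc]]] := PiS_period lS' Sl.
  exists (fun u => \prod_(t <- T) (c ^+ 2 * cexp (2 * a' * u - a' * (rho + t)))).
    apply: entire_prod => t _; apply: entireM; first exact: entire_cst.
    apply: entire_eq (entire_affine (2 * a') (- (a' * (rho + t))) (@entire_cexp R)) => u.
    by [].
  have hcx x u : PiS S' (u + l - x) = c * cexp (a' * (u - x)) * PiS S' (u - x).
    by rewrite -hc addrAC.
  move=> i u; rewrite /F; case: i; rewrite -big_split; apply: eq_bigr => t _ /=; rewrite !hcx.
  - have -> : 2 * a' * u - a' * (rho + t) = a' * (u - (rho + t)) + a' * (u - 0) by ring.
    by rewrite cexpD; ring.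
  have -> : 2 * a' * u - a' * (rho + t) = a' * (u - t) + a' * (u - rho) by ring.
  by rewrite cexpD; ring.
move=> u; rewrite !hT /F /n -!prodr_const_size !big_split /= subr0.
have -> : \prod_(t <- T) PiS S' (u - (rho + t)) = \prod_(t <- T) PiS S' (u - rho - t).
  by apply: eq_bigr => t _; rewrite opprD addrA.
have -> : cexp (a * (u - rho) + b * (u - rho) ^+ 2) =
   cexp (b * rho ^+ 2 - a * rho) * cexp (- 2 * b * rho * u) * cexp (a * u + b * u ^+ 2).
  by rewrite -!cexpD; congr cexp; ring.
by ring.
Qed.
End Sublattice.

(** * The lattices Z + Z w, and homogeneity under scaling *)

Section LatticeExamples.
Variable R : realType.
Local Notation C := R[i].

(** [k.+1] to the power -3/2: a lattice point with coordinates [i], [j] has [|w| ^ -3] bounded by a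
    multiple of [cw i * cw j], which separates the double sum. *)
Definition cw (k : nat) : R := (k.+1%:R * Num.sqrt k.+1%:R)^-1.

Lemma cw_ge0 k : 0 <= cw k.
Proof. by rewrite invr_ge0 mulr_ge0 // sqrtr_ge0. Qed.

(** The bound [3 - 2 / sqrt (N + 1)] of the induction is 1 plus the integral of [x ^ (-3/2)] from 1
    to [N + 1]. *)
Lemma cw_sum N : \sum_(k < N) cw k <= 3.
Proof.
suff : \sum_(k < N.+1) cw k <= 3 - 2 / Num.sqrt N.+1%:R.
  rewrite big_ord_recr /= => h.
  have : 0 <= 2 / Num.sqrt N.+1%:R :> R by rewrite divr_ge0 // sqrtr_ge0.
  by have := cw_ge0 N; lra.
elim: N => [|N IH]; first by rewrite big_ord_recr big_ord0 /cw /= sqrtr1; lra.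
rewrite big_ord_recr /=; apply: le_trans (lerD IH (lexx _)) _.
rewrite /cw; set A := N.+1%:R; have -> : N.+2%:R = A + 1 :> R by rewrite /A natr1.
have A0 : 0 < A by rewrite ltr0n.
set a := Num.sqrt A; set b := Num.sqrt (A + 1).
have a0 : 0 < a by rewrite sqrtr_gt0.
have b0 : 0 < b by rewrite sqrtr_gt0; lra.
have ab : a <= b by rewrite ler_sqrt; lra.
have a2 : a ^+ 2 = A by rewrite sqr_sqrtr // ltW.
have b2 : b ^+ 2 = A + 1 by rewrite sqr_sqrtr //; lra.
have -> : A + 1 = b * b by rewrite -b2 expr2.
have h : (b - a) * (a + b) = 1.
  have -> : (b - a) * (a + b) = b ^+ 2 - a ^+ 2 by ring.
  by lra.
have hd : b - a = (a + b)^-1 by rewrite -[LHS]mulr1 -(divff (_ : a + b != 0)) ?mulrA ?h ?mul1r // lt0r_neq0 //; lra.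
have -> : 3 - 2 / b = 3 - 2 / a + 2 * (b - a) / (a * b) by field; rewrite !lt0r_neq0.
rewrite lerD2l hd -subr_ge0.
have -> : 2 * (a + b)^-1 / (a * b) - (b * b * b)^-1 =
   (2 * b * b - a * (a + b)) / ((a + b) * a * b * b * b).
  by field; rewrite !lt0r_neq0 //; lra.
by rewrite divr_ge0 ?mulr_ge0 //; [nra|lra..].
Qed.

Lemma sum_image_le (T : finType) (g : T -> C) (S : set C) (A : {fset C}) (F : C -> R) :
  (forall x, 0 <= F x) -> (forall x, x \in A -> S x -> exists t, g t = x) ->
  \sum_(x <- A | x \in S) F x <= \sum_t F (g t).
Proof.
move=> F0 hg.
apply: (@le_trans _ _ (\sum_(x <- A | x \in S) \sum_(t | g t == x) F (g t))).
  rewrite big_seq_cond [leRHS]big_seq_cond; apply: ler_sum => x /andP[xA].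
  rewrite inE => /(hg x xA)[t gt]; rewrite (bigD1 t) ?gt ?eqxx //= lerDl.
  by apply: sumr_ge0.
rewrite (exchange_big_dep xpredT) //=; apply: ler_sum => t _.
rewrite -big_filter; set s := [seq _ <- _ | _].
have : (size s <= 1)%N.
  have /leq_trans->// : (size s <= size [:: g t])%N.
  apply: uniq_leq_size; first by rewrite filter_uniq // fset_uniq.
  by move=> x; rewrite mem_filter inE => /andP[/andP[_ /eqP ->]].
case: s => [|x [|//]] _; first by rewrite big_nil.
by rewrite big_seq1.
Qed.

Lemma ReIm_lin (u w : C) (p q : R) :
  complex.Re (u - (p%:C%C + q%:C%C * w)) = complex.Re u - q * complex.Re w - p /\
  complex.Im (u - (p%:C%C + q%:C%C * w)) = complex.Im u - q * complex.Im w.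
Proof. by case: u w => ? ? [? ?] /=; split; ring. Qed.

Section Basis.
Variables (w : C) (hw : w \isn't Num.real).

Lemma nonreal_Im : complex.Im w != 0.
Proof. by apply: contra hw => /eqP; case: w => a b /= ->; rewrite complex_real. Qed.

Lemma coord_bound : exists2 K : R, 1 <= K & forall p q : R,
  `|p| <= K * nm (p%:C%C + q%:C%C * w) /\ `|q| <= K * nm (p%:C%C + q%:C%C * w).
Proof.
have b0 := nonreal_Im; set b := complex.Im w in b0.
have nb : 0 < `|b| by rewrite normr_gt0.
have k0 : 0 <= (1 + nm w) / `|b| by rewrite divr_ge0 // addr_ge0 // nm_ge0.
exists (1 + (1 + nm w) / `|b|) => [|p q]; first lra.
set x := p%:C%C + _.
have qb : `|q| * `|b| <= nm x.
  rewrite -normrM; have -> : q * b = complex.Im x.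
    by rewrite /x /b; case: w => a b' /=; ring.
  exact: nm_Im.
have {qb} qx : `|q| <= nm x / `|b| by rewrite ler_pdivlMr.
have x0 := nm_ge0 x; have w0 := nm_ge0 w.
have px : `|p| <= nm x + `|q| * nm w.
  have := nmB x (q%:C%C * w); rewrite /x addrK nm_real nmM nm_real; apply.
have e1 : (1 + (1 + nm w) / `|b|) * nm x = nm x + nm x / `|b| + nm x / `|b| * nm w.
  by field; rewrite lt0r_neq0.
rewrite e1; have y0 : 0 <= nm x / `|b| by rewrite divr_ge0.
by split; have := ler_wpM2r w0 qx; have := mulr_ge0 y0 w0; lra.
Qed.

Lemma lattice_coord x : lattice 1 w x <->
  exists m n : int, x = (m%:~R : R)%:C%C + (n%:~R : R)%:C%C * w.
Proof.
by split=> -[m [n ->]]; exists m, n; rewrite !(rmorph_int (real_complex R)) mulr1.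
Qed.

Lemma sum3_lattice : sum3 (lattice 1 w).
Proof.
have [K K1 hK] := coord_bound.
(* One share for each pair of signs of the coordinates; [8 * K ^+ 3] comes from
   [i.+1, j.+1 <= 2 * K * nm x], and 9 is the square of the bound in [cw_sum]. *)
exists (\sum_(s : bool * bool) 8 * K ^+ 3 * 9) => A.
have [N hN] := nat_ge (K * \sum_(x <- A) nm x + 1).
pose sg (s : bool) (i : nat) : R := (-1) ^+ s * i%:R.
pose g (t : (bool * bool) * ('I_N * 'I_N)) : C :=
  (sg t.1.1 t.2.1)%:C%C + (sg t.1.2 t.2.2)%:C%C * w.
have nsg s i : `|sg s i| = i%:R by rewrite /sg normrM normr_sign mul1r normr_nat.
apply: le_trans (@sum_image_le _ g _ _ _ (@wt_ge0 R) _) _.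
  move=> x xA /lattice_coord[m [n xE]].
  have [hm hn] := hK m%:~R n%:~R; rewrite -xE in hm hn.
  have xN : K * nm x < N%:R.
    have : nm x <= \sum_(y <- A) nm y.
      rewrite (big_fset_split _ _ _ (_ : ([fset x] `<=` A)%fset)) ?fsub1set //=.
      by rewrite big_seq_fset1 lerDl sumr_ge0 // => *; exact: nm_ge0.
    by have := hN N (leqnn _); nra.
  have aN (k : int) : `|k%:~R : R| <= K * nm x -> (`|k| < N)%N.
    by move=> h; rewrite -(ltr_nat R) natr_absz intr_norm; apply: le_lt_trans h xN.
  have sgE (k : int) (h : (`|k| < N)%N) : sg (k < 0) (Ordinal h) = k%:~R.
    by rewrite /sg /= [in RHS](intEsign k) rmorphM rmorph_sign.
  exists (((m < 0), (n < 0)), (Ordinal (aN _ hm), Ordinal (aN _ hn))).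
  by rewrite /g /= (sgE _ (aN _ hm)) (sgE _ (aN _ hn)) -xE.
have -> : \sum_t wt (g t) = \sum_s \sum_i \sum_j wt (g (s, (i, j))).
  rewrite (eq_bigr (fun s => \sum_ij wt (g (s, ij)))).
    by rewrite pair_bigA; apply: eq_bigr => -[].
  by move=> s _; rewrite pair_bigA; apply: eq_bigr => -[].
apply: ler_sum => s _.
apply: (@le_trans _ _ (\sum_(i < N) \sum_(j < N) 8 * K ^+ 3 * (cw i * cw j))).
  apply: ler_sum => i _; apply: ler_sum => j _.
  set x := g _; have [hi hj] := hK (sg s.1 i) (sg s.2 j).
  rewrite !nsg in hi hj; rewrite -/x in hi hj.
  have {}hi : i%:R <= K * nm x by [].
  have {}hj : j%:R <= K * nm x by [].
  have K30 : 0 <= 8 * K ^+ 3 by rewrite mulr_ge0 // exprn_ge0 //; lra.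
  have [x0|x0] := eqVneq x 0.
    rewrite x0 /wt nm0 expr0n invr0; apply: mulr_ge0 => //.
    by apply: mulr_ge0; exact: cw_ge0.
  have Kx1 : 1 <= K * nm x.
    have := hi; have := hj; case: (posnP i) => [i0|i0]; last first.
      by move=> _; apply: le_trans; rewrite ler1n.
    case: (posnP j) => [j0|j0]; last by move=> h _; apply: le_trans h; rewrite ler1n.
    by move: x0; rewrite /x /g /sg /= i0 j0 !mulr0 mul0r addr0 eqxx.
  rewrite /wt /cw; set a := i.+1%:R; set b := j.+1%:R.
  set M := K * nm x in hi hj Kx1.
  have a0 : 0 < a by rewrite ltr0n.
  have b0 : 0 < b by rewrite ltr0n.
  have aM : a <= 2 * M by rewrite /a -natr1; lra.
  have bM : b <= 2 * M by rewrite /b -natr1; lra.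
  have sM : Num.sqrt a * Num.sqrt b <= 2 * M.
    rewrite -sqrtrM ?(ltW a0) // -[leRHS]ger0_norm; last lra.
    by rewrite -sqrtr_sqr ler_sqrt ?sqr_ge0 // expr2 ler_pM // ltW.
  have sa0 : 0 < Num.sqrt a by rewrite sqrtr_gt0.
  have sb0 : 0 < Num.sqrt b by rewrite sqrtr_gt0.
  have nx : 0 < nm x by rewrite nm_gt0.
  rewrite -invfM -[leLHS]mul1r ler_pdivrMr ?exprn_gt0 // mulrAC ler_pdivlMr ?mulr_gt0 //.
  have -> : 8 * K ^+ 3 * nm x ^+ 3 = (2 * M) * (2 * M) * (2 * M) by rewrite /M; ring.
  have -> : 1 * (a * Num.sqrt a * (b * Num.sqrt b)) = a * b * (Num.sqrt a * Num.sqrt b) by ring.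
  have abM : a * b <= 2 * M * (2 * M) by rewrite ler_pM // ltW.
  by rewrite ler_pM // mulr_ge0 // ltW.
under eq_bigr do rewrite -mulr_sumr.
rewrite -mulr_sumr; under eq_bigr do rewrite -mulr_sumr.
rewrite -mulr_suml; apply: ler_wpM2l; first by rewrite mulr_ge0 // exprn_ge0 //; lra.
have c3 := cw_sum N; have c0 : 0 <= \sum_(k < N) cw k by apply: sumr_ge0 => *; exact: cw_ge0.
by nra.
Qed.

Lemma latt_lattice : latt (lattice 1 w).
Proof.
split; first exact: sum3_lattice.
- by exists 0, 0; rewrite !mulr0z !mul0r addr0.
- move=> x y [m [n ->]] [m' [n' ->]]; exists (m - m'), (n - n').
  by rewrite !rmorphB /=; ring.
have b0 := nonreal_Im.
exists (1 + `|complex.Im w|) => [|u]; first by rewrite ltr_wpDr.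
pose n := Num.floor (complex.Im u / complex.Im w).
pose m := Num.floor (complex.Re u - n%:~R * complex.Re w).
exists ((m%:~R : R)%:C%C + (n%:~R : R)%:C%C * w).
  by apply/lattice_coord; exists m, n.
apply: le_trans (nm_ReIm _) _.
have hm : `|complex.Re u - n%:~R * complex.Re w - m%:~R| <= 1.
  have /andP[h1 h2] := mem_rg1_floor (complex.Re u - n%:~R * complex.Re w).
  rewrite ler_norml; apply/andP; split; move: h1 h2; rewrite -/m; lra.
have hn : `|complex.Im u / complex.Im w - n%:~R| <= 1.
  have /andP[h1 h2] := mem_rg1_floor (complex.Im u / complex.Im w).
  rewrite ler_norml; apply/andP; split; move: h1 h2; rewrite -/n; lra.
have [-> ->] := ReIm_lin u w m%:~R n%:~R.
have -> : complex.Im u - n%:~R * complex.Im w =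
   (complex.Im u / complex.Im w - n%:~R) * complex.Im w by rewrite mulrBl divfK.
apply: lerD => //.
by rewrite normrM ler_piMl.
Qed.
End Basis.

Section Scale.
Variables (S : set C) (mu : C) (mu0 : mu != 0).
Let S' : set C := [set x | S (x / mu)].

Lemma sum3_scale : sum3 S -> sum3 S'.
Proof.
move=> [M hM]; exists (wt mu * M) => A.
have -> : \sum_(x <- A | x \in S') wt x =
    wt mu * \sum_(x <- ((fun x => x / mu) @` A)%fset | x \in S) wt x.
  rewrite big_mkcond [in RHS]big_mkcond big_imfset /=; last first.
    by move=> x y _ _; apply: mulIf; rewrite invr_eq0.
  rewrite mulr_sumr; apply: eq_bigr => x _.
  have -> : (x / mu \in S) = (x \in S') by apply/idP/idP; rewrite !inE.
  case: ifP => _; last by rewrite mulr0.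
  have {1}-> : x = mu * (x / mu) by rewrite mulrCA divff // mulr1.
  by rewrite /wt nmM exprMn invfM.
by rewrite ler_wpM2l ?wt_ge0.
Qed.

Lemma latt_scale : latt S -> latt S'.
Proof.
move=> [s3 S0 SB [r r0 hr]]; split; first exact: sum3_scale.
- by rewrite /S' /= mul0r.
- by move=> x y; rewrite /S' /= mulrBl; exact: SB.
exists (nm mu * r); first by rewrite mulr_gt0 // nm_gt0.
move=> u; have [l Sl h] := hr (u / mu); exists (l * mu); first by rewrite /S' /mkset (mulfK mu0).
have -> : u - l * mu = mu * (u / mu - l) by field.
by rewrite nmM ler_wpM2l ?nm_ge0.
Qed.

Lemma scale_mem x : S' (mu * x) <-> S x.
Proof. by rewrite /S' /mkset mulrC (mulKf mu0). Qed.

Let muK : cancel ( *%R mu) ( *%R mu^-1). Proof. exact: mulKf. Qed.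
Let muVK : cancel ( *%R mu^-1) ( *%R mu). Proof. exact: mulVKf. Qed.

Lemma wp_scale u : latt S -> wp S u = mu ^+ 2 * wp S' (mu * u).
Proof.
move=> lS; have [s3 S0 _ _] := lS; have [s3' S0' _ _] := latt_scale lS.
apply: fcvg_uniq (wp_cvg u s3 S0) _.
have := fcvgZ (mu ^+ 2) (@fcvg_bij _ _ +%R S S' _ _ _ _ muK muVK scale_mem
  (wp_cvg (mu * u) s3' S0')).
apply: fcvg_eq; exists fset0 => A _ /=; rewrite mulr_sumr; apply: eq_bigr => x _.
by rewrite /pterm -mulrBr !exprMn !(invfM (mu ^+ 2)) -mulrBr mulrA divff ?mul1r // expf_neq0.
Qed.

Lemma PiS_scale u : latt S -> PiS S' (mu * u) = mu * PiS S u.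
Proof.
move=> lS; have [s3 S0 _ _] := lS; have [s3' S0' _ _] := latt_scale lS.
symmetry; apply: fcvg_uniq (fcvgZ mu (PiS_cvg u s3)) _.
have := @fcvg_bij _ _ *%R S S' _ _ _ _ muK muVK scale_mem (PiS_cvg (mu * u) s3').
apply: fcvg_eq; exists [fset 0]%fset => A sA /=.
rewrite prod_fac0 // (big_fset_split _ _ _ sA) /= mulrA; congr (_ * _).
  by rewrite big_mkcond big_seq_fset1 mem_set // /fac mulr0 eqxx.
apply: eq_bigr => x /andP[_]; rewrite in_fset1 => x0.
by rewrite /fac mulf_eq0 (negbTE mu0) (negbTE x0) /= -mulf_div divff // mul1r.
Qed.

End Scale.
End LatticeExamples.

(** * The fraction field of entire functions on C^2 *)

Section Entire2.
Variable R : realType.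
Local Notation C := R[i].
Local Notation C2 := 'cV[C]_2.

(** By Osgood's lemma these are the entire functions of two variables. Lines in every direction, not
    only the axes, make restriction to the line through two points available. *)
Definition entire2 (f : C2 -> C) : Prop :=
  continuous f /\ forall z w : C2, entire (fun t => f (z + t *: w)).

Lemma entire_continuous (f : C -> C) : entire f -> continuous f.
Proof.
move=> ef x; apply/(@cvgrPdist_le _ _ _ _ (nbhs_filter x)) => e; case: e => e e'.
rewrite ltcE /= => /andP[/eqP -> /= e0].
have [d d0 hd] := entire_cont x ef e0.
have d0' : 0 < d%:C%C :> C by rewrite ltcR.
apply/nbhs_normP; exists d%:C%C => //= y.
by rewrite /= !normE ltcR lecR (nmBC x) (nmBC (f x)) => /ltW; exact: hd.
Qed.

Lemma entire2_cst c : entire2 (cst c).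
Proof. by split=> [|z w]; [exact: cst_continuous | exact: entire_cst]. Qed.

Lemma entire2D f g : entire2 f -> entire2 g -> entire2 (f + g).
Proof.
move=> [cf ef] [cg eg]; split=> [|z w]; first by move=> x; apply: (@continuousD _ _ _ f g x); [exact: cf|exact: cg].
exact: entireD.
Qed.

Lemma entire2N f : entire2 f -> entire2 (- f).
Proof.
move=> [cf ef]; split=> [|z w]; first by move=> x; apply: (@continuousN _ _ _ f x); exact: cf.
exact: entireN.
Qed.

Lemma entire2M f g : entire2 f -> entire2 g -> entire2 (f * g).
Proof.
move=> [cf ef] [cg eg]; split=> [|z w]; first by move=> x; apply: (@continuousM _ _ f g x); [exact: cf|exact: cg].
exact: entireM.
Qed.

Definition lform (p q : C) (z : C2) : C := p * z 0 0 + q * z 1 0.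

Lemma entire2_lform (f : C -> C) p q : entire f -> entire2 (f \o lform p q).
Proof.
move=> ef; split=> [z|z w].
  apply: continuous_comp; last exact: entire_continuous.
  have cc a i x : {for x, continuous (fun z : C2 => a * z i 0)}.
    apply: (@continuousM _ _ (cst a) (fun z : C2 => z i 0)); first exact: cst_continuous.
    exact: coord_continuous.
  exact: (@continuousD _ _ _ (fun z : C2 => p * z 0 0) (fun z => q * z 1 0)).
apply: entire_eq (entire_affine (lform p q w) (lform p q z) ef) => t /=.
by congr f; rewrite /lform !mxE; ring.
Qed.

(** The identity theorem on the complex line through [w] and [z]. *)
Lemma entire2_eq0 f z w : entire2 f -> f z != 0 -> forall d : R, 0 < d ->
  exists2 t : C, nm t <= d & f (w + t *: (z - w)) != 0.
Proof.
move=> [_ ef] fz d d0; apply: contrapT => h; move/eqP: fz; apply.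
have <- : w + 1 *: (z - w) = z by rewrite scale1r addrC subrK.
apply: (entire_ident (c := 0) d0 (ef w (z - w))) => t; rewrite subr0 => td.
by apply/eqP/negPn/negP => ft; apply: h; exists t.
Qed.

Lemma entire2_dense f : entire2 f -> (exists z, f z != 0) ->
  open [set z | f z != 0] /\ dense [set z | f z != 0].
Proof.
move=> ef [z fz]; split.
  rewrite (_ : [set z | f z != 0] = f @^-1` ~` [set 0]); last first.
    by apply/seteqP; split=> x /= /eqP.
  have [cf _] := ef.
  move/continuousP: cf; apply; apply: closed_openC.
  by apply: accessible_closed_set1; apply: hausdorff_accessible; exact: norm_hausdorff.
move=> O [w Ow] oO.
have [e e0 he] : exists2 e : R, 0 < e & forall t : C, nm t <= e -> O (w + t *: (z - w)).
  have : nbhs (0 : C) ((fun t : C => w + t *: (z - w)) @^-1` O).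
    have ct : (fun t : C => w + t *: (z - w)) @ (0 : C) --> w + (0 : C) *: (z - w).
      have FF : Filter (nbhs (0 : C)) := nbhs_filter _.
      apply: (@cvgD C C2 C _ FF (cst w) (fun t => t *: (z - w))).
        exact: (@cvg_cst _ _ _ _ FF).
      by apply: (@cvgZr_tmp C C2 C _ FF id); exact: cvg_id.
    apply: ct; rewrite scale0r addr0; exact: open_nbhs_nbhs.
  move=> /nbhs_normP[e']; case: e' => e e'; rewrite /= ltcE /= => /andP[/eqP -> /= e0] h.
  exists (e / 2) => [|t te]; first by rewrite divr_gt0.
  by apply: h; rewrite /= sub0r normrN normE ltcR; lra.
have [t te ft] := entire2_eq0 w ef fz e0.
by exists (w + t *: (z - w)); split=> //; exact: he.
Qed.
End Entire2.

Section Ent2.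
Variable R : realType.
Local Notation C := R[i].
Local Notation C2 := 'cV[C]_2.

Definition ent2P : pred (C2 -> C) := fun f => `[< entire2 f >].

Fact ent2_subring : subring_closed ent2P.
Proof.
split=> [|f g /asboolP ef /asboolP eg|f g /asboolP ef /asboolP eg]; apply/asboolP.
- exact: entire2_cst.
- by apply: entire2D => //; exact: entire2N.
- exact: entire2M.
Qed.
HB.instance Definition _ := GRing.isSubringClosed.Build (C2 -> C) ent2P ent2_subring.

Record ent2 := Ent2 { ent2_val :> C2 -> C; _ : ent2_val \in ent2P }.
HB.instance Definition _ := [isSub for ent2_val].
HB.instance Definition _ := [Choice of ent2 by <:].
HB.instance Definition _ := [SubChoice_isSubComNzRing of ent2 by <:].

Lemma ent2_entire (f : ent2) : entire2 f.
Proof. by case: f => f /= /asboolP. Qed.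

Lemma ent2E (f g : ent2) : f = g <-> forall z, f z = g z.
Proof. by split=> [->//|h]; apply/val_inj/funext => z; exact: h. Qed.
Lemma ent20 z : (0 : ent2) z = 0. Proof. by []. Qed.
Lemma ent21 z : (1 : ent2) z = 1. Proof. by []. Qed.
Lemma ent2D (f g : ent2) z : (f + g) z = f z + g z. Proof. by []. Qed.
Lemma ent2M (f g : ent2) z : (f * g) z = f z * g z. Proof. by []. Qed.

Definition ent2_unit : pred ent2 := fun f => `[< exists g : ent2, g * f = 1 >].
Definition ent2_inv (f : ent2) : ent2 :=
  if pselect (exists g : ent2, g * f = 1) is left h then projT1 (cid h) else f.

Fact ent2_mulVx : {in ent2_unit, left_inverse 1 ent2_inv *%R}.
Proof.
move=> f /asboolP h; rewrite /ent2_inv; case: pselect => // h'.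
by case: cid.
Qed.
Fact ent2_unitP (f g : ent2) : g * f = 1 -> ent2_unit f.
Proof. by move=> h; apply/asboolP; exists g. Qed.
Fact ent2_invr_out : {in [predC ent2_unit], ent2_inv =1 id}.
Proof.
move=> f; rewrite inE => /asboolP h; rewrite /ent2_inv.
by case: pselect => // h'; case: h.
Qed.
HB.instance Definition _ := GRing.ComNzRing_hasMulInverse.Build ent2
  ent2_mulVx ent2_unitP ent2_invr_out.

(** Restricted to the line through a point where [f] is nonzero and one where [g] is, both are
    nonzero entire functions of one variable. *)
Fact ent2_integral (f g : ent2) : f * g = 0 -> (f == 0) || (g == 0).
Proof.
move=> fg; apply/orP; apply: contrapT => /not_orP[/negP/eqP f0 /negP/eqP g0].
have [z fz] : exists z, f z != 0.
  by apply: contrapT => h; apply: f0; apply/ent2E => z; apply/eqP/negPn/negP => fz; apply: h; exists z.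
have [w gw] : exists z, g z != 0.
  by apply: contrapT => h; apply: g0; apply/ent2E => x; apply/eqP/negPn/negP => gx; apply: h; exists x.
have [_ ef] := ent2_entire f; have [_ eg] := ent2_entire g.
have [|//|] := entire_mul_neq0 (ef z (w - z)) (eg z (w - z)).
- by exists 0; rewrite scale0r addr0.
- by exists 1; rewrite scale1r addrC subrK.
by move=> t; rewrite -ent2M fg ent20 eqxx.
Qed.
HB.instance Definition _ := GRing.ComUnitRing_isIntegral.Build ent2 ent2_integral.
End Ent2.

Section FracGeneric.
Variable D : idomainType.
Local Notation K := {fraction D}.
Local Notation "x %:F" := (tofrac x).
Implicit Types (n d : D).

Lemma frac_ex (x : K) : exists n d, d != 0 /\ x = n%:F / d%:F.
Proof.
pose r := repr x; exists (frac r).1, (frac r).2.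
have d0 := denom_ratioP r; split=> //.
have d0' : ((frac r).2)%:F != 0 :> K by rewrite tofrac_eq0.
apply: (canRL (mulfK d0')); rewrite -[x]reprK -/r.
unlock tofrac; rewrite -[LHS]FracField.pi_mul; apply/eqmodP.
by rewrite /= FracField.equivfE /FracField.mulf !numden_Ratio ?mulr1 ?oner_neq0 // mulrC.
Qed.

Lemma frac_add n d n' d' : d != 0 -> d' != 0 ->
  n%:F / d%:F + n'%:F / d'%:F = (n * d' + n' * d)%:F / (d * d')%:F :> K.
Proof. by move=> d0 d0'; rewrite tofracD !tofracM addf_div // tofrac_eq0. Qed.

Lemma frac_mul n d n' d' : n%:F / d%:F * (n'%:F / d'%:F) = (n * n')%:F / (d * d')%:F :> K.
Proof. by rewrite !tofracM mulf_div. Qed.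

Lemma frac_eq n d n' d' : d != 0 -> d' != 0 -> n%:F / d%:F = n'%:F / d'%:F :> K ->
  n * d' = n' * d.
Proof.
move=> d0 d0' /eqP; rewrite eqr_div ?tofrac_eq0 // -!tofracM tofrac_eq.
by move/eqP.
Qed.
End FracGeneric.

(** * Values of fractions, and the total functions that represent them *)

Section Fractions.
Variable R : realType.
Local Notation C := R[i].
Local Notation C2 := 'cV[C]_2.
Local Notation ent2 := (ent2 R).
Local Notation K := {fraction ent2}.
Local Notation "x %:F" := (tofrac x).
Implicit Types (f g : C2 -> C) (x y : K) (z : C2).

Fact ent2_cst_proof (c : C) : (cst c : C2 -> C) \in @ent2P R.
Proof. by apply/asboolP; exact: entire2_cst. Qed.
Definition ent2_cst (c : C) : ent2 := Ent2 (ent2_cst_proof c).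
Definition kcst (c : C) : K := (ent2_cst c)%:F.

Fact kcst_zmod : zmod_morphism kcst.
Proof. by move=> a b; rewrite /kcst -rmorphB; congr (_%:F); apply/ent2E. Qed.
Fact kcst_monoid : monoid_morphism kcst.
Proof.
split=> [|a b]; first by rewrite /kcst -tofrac1; congr (_%:F); apply/ent2E.
by rewrite /kcst -rmorphM; congr (_%:F); apply/ent2E.
Qed.
HB.instance Definition _ := GRing.isZmodMorphism.Build C K kcst kcst_zmod.
HB.instance Definition _ := GRing.isMonoidMorphism.Build C K kcst kcst_monoid.

Lemma ent2_neq0 (n : ent2) : n != 0 <-> exists z, n z != 0.
Proof.
split=> [n0|[z nz]]; last by apply: contraNneq nz => ->; rewrite ent20.
apply: contrapT => h; move/eqP: n0; apply; apply/ent2E => z.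
by apply/eqP/negPn/negP => nz; apply: h; exists z.
Qed.

(* [x] is defined at [z], with value [a]. *)
Definition reg z x (a : C) := exists n d : ent2,
  [/\ d z != 0, x = n%:F / d%:F & a = n z / d z].

Lemma ent2_val_neq0 (d : ent2) z : d z != 0 -> d != 0.
Proof. by move=> dz; apply/ent2_neq0; exists z. Qed.

Lemma reg_uniq z x a b : reg z x a -> reg z x b -> a = b.
Proof.
move=> [n [d [dz -> ->]]] [n' [d' [dz' e ->]]].
have := frac_eq (ent2_val_neq0 dz) (ent2_val_neq0 dz') e.
move/(congr1 (fun h : ent2 => h z)); rewrite !ent2M => h.
by apply/eqP; rewrite eqr_div //; apply/eqP.
Qed.

Lemma reg_cst z c : reg z (kcst c) c.
Proof. by exists (ent2_cst c), 1; rewrite tofrac1 !divr1 ent21 oner_neq0. Qed.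

Lemma regD z x y a b : reg z x a -> reg z y b -> reg z (x + y) (a + b).
Proof.
move=> [n [d [dz -> ->]]] [n' [d' [dz' -> ->]]].
rewrite frac_add ?(ent2_val_neq0 dz) ?(ent2_val_neq0 dz') // addf_div //.
by exists (n * d' + n' * d), (d * d'); rewrite ent2M mulf_neq0 // ent2D !ent2M.
Qed.

Lemma regM z x y a b : reg z x a -> reg z y b -> reg z (x * y) (a * b).
Proof.
move=> [n [d [dz -> ->]]] [n' [d' [dz' -> ->]]]; rewrite frac_mul mulf_div.
by exists (n * n'), (d * d'); rewrite !ent2M mulf_neq0.
Qed.

Lemma regN z x a : reg z x a -> reg z (- x) (- a).
Proof.
by move=> h; have := regM (reg_cst z (-1)) h; rewrite rmorphN1 !mulN1r.
Qed.

Lemma regV z x a : a != 0 -> reg z x a -> reg z x^-1 a^-1.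
Proof.
move=> a0 [n [d [dz -> e]]]; exists d, n; rewrite e !invf_div; split=> //.
by move: a0; rewrite e mulf_eq0 negb_or => /andP[].
Qed.

Lemma regX z x a n : reg z x a -> reg z (x ^+ n) (a ^+ n).
Proof.
move=> h; elim: n => [|n IH]; last by rewrite !exprS; exact: regM.
by have := reg_cst z 1; rewrite rmorph1.
Qed.

Lemma reg_sum z (I : Type) (s : seq I) (x : I -> K) (a : I -> C) :
  (forall i, reg z (x i) (a i)) -> reg z (\sum_(i <- s) x i) (\sum_(i <- s) a i).
Proof.
move=> h; elim: s => [|i s IH]; last by rewrite !big_cons; exact: regD.
by rewrite !big_nil; have := reg_cst z 0; rewrite rmorph0.
Qed.

Lemma reg0 z a : reg z 0 a -> a = 0.
Proof. by move=> h; apply: (reg_uniq h); have := reg_cst z 0; rewrite rmorph0. Qed.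

Definition big_open (U : set C2) := open U /\ dense U.

Lemma big_openI U V : big_open U -> big_open V -> big_open (U `&` V).
Proof.
move=> [oU dU] [oV dV]; split=> [|O O0 oO]; first exact: openI.
by rewrite setIA; apply: dV; [exact: dU | exact: openI].
Qed.

Lemma big_open_neq0 (n : ent2) : n != 0 -> big_open [set z | n z != 0].
Proof. by move=> /ent2_neq0 h; apply: entire2_dense => //; exact: ent2_entire. Qed.

(** The dense open set absorbs the junk values at poles, so every operation on total functions
    follows the one in the field. *)
Definition represents f x := exists2 U, big_open U & forall z, U z -> reg z x (f z).

Lemma represents_eq f g x : (forall z, f z = g z) -> represents f x -> represents g x.
Proof. by move=> h [U oU hU]; exists U => // z /hU; rewrite h. Qed.

Lemma represents_cst c : represents (cst c) (kcst c).
Proof.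
exists [set: C2]; last by move=> z _; exact: reg_cst.
by split; [exact: openT | move=> O [z Oz] _; exists z].
Qed.

Lemma representsD f g x y : represents f x -> represents g y -> represents (f + g) (x + y).
Proof.
move=> [U oU hU] [V oV hV]; exists (U `&` V); first exact: big_openI.
by move=> z [/hU h1 /hV h2]; exact: regD.
Qed.

Lemma representsM f g x y : represents f x -> represents g y -> represents (f * g) (x * y).
Proof.
move=> [U oU hU] [V oV hV]; exists (U `&` V); first exact: big_openI.
by move=> z [/hU h1 /hV h2]; exact: regM.
Qed.

Lemma representsN f x : represents f x -> represents (- f) (- x).
Proof. by move=> [U oU hU]; exists U => // z /hU; exact: regN. Qed.

Lemma representsX f x n : represents f x -> represents (f ^+ n) (x ^+ n).
Proof.
move=> h; elim: n => [|n IH]; last by rewrite !exprS; exact: representsM.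
by have := represents_cst 1; rewrite rmorph1.
Qed.

Lemma represents_sum (I : Type) (s : seq I) (f : I -> C2 -> C) (x : I -> K) :
  (forall i, represents (f i) (x i)) ->
  represents (\sum_(i <- s) f i) (\sum_(i <- s) x i).
Proof.
move=> h; elim: s => [|i s IH]; last by rewrite !big_cons; exact: representsD.
by rewrite !big_nil; have := represents_cst 0; rewrite rmorph0.
Qed.

Lemma representsV f x : represents f x -> represents (fun z => (f z)^-1) x^-1.
Proof.
(* For [x = 0] the conventions [0^-1 = 0] for functions and in the field agree. *)
move=> [U oU hU]; have [x0|x0] := eqVneq x 0.
  exists U => // z /hU; rewrite x0 => /reg0 ->; rewrite !invr0.
  by have := reg_cst z 0; rewrite rmorph0.
have [n [d [d0 xE]]] := frac_ex x.
have n0 : n != 0 by apply: contraNneq x0 => n0; rewrite xE n0 tofrac0 mul0r.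
exists (U `&` ([set z | n z != 0] `&` [set z | d z != 0])).
  by apply: big_openI => //; apply: big_openI; exact: big_open_neq0.
move=> z [/hU h [/= nz dz]]; apply: regV => //.
have -> : f z = n z / d z by apply: (reg_uniq h); exists n, d.
by rewrite mulf_neq0 // invr_eq0.
Qed.

(** Two dense open sets and the sets where a numerator and a denominator are nonzero have a common
    point. *)
Lemma represents_mero0 f x : represents f x -> mero_eq f 0 <-> x = 0.
Proof.
move=> [U [oU dU] hU]; split=> [[V [oV dV fV]]|x0]; last first.
  by exists U; split=> // z /hU; rewrite x0 => /reg0.
apply: contrapT => /eqP x0; have [n [d [d0 xE]]] := frac_ex x.
have n0 : n != 0 by apply: contraNneq x0 => n0; rewrite xE n0 tofrac0 mul0r.
have [_ dW] := big_openI (big_openI (conj oU dU) (conj oV dV))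
  (big_openI (big_open_neq0 n0) (big_open_neq0 d0)).
have [z [_ [[/hU h /fV f0] [/= nz dz]]]] : setT `&` (U `&` V `&`
    ([set z | n z != 0] `&` [set z | d z != 0])) !=set0.
  by apply: dW; [exists 0 | exact: openT].
have : f z = n z / d z by apply: (reg_uniq h); exists n, d.
by rewrite f0 => /esym/eqP; rewrite mulf_eq0 invr_eq0 (negbTE nz) (negbTE dz).
Qed.
End Fractions.

(** * Algebraic elements over a generated subfield *)

Section GeneratedSubfield.
Variables (K : fieldType) (A : set K).

Inductive gen_sub : K -> Prop :=
| gs_gen y : A y -> gen_sub y
| gs_one : gen_sub 1
| gs_add y z : gen_sub y -> gen_sub z -> gen_sub (y + z)
| gs_opp y : gen_sub y -> gen_sub (- y)
| gs_mul y z : gen_sub y -> gen_sub z -> gen_sub (y * z)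
| gs_inv y : gen_sub y -> gen_sub y^-1.

Definition genP : pred K := fun y => `[< gen_sub y >].

Fact genP_divring : divring_closed genP.
Proof.
split=> [|y z /asboolP hy /asboolP hz|y z /asboolP hy /asboolP hz]; apply/asboolP.
- exact: gs_one.
- by apply: gs_add => //; exact: gs_opp.
- by apply: gs_mul => //; exact: gs_inv.
Qed.
HB.instance Definition _ := GRing.isDivringClosed.Build K genP genP_divring.

(** The generated subfield is made a field type of its own, so that the general theory of algebraic
    elements applies to its inclusion into [K]. *)
Record genK := GenK { genK_val : K; _ : genK_val \in genP }.
HB.instance Definition _ := [isSub for genK_val].
HB.instance Definition _ := [Choice of genK by <:].
HB.instance Definition _ := [SubChoice_isSubIntegralDomain of genK by <:].
HB.instance Definition _ := [SubIntegralDomain_isSubField of genK by <:].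

Definition alg_over (y : K) := algebraicOver (val : genK -> K) y.

Lemma genKP (a : genK) : gen_sub (val a).
Proof. by case: a => a /= /asboolP. Qed.

Lemma gen_lift y : gen_sub y -> exists a : genK, val a = y.
Proof.
move=> h; have hy : y \in genP by apply/asboolP.
by exists (GenK hy).
Qed.

Lemma alg_over_gen y : gen_sub y -> alg_over y.
Proof. by move=> /gen_lift[a <-]; exact: algebraic_id. Qed.

Lemma alg_overD y z : alg_over y -> alg_over z -> alg_over (y + z).
Proof. exact: algebraic_add. Qed.
Lemma alg_overN y : alg_over y -> alg_over (- y).
Proof. exact: algebraic_opp. Qed.
Lemma alg_overM y z : alg_over y -> alg_over z -> alg_over (y * z).
Proof. exact: algebraic_mul. Qed.
Lemma alg_overV y : alg_over y -> alg_over y^-1.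
Proof. exact: algebraic_inv. Qed.
Lemma alg_over1 : alg_over 1.
Proof. exact: algebraic1. Qed.
Lemma alg_overX y n : alg_over y -> alg_over (y ^+ n).
Proof.
move=> hy; elim: n => [|n IH]; first by rewrite expr0; exact: alg_over1.
by rewrite exprS; exact: alg_overM.
Qed.

(** Transitivity of algebraicity: after division by the leading coefficient, [y] is a root of a
    monic polynomial with integral coefficients, and over a field integral means algebraic. *)
Lemma alg_over_root (p : {poly K}) y : p != 0 -> root p y ->
  (forall i, alg_over p`_i) -> alg_over y.
Proof.
move=> p0 py hp; apply/integral_algebraic.
have l0 : lead_coef p != 0 by rewrite lead_coef_eq0.
apply: (@integral_root_monic _ _ _ y ((lead_coef p)^-1 *: p)).
- by rewrite monicE lead_coefZ mulVf.
- by rewrite rootZ // invr_eq0.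
move=> a /(nthP 0)[i _ <-]; rewrite coefZ; apply/integral_algebraic.
by apply: alg_overM; [apply: alg_overV; exact: hp|exact: hp].
Qed.

Lemma alg_over_rootn y n : (0 < n)%N -> alg_over (y ^+ n) -> alg_over y.
Proof.
move=> n0 hy; apply: (@alg_over_root ('X^n - (y ^+ n)%:P)).
- by rewrite monic_neq0 // monicXnsubC.
- by rewrite /root !hornerE subrr.
have h0 : alg_over 0 by exact: algebraic0.
move=> i; rewrite coefB coefXn coefC.
apply: alg_overD; first by case: (i == n); [exact: alg_over1|exact: h0].
by apply: alg_overN; case: (i == 0%N).
Qed.
End GeneratedSubfield.

Section AlgebraicFun.
Variable R : realType.
Local Notation C := R[i].
Local Notation C2 := 'cV[C]_2.
Local Notation K := {fraction (ent2 R)}.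

Definition gens (x : 'I_2 -> K) : set K := range (@kcst R) `|` range x.

Section Gens.
Variables (G : C2 -> 'cV[C]_2) (x : 'I_2 -> K).
Hypothesis hG : forall i, represents (fun z => G z i 0) (x i).

Lemma gen_field_represents g : gen_field G g -> exists2 y, gen_sub (gens x) y & represents g y.
Proof.
elim=> [c|i|f h _ [y gy ry] _ [z gz rz]|f _ [y gy ry]|f h _ [y gy ry] _ [z gz rz]|f _ [y gy ry]].
- by exists (kcst c); [apply: gs_gen; left; exists c | exact: represents_cst].
- by exists (x i) => //; apply: gs_gen; right; exists i.
- by exists (y + z); [exact: gs_add | exact: representsD].
- by exists (- y); [exact: gs_opp | exact: representsN].
- by exists (y * z); [exact: gs_mul | exact: representsM].
- by exists y^-1; [exact: gs_inv | exact: representsV].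
Qed.

Lemma gen_sub_represents y : gen_sub (gens x) y -> exists2 g, gen_field G g & represents g y.
Proof.
elim=> [_ [[c _ <-]|[i _ <-]]||a b _ [f gf rf] _ [g gg rg]|a _ [f gf rf]|a b _ [f gf rf] _ [g gg rg]|a _ [f gf rf]].
- by exists (cst c); [exact: gen_cst | exact: represents_cst].
- by exists (fun z => G z i 0); [exact: gen_coord | exact: hG].
- exists (cst 1); first exact: gen_cst.
  by rewrite -(rmorph1 (@kcst R)); exact: represents_cst.
- by exists (f + g); [exact: gen_add | exact: representsD].
- by exists (- f); [exact: gen_opp | exact: representsN].
- by exists (f * g); [exact: gen_mul | exact: representsM].
- by exists (fun z => (f z)^-1); [exact: gen_inv | exact: representsV].
Qed.

Lemma represents_horner (p : {poly (C2 -> C)}) (q : {poly K}) f y n :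
  (size p <= n)%N -> (size q <= n)%N -> (forall i, (i < n)%N -> represents p`_i q`_i) ->
  represents f y -> represents p.[f] q.[y].
Proof.
move=> pn qn h hf; rewrite (horner_coef_wide _ pn) (horner_coef_wide _ qn).
apply: represents_sum => i; apply: representsM; [exact: h|exact: representsX].
Qed.

(** Coefficients are exchanged one by one along [represents]; a coefficient that is not [mero_eq] to
    0 corresponds to a nonzero one in the field. *)
Lemma algebraic_funP f y : represents f y ->
  algebraic_fun G f <-> alg_over (gens x) y.
Proof.
move=> rf; split=> [[p [gp [i0 pi0] pf]]|[q q0 qy]].
  have /choice[a ha] : forall i, exists a : genK (gens x), represents p`_i (val a).
    by move=> i; have [b /gen_lift[a <-] rb] := gen_field_represents (gp i); exists a.
  pose q := \poly_(i < size p) a i.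
  have hq i : (i < size p)%N -> represents p`_i (map_poly val q)`_i.
    by move=> ip; rewrite coef_map /= coef_poly ip.
  exists q.
    apply/eqP => q0; apply: pi0.
    have [ip|ip] := ltnP i0 (size p).
      by apply/(represents_mero0 (hq _ ip)); rewrite q0 map_poly0 coef0.
    rewrite nth_default //; apply/(represents_mero0 (represents_cst 0)).
    exact: (rmorph0 (@kcst R)).
  rewrite /root; apply/eqP; apply/(represents_mero0 (f := p.[f])) => //.
  apply: (@represents_horner _ _ _ _ (size p)) => //.
  by rewrite size_map_poly size_poly.
have /choice[g hg] : forall i, exists g, gen_field G g /\ represents g (val q`_i).
  by move=> i; have [g] := gen_sub_represents (genKP q`_i); exists g.
pose p := \poly_(i < size q) g i.
have hp i : (i < size q)%N -> represents p`_i (map_poly val q)`_i.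
  by move=> iq; rewrite coef_map /= coef_poly iq; have [] := hg i.
exists p; split.
- move=> i; rewrite coef_poly; case: ifP => _; last exact: (gen_cst _ 0).
  by have [] := hg i.
- exists (size q).-1; have sq : ((size q).-1 < size q)%N by rewrite prednK // size_poly_gt0.
  move=> /(represents_mero0 (hp _ sq)); rewrite coef_map /= => e.
  have /eqP : q`_(size q).-1 = 0 by exact: val_inj.
  by rewrite -lead_coefE lead_coef_eq0 (negbTE q0).
apply/(represents_mero0 (x := (map_poly val q).[y])); last exact/eqP.
apply: (@represents_horner _ _ _ _ (size q)) => //; first exact: size_poly.
by rewrite size_map_poly.
Qed.
End Gens.
End AlgebraicFun.

(** * Isogenies *)

Section Regular.
Variable R : realType.
Local Notation C := R[i].
Local Notation C2 := 'cV[C]_2.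
Local Notation K := {fraction (ent2 R)}.
Implicit Types S : set C.

Definition row_form (a : 'M[C]_2) i (z : C2) : C := (a *m z) i 0.

Lemma row_formE (a : 'M[C]_2) i z : row_form a i z = lform (a i 0) (a i 1) z.
Proof.
by rewrite /row_form mxE !big_ord_recl big_ord0 addr0 /lform; congr (_ * _ + _ * _); congr (_ _ _); apply: val_inj.
Qed.

Lemma ent2_row (f : C -> C) a i : entire f -> exists n : ent2 R, forall z, n z = f (row_form a i z).
Proof.
move=> ef; have en : f \o lform (a i 0) (a i 1) \in @ent2P R by apply/asboolP; exact: entire2_lform.
by exists (Ent2 en) => z; rewrite row_formE.
Qed.

Lemma unitmx_surj (a : 'M[C]_2) : a \in unitmx -> forall u v : C, exists z,
  row_form a 0 z = u /\ row_form a 1 z = v.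
Proof.
move=> ua u v; exists (invmx a *m \col_i (if i == 0 then u else v)).
by rewrite /row_form !mulmxA mulmxV // mul1mx !mxE.
Qed.

Lemma big_open_row (f : C -> C) a i : a \in unitmx -> entire f -> (exists u, f u != 0) ->
  big_open [set z | f (row_form a i z) != 0].
Proof.
move=> ua ef [u fu]; have [n nE] := ent2_row a i ef.
have n0 : n != 0.
  apply/ent2_neq0; have [z [z0 z1]] := unitmx_surj ua u u; exists z; rewrite nE.
  suff -> : row_form a i z = u by [].
  by case: i {nE} => [[|[|//]] hi]; [rewrite -z0|rewrite -z1]; congr row_form; exact: val_inj.
rewrite (_ : [set z | _] = [set z | n z != 0]); first exact: big_open_neq0.
by apply/seteqP; split=> z /=; rewrite nE.
Qed.

Lemma reg_row (f g : C -> C) a i : a \in unitmx -> entire f -> entire g -> (exists u, g u != 0) ->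
  exists x : K, forall z, g (row_form a i z) != 0 ->
    reg z x (f (row_form a i z) / g (row_form a i z)).
Proof.
move=> ua ef eg g0; have [n nE] := ent2_row a i ef; have [d dE] := ent2_row a i eg.
by exists (tofrac n / tofrac d) => z gz; exists n, d; rewrite -nE -dE in gz *.
Qed.

Lemma reg_ext U (x y : K) : big_open U -> (forall z, U z -> exists2 a, reg z x a & reg z y a) ->
  x = y.
Proof.
move=> oU h; apply/eqP; rewrite -subr_eq0; apply/eqP.
apply/(@represents_mero0 R (cst 0)); last by exists U; have [] := oU.
by exists U => // z /h[a ha hb]; rewrite /cst -(subrr a); apply: regD => //; exact: regN.
Qed.

(** The domain is exactly where sigma does not vanish, not just some dense open set, because
    relations in the field are later evaluated at prescribed points. *)
Definition regs S (a : 'M[C]_2) rho (x : 'I_2 -> K) := forall i z,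
  PiS S (row_form a 0 z) != 0 -> reg z (x i) (wp_sigmat S rho (a *m z) i 0).

Lemma PiS_neq0 S : latt S -> exists u, PiS S u != 0.
Proof. by move=> lS; have [u] := PiS_shift_neq0 0 lS; rewrite subr0; exists u. Qed.

Lemma latt_entire S : latt S -> entire (PiS S).
Proof. by move=> [s3 _ _ _]; exact: entire_PiS. Qed.

Lemma latt_wp S : latt S -> exists2 H, entire H & forall u, PiS S u != 0 ->
  H u = PiS S u ^+ 2 * wp S u.
Proof.
move=> [s3 S0 _ _]; have [H eH hH] := wp_extend s3 S0; exists H => // u /eqP Pu.
by apply: hH => /(PiS_eq0 u s3).
Qed.

Lemma wp_sigmat0 S rho (w : C2) : wp_sigmat S rho w 0 0 = wp S (w 0 0).
Proof. by rewrite mxE. Qed.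

Lemma wp_sigmat1 S rho (w : C2) : latt S ->
  wp_sigmat S rho w 1 0 = cexp (w 1 0) * (PiS S (w 0 0 - rho) / PiS S (w 0 0)).
Proof. by move=> [s3 S0 _ _]; rewrite mxE /= /sigmat !sigmaE. Qed.

Lemma regs_ex S a rho : latt S -> a \in unitmx -> exists x, regs S a rho x.
Proof.
move=> lS ua; have [H eH hH] := latt_wp lS; have eP := latt_entire lS.
have nP := PiS_neq0 lS.
have [x0 hx0] : exists x : K, forall z, PiS S (row_form a 0 z) != 0 ->
    reg z x (wp S (row_form a 0 z)).
  have n2 : exists u, PiS S u ^+ 2 != 0 by have [u hu] := nP; exists u; rewrite expf_neq0.
  have [x hx] := reg_row 0 ua eH (entireX 2 eP) n2; exists x => z hz.
  have := hx z; rewrite expf_neq0 // => /(_ isT); rewrite hH // mulrC mulKf // expf_neq0 //.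
have [n nE] := ent2_row a 1 (@entire_cexp R).
have [m mE] := ent2_row a 0 (PiS_shift_entire rho lS).
have [d dE] := ent2_row a 0 eP.
exists (fun i => if i == 0 then x0 else tofrac (n * m) / tofrac d) => i z hz.
case: (eqVneq i 0) => [->|i0]; first by rewrite wp_sigmat0; exact: hx0.
have -> : i = 1 by case: i i0 => [[|[|//]] hi] // _; exact: val_inj.
rewrite wp_sigmat1 //; exists (n * m), d; split=> //; first by rewrite dE.
by rewrite ent2M nE mE dE mulrA.
Qed.

Lemma regs_represents S a rho x : latt S -> a \in unitmx -> regs S a rho x ->
  forall i, represents (fun z => (wp_sigmat S rho \o mulmx a) z i 0) (x i).
Proof.
move=> lS ua hx i; exists [set z | PiS S (row_form a 0 z) != 0].
  by apply: big_open_row => //; [exact: latt_entire|exact: PiS_neq0].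
by move=> z /=; exact: hx.
Qed.

Lemma algebraic_mapP S1 S2 xi1 xi2 a x y : latt S1 -> latt S2 -> a \in unitmx ->
  regs S1 1%:M xi1 x -> regs S2 a xi2 y ->
  algebraic_map (wp_sigmat S1 xi1) (wp_sigmat S2 xi2 \o mulmx a) <->
  forall i, alg_over (gens x) (y i).
Proof.
move=> l1 l2 ua hx hy.
have rx i : represents (fun z => wp_sigmat S1 xi1 z i 0) (x i).
  apply: represents_eq (regs_represents l1 (unitmx1 _ _) hx i) => z /=.
  by rewrite mul1mx.
by split=> h i; apply/(algebraic_funP rx (regs_represents l2 ua hy i)).
Qed.

(** C is algebraically closed, so [q] splits and its only roots in [K] are constants. *)
Lemma kcst_root (q : {poly C}) (y : K) : q != 0 -> (forall c, y <> kcst c) ->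
  (map_poly (@kcst R) q).[y] != 0.
Proof.
move=> q0 hy; have [r ->] := closed_field_poly_normal q.
rewrite map_polyZ /= hornerZ mulf_neq0 //; first by rewrite fmorph_eq0 lead_coef_eq0.
rewrite rmorph_prod horner_prod prodf_seq_neq0; apply/allP => c _ /=.
rewrite rmorphB /= map_polyX map_polyC hornerXsubC subr_eq0.
by apply/eqP; exact: hy.
Qed.

(** The combination of [theta_dep], divided by [E 0 ^+ (d + d)], is a polynomial relation between
    [x] and [y] over C. It stays nonzero as a polynomial in [x], since the nonconstant [y] is not a
    root of the nonzero coefficient [q i0]. *)
Lemma theta_alg S (E : 'I_3 -> C -> C) a i (x y : K) (A : set K) :
  latt S -> a \in unitmx -> (forall j, entire (E j)) ->
  (forall l, S l -> exists2 c, entire c & forall j u, E j (u + l) = c u * E j u) ->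
  (exists u, E 0 u != 0) ->
  (forall z, E 0 (row_form a i z) != 0 ->
    reg z x (E 1 (row_form a i z) / E 0 (row_form a i z)) /\
    reg z y (E 2%:R (row_form a i z) / E 0 (row_form a i z))) ->
  (forall c, y <> kcst c) -> range (@kcst R) `<=` A -> alg_over A y -> alg_over A x.
Proof.
move=> lS ua eE hE E0 hxy hy cA ay.
have [d [Q [[[i0 j0] Q0] hQ]]] := theta_dep lS eE hE.
have rel : \sum_t kcst (Q t) * (x ^+ t.1 * y ^+ t.2) = 0.
  apply: (reg_ext (big_open_row i ua (eE 0) E0)) => z /= hz.
  have [rx ry] := hxy z hz.
  set u := row_form a i z in hz rx ry *.
  exists 0; last by have := @reg_cst R z 0; rewrite rmorph0.
  have -> : 0 = \sum_t Q t * ((E 1 u / E 0 u) ^+ t.1 * (E 2%:R u / E 0 u) ^+ t.2).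
    apply: (mulfI (expf_neq0 (d + d) hz)); rewrite mulr0; apply: (etrans (esym (hQ u))); rewrite mulr_sumr.
    apply: eq_bigr => -[i1 j1] _ /=.
    have -> : (d + d = i1 + j1 + (d - i1 + (d - j1)))%N.
      have := ltn_ord i1; have := ltn_ord j1; rewrite !ltnS.
      by move: (nat_of_ord i1) (nat_of_ord j1) => p q; lia.
    have z1 : E 0 u ^+ i1 != 0 by rewrite expf_neq0.
    have z2 : E 0 u ^+ j1 != 0 by rewrite expf_neq0.
    rewrite !expr_div_n !exprD; move: (E 0 u ^+ i1) (E 0 u ^+ j1) z1 z2 => p q p0 q0.
    by field; rewrite p0 q0.
  apply: reg_sum => t; apply: regM; first exact: reg_cst.
  by apply: regM; exact: regX.
pose q (i1 : 'I_d.+1) := \sum_(j < d.+1) Q (i1, j) *: 'X^j.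
pose p : {poly K} := \sum_(i1 < d.+1) (map_poly (@kcst R) (q i1)).[y] *: 'X^i1.
have coefp (i1 : 'I_d.+1) : p`_i1 = (map_poly (@kcst R) (q i1)).[y].
  rewrite coef_sum (bigD1 i1) //= coefZ coefXn eqxx mulr1 big1 ?addr0 // => i2 i12.
  by rewrite coefZ coefXn -(inj_eq val_inj) eq_sym in i12 *; rewrite (negbTE i12) mulr0.
have qy i1 : (map_poly (@kcst R) (q i1)).[y] = \sum_(j < d.+1) kcst (Q (i1, j)) * y ^+ j.
  rewrite rmorph_sum /= horner_sum; apply: eq_bigr => j _.
  by rewrite map_polyZ /= map_polyXn hornerZ hornerXn.
have q0 : q i0 != 0.
  apply/eqP => /(congr1 (fun p : {poly C} => p`_j0)); rewrite coef0 coef_sum (bigD1 j0) //=.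
  rewrite coefZ coefXn eqxx mulr1 big1 ?addr0; first by move/eqP; rewrite (negbTE Q0).
  by move=> j jj; rewrite coefZ coefXn eq_sym (inj_eq val_inj) (negbTE jj) mulr0.
apply: (@alg_over_root _ _ p).
- apply/eqP => p0; have := coefp i0; rewrite p0 coef0 => /esym/eqP.
  by rewrite (negbTE (kcst_root q0 hy)).
- rewrite /root horner_sum; apply/eqP; apply: etrans rel.
  rewrite (eq_bigr (fun i1 : 'I_d.+1 => \sum_(j < d.+1) kcst (Q (i1, j)) * y ^+ j * x ^+ i1)).
    rewrite pair_bigA; apply: eq_bigr => -[i1 j1] _ /=; ring.
  by move=> i1 _; rewrite hornerZ hornerXn qy mulr_suml.
move=> k; rewrite coef_sum.
have h0 : alg_over A 0 by rewrite -(subrr 1); apply: alg_overD; [|apply: alg_overN]; exact: alg_over1.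
elim/big_ind: _ => [//|b c|i1 _]; first exact: alg_overD.
rewrite coefZ coefXn; apply: alg_overM; last by case: (k == i1 :> nat); [exact: alg_over1|exact: h0].
rewrite qy; elim/big_ind: _ => [//|b c|j1 _]; first exact: alg_overD.
apply: alg_overM; last exact: alg_overX.
by apply/alg_over_gen/gs_gen/cA; exists (Q (i1, j1)).
Qed.
End Regular.

Section Isogeny.
Variable R : realType.
Local Notation C := R[i].
Local Notation C2 := 'cV[C]_2.
Local Notation K := {fraction (ent2 R)}.
Implicit Types S : set C.

(** [f] cannot vanish on the whole disc of radius [r / 4] around [r / 2], which lies in the
    punctured disc where wp is large. *)
Lemma wp_unbounded S (f : C -> C) (M : R) : latt S -> entire f -> (exists u, f u != 0) ->
  exists u, [/\ PiS S u != 0, f u != 0 & M <= nm (wp S u)].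
Proof.
move=> [s3 S0 _ _] ef [v fv]; have [r r0 hr] := wp_large M s3 S0.
pose c : C := (r / 2)%:C%C; have r40 : 0 < r / 4 by lra.
have nc : nm c = r / 2 by rewrite /c nm_real ger0_norm //; lra.
have [u uc fu] : exists2 u, nm (u - c) <= r / 4 & f u != 0.
  apply: contrapT => h; move/eqP: fv; apply; apply: (entire_ident (c := c) r40 ef) => z zc.
  by apply/eqP/negPn/negP => fz; apply: h; exists z.
have [||Su hu] := hr u.
- by rewrite -nm_gt0; have := nmBge c u; rewrite (nmBC c u); lra.
- by have := nmBge u c; lra.
by exists u; split=> //; apply/eqP => /(PiS_eq0 u s3).
Qed.

Lemma wp_nonconst S a (x : K) : latt S -> a \in unitmx ->
  (forall z, PiS S (row_form a 0 z) != 0 -> reg z x (wp S (row_form a 0 z))) ->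
  forall c, x <> kcst c.
Proof.
move=> lS ua hx c xc.
have [u [Pu _ hu]] := wp_unbounded (nm c + 1) lS (latt_entire lS) (PiS_neq0 lS).
have [z [z0 _]] := unitmx_surj ua u 0.
have := hx z; rewrite z0 => /(_ Pu); rewrite xc => /reg_uniq/(_ (reg_cst z c)) e.
by move: hu; rewrite e; lra.
Qed.

(** Off [S] this is the periodicity of wp; it extends to the poles because both sides are entire. *)
Lemma sigma2_factor S H : latt S -> entire H ->
  (forall u, PiS S u != 0 -> H u = PiS S u ^+ 2 * wp S u) ->
  forall l, S l -> exists2 e, entire e &
    forall u, PiS S (u + l) ^+ 2 = e u * PiS S u ^+ 2 /\ H (u + l) = e u * H u.
Proof.
move=> lS eH hH l Sl; have [s3 S0 SB _] := lS; have eP := latt_entire lS.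
have [c [a [c0 hc]]] := PiS_period lS Sl.
pose e u := (c * cexp (a * u)) ^+ 2.
have ee : entire e.
  apply: entireX; apply: entireM; first exact: entire_cst.
  by apply: entire_eq (entire_affine a 0 (@entire_cexp R)) => u; rewrite addr0.
exists e => // u; split; first by rewrite hc exprMn.
have eHl : entire (fun u => H (u + l)).
  by apply: entire_eq (entire_affine 1 l eH) => z; rewrite mul1r.
apply: (entire_off_eq s3 eHl (entireM ee eH)) => {}u Su.
have Pu : PiS S u != 0 by apply/eqP => /(PiS_eq0 u s3).
have Pul : PiS S (u + l) != 0 by rewrite hc mulf_neq0 // mulf_neq0 // cexp_neq0.
by rewrite !hH // wp_period // hc exprMn mulrA.
Qed.

Lemma theta_alg3 S (D N1 N2 : C -> C) a i (x y : K) (A : set K) :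
  latt S -> a \in unitmx -> entire D -> entire N1 -> entire N2 ->
  (forall l, S l -> exists2 c, entire c & forall u,
     [/\ D (u + l) = c u * D u, N1 (u + l) = c u * N1 u & N2 (u + l) = c u * N2 u]) ->
  (exists u, D u != 0) ->
  (forall z, D (row_form a i z) != 0 ->
    reg z x (N1 (row_form a i z) / D (row_form a i z)) /\
    reg z y (N2 (row_form a i z) / D (row_form a i z))) ->
  (forall c, y <> kcst c) -> range (@kcst R) `<=` A -> alg_over A y -> alg_over A x.
Proof.
move=> lS ua eD e1 e2 hE D0 hxy hy cA.
pose E (j : 'I_3) := nth D [:: D; N1; N2] j.
apply: (@theta_alg _ S E a i) => //; first by case=> [[|[|[|//]]] hj].
move=> l /hE[c ec hc]; exists c => // -[[|[|[|//]]] hj] u;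
  by have [] := hc u.
Qed.

Lemma isogeny_alg S1 S2 mu xi : latt S1 -> latt S2 -> mu != 0 ->
  [set w | S2 (w / mu)] `<=` S1 ->
  exists2 g : 'M[C]_2, g \in unitmx & forall a x y, a \in unitmx ->
    regs S1 (g *m a) (mu * xi) x -> regs S2 a xi y ->
    forall A : set K, range (@kcst R) `<=` A ->
    (forall i, alg_over A (x i)) <-> (forall i, alg_over A (y i)).
Proof.
move=> l1 l2 mu0 sub; pose S := [set w | S2 (w / mu)].
have lS : latt S := latt_scale mu0 l2.
set rho := mu * xi.
have [n [c [k [F [n0 k0 hF hmul hrel]]]]] := sigmat_ratio rho l1 lS sub.
have nC : n%:R != 0 :> C by rewrite pnatr_eq0 -lt0n.
(* [u] becomes [mu * u] and [v] becomes [n * v - c * mu * u]: the [n] produces the power of the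
   second coordinate, and the last term cancels the [cexp (c * u)] of [sigmat_ratio]. *)
pose g : 'M[C]_2 := \matrix_(i, j) if i == 0 then (if j == 0 then mu else 0)
                                   else (if j == 0 then - (c * mu) else n%:R).
have ug : g \in unitmx.
  rewrite unitmxE (_ : \det g = mu * n%:R) ?unitfE ?mulf_neq0 //.
  by rewrite (expand_det_row _ 0) !big_ord_recl big_ord0 !mxE /= mul0r !addr0 /cofactor
     det_mx11 !mxE /= expr0 mul1r.
exists g; first exact: ug.
move=> a x y ua hx hy A cA.
pose b := g *m a; have ub : b \in unitmx by rewrite unitmx_mul ug.
have b0 z : row_form b 0 z = mu * row_form a 0 z.
  by rewrite /b row_formE /lform !mxE !big_ord_recl !big_ord0 !mxE /= row_formE /lform; ring.
have b1 z : row_form b 1 z = n%:R * row_form a 1 z - c * row_form b 0 z.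
  rewrite b0 /b !row_formE /lform !mxE !big_ord_recl !big_ord0 !mxE /=.
  have -> : lift ord0 ord0 = 1 :> 'I_2 by exact: val_inj.
  ring.
(* [Y] is the pair of the scaled lattice [S] in the coordinates of [x]; by homogeneity [Y 0] is
   [y 0] up to a constant. *)
have [Y hY] := regs_ex rho lS ub.
have [[eF0 nF0] [eF1 nF1]] := (hF false, hF true).
(* [f] is the function elliptic for [S] that relates [x 1] to [y 1 ^+ n]. *)
have [f hf] := reg_row 0 ub eF1 eF0 nF0.
have [H1 eH1 hH1] := latt_wp l1; have [H eH hH] := latt_wp lS.
have [eP1 eP] := (latt_entire l1, latt_entire lS).
have [nP1 nP] := (PiS_neq0 l1, PiS_neq0 lS).
have n2 S' : latt S' -> exists u, PiS S' u ^+ 2 != 0.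
  by move=> /PiS_neq0[u hu]; exists u; rewrite expf_neq0.
have Px z : PiS S1 (row_form b 0 z) != 0 -> reg z (x 0) (wp S1 (row_form b 0 z)).
  by move=> /(hx 0); rewrite wp_sigmat0.
have PY z : PiS S (row_form b 0 z) != 0 -> reg z (Y 0) (wp S (row_form b 0 z)).
  by move=> /(hY 0); rewrite wp_sigmat0.
have scaleP z : PiS S (row_form b 0 z) = mu * PiS S2 (row_form a 0 z).
  by rewrite b0 PiS_scale.
have yY : y 0 = kcst (mu ^+ 2) * Y 0.
  apply: (reg_ext (big_open_row 0 ub eP nP)) => z /= hz.
  exists (wp S2 (row_form a 0 z)).
    have := hy 0 z; rewrite wp_sigmat0; apply.
    by move: hz; rewrite scaleP mulf_eq0 negb_or => /andP[].
  rewrite (wp_scale mu0 _ l2) -b0; apply: regM; [exact: reg_cst | exact: PY].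
have kA d : alg_over A (kcst d) by apply/alg_over_gen/gs_gen/cA; exists d.
have kmu : kcst (mu ^+ 2) != 0 :> K by rewrite fmorph_eq0 expf_neq0.
have Yy : Y 0 = (kcst (mu ^+ 2))^-1 * y 0 by rewrite yY (mulKf kmu).
have y0Y : alg_over A (y 0) <-> alg_over A (Y 0).
  split=> h; first by rewrite Yy; exact: (alg_overM (alg_overV (kA _)) h).
  by rewrite yY; exact: (alg_overM (kA _) h).
(* [x 0] and [Y 0] are both elliptic for the smaller lattice [S], hence
   algebraically dependent. *)
have fac1 l : S l -> exists2 e, entire e &
    forall u, PiS S1 (u + l) ^+ 2 = e u * PiS S1 u ^+ 2 /\ H1 (u + l) = e u * H1 u.
  by move=> /sub; exact: sigma2_factor.
have facS := sigma2_factor lS eH hH.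
pose D1 u := PiS S1 u ^+ 2 * PiS S u ^+ 2.
have eD1 : entire D1 by apply: entireM; exact: entireX.
have nD1 : exists u, D1 u != 0 by apply: entire_mul_neq0; [exact: entireX|exact: entireX|exact: n2|exact: n2].
have D1reg z : D1 (row_form b 0 z) != 0 ->
    reg z (x 0) (H1 (row_form b 0 z) * PiS S (row_form b 0 z) ^+ 2 / D1 (row_form b 0 z)) /\
    reg z (Y 0) (H (row_form b 0 z) * PiS S1 (row_form b 0 z) ^+ 2 / D1 (row_form b 0 z)).
  rewrite /D1 mulf_eq0 !expf_eq0 /= negb_or => /andP[p1 p2].
  rewrite hH1 // hH //; split.
    have -> : PiS S1 (row_form b 0 z) ^+ 2 * wp S1 (row_form b 0 z) * PiS S (row_form b 0 z) ^+ 2 /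
      (PiS S1 (row_form b 0 z) ^+ 2 * PiS S (row_form b 0 z) ^+ 2) = wp S1 (row_form b 0 z).
      by field; rewrite p1 p2.
    exact: Px.
  have -> : PiS S (row_form b 0 z) ^+ 2 * wp S (row_form b 0 z) * PiS S1 (row_form b 0 z) ^+ 2 /
    (PiS S1 (row_form b 0 z) ^+ 2 * PiS S (row_form b 0 z) ^+ 2) = wp S (row_form b 0 z).
    by field; rewrite p1 p2.
  exact: PY.
have mul1 l : S l -> exists2 e, entire e & forall u,
   [/\ D1 (u + l) = e u * D1 u, H1 (u + l) * PiS S (u + l) ^+ 2 = e u * (H1 u * PiS S u ^+ 2) &
       H (u + l) * PiS S1 (u + l) ^+ 2 = e u * (H u * PiS S1 u ^+ 2)].
  move=> Sl; have [e1 ee1 h1] := fac1 l Sl; have [e2 ee2 h2] := facS l Sl.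
  exists (fun u => e1 u * e2 u); first exact: entireM.
  by move=> u; rewrite /D1; have [-> ->] := h1 u; have [-> ->] := h2 u; split; ring.
have xY : alg_over A (Y 0) -> alg_over A (x 0).
  apply: (@theta_alg3 S D1 (fun u => H1 u * PiS S u ^+ 2) (fun u => H u * PiS S1 u ^+ 2) b 0) => //.
  - by apply: entireM => //; exact: entireX.
  - by apply: entireM => //; exact: entireX.
  - exact: wp_nonconst lS ub PY.
have Yx : alg_over A (x 0) -> alg_over A (Y 0).
  apply: (@theta_alg3 S D1 (fun u => H u * PiS S1 u ^+ 2) (fun u => H1 u * PiS S u ^+ 2) b 0) => //.
  - by apply: entireM => //; exact: entireX.
  - by apply: entireM => //; exact: entireX.
  - by move=> l /mul1[e ee he]; exists e => // u; have [] := he u.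
  - by move=> z /D1reg[].
  - exact: wp_nonconst l1 ub Px.
have fY : alg_over A (Y 0) -> alg_over A f.
  pose D2 u := F false u * PiS S u ^+ 2.
  have eD2 : entire D2 by apply: entireM => //; exact: entireX.
  apply: (@theta_alg3 S D2 (fun u => F true u * PiS S u ^+ 2) (fun u => H u * F false u) b 0) => //.
  - by apply: entireM => //; exact: entireX.
  - exact: entireM.
  - move=> l Sl; have [e1 ee1 h1] := hmul l Sl; have [e2 ee2 h2] := facS l Sl.
    exists (fun u => e1 u * e2 u); first exact: entireM.
    by move=> u; rewrite /D2 !h1; have [-> ->] := h2 u; split; ring.
  - by apply: entire_mul_neq0 => //; [exact: entireX|exact: n2].
  - move=> z; rewrite /D2 mulf_eq0 expf_eq0 /= negb_or => /andP[p1 p2]; rewrite hH //; split.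
      have -> : F true (row_form b 0 z) * PiS S (row_form b 0 z) ^+ 2 /
        (F false (row_form b 0 z) * PiS S (row_form b 0 z) ^+ 2) =
        F true (row_form b 0 z) / F false (row_form b 0 z) by field; rewrite p1 p2.
      exact: hf.
    have -> : PiS S (row_form b 0 z) ^+ 2 * wp S (row_form b 0 z) * F false (row_form b 0 z) /
      (F false (row_form b 0 z) * PiS S (row_form b 0 z) ^+ 2) = wp S (row_form b 0 z).
      by field; rewrite p1 p2.
    exact: PY.
  - exact: wp_nonconst lS ub PY.
pose W u := F false u * (PiS S1 u * PiS S u).
have eW : entire W by apply: entireM => //; exact: entireM.
have nW : exists u, W u != 0.
  by apply: entire_mul_neq0 => //; [exact: entireM | exact: entire_mul_neq0].
have x1E : x 1 = kcst k * y 1 ^+ n * f.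
  apply: (reg_ext (big_open_row 0 ub eW nW)) => z /=.
  rewrite /W !mulf_eq0 !negb_or => /and3P[p1 p2 p3].
  have p4 : PiS S2 (row_form a 0 z) != 0.
    by move: p3; rewrite scaleP mulf_eq0 negb_or => /andP[].
  have r1 : reg z (x 1) (cexp (row_form b 1 z) *
      (PiS S1 (row_form b 0 z - rho) / PiS S1 (row_form b 0 z))).
    by have := hx 1 z p2; rewrite wp_sigmat1.
  have r2 : reg z (y 1) (cexp (row_form a 1 z) *
      (PiS S2 (row_form a 0 z - xi) / PiS S2 (row_form a 0 z))).
    by have := hy 1 z p4; rewrite wp_sigmat1.
  eexists; first exact: r1.
  suff -> : cexp (row_form b 1 z) * (PiS S1 (row_form b 0 z - rho) / PiS S1 (row_form b 0 z)) =
    k * (cexp (row_form a 1 z) * (PiS S2 (row_form a 0 z - xi) / PiS S2 (row_form a 0 z))) ^+ n *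
    (F true (row_form b 0 z) / F false (row_form b 0 z)).
    exact: (regM (regM (reg_cst z k) (regX n r2)) (hf z p1)).
  have -> : PiS S2 (row_form a 0 z - xi) / PiS S2 (row_form a 0 z) =
            PiS S (row_form b 0 z - rho) / PiS S (row_form b 0 z).
    rewrite scaleP b0 /rho -mulrBr (PiS_scale mu0 _ l2) -mulf_div divff // mul1r //.
  have := hrel (row_form b 0 z).
  rewrite b1 cexpB cexp_nat exprMn expr_div_n.
  have := cexp_neq0 (c * row_form b 0 z); have := expf_neq0 n p3.
  set u := row_form b 0 z in p1 p2 p3 *.
  move: (cexp (c * u)) (PiS S u ^+ n) (PiS S (u - rho) ^+ n) (cexp _ ^+ n) => e s s' e' s0 e0 hr.
  apply: (mulIf (mulf_neq0 e0 (mulf_neq0 p2 (mulf_neq0 s0 p1)))).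
  have -> : e' / e * (PiS S1 (u - rho) / PiS S1 u) * (e * (PiS S1 u * (s * F false u))) =
    e' * (PiS S1 (u - rho) * s * F false u) by field; rewrite e0 p2.
  by rewrite hr; field; rewrite p1 s0.
have f0 : f != 0.
  apply/eqP => f0; have [v hv] := entire_mul_neq0 eF0 eF1 nF0 nF1.
  have [z [z0 _]] := unitmx_surj ub v 0.
  move: hv; rewrite -z0 mulf_eq0 negb_or => /andP[q0 q1].
  have := hf z q0; rewrite f0 => /reg0/eqP.
  by rewrite mulf_eq0 invr_eq0 (negbTE q0) (negbTE q1).
have kk : kcst k != 0 :> K by rewrite fmorph_eq0.
have is1 (i : 'I_2) : i != 0 -> i = 1.
  by case: i => [[|[|//]] hi] // _; exact: val_inj.
split=> h.
  have aY := Yx (h 0); have af := fY aY.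
  have y1E : y 1 ^+ n = (kcst k)^-1 * x 1 * f^-1.
    apply: (mulfI kk); apply: (mulIf f0); rewrite -x1E.
    by rewrite mulrA mulrA (mulfV kk) mul1r (divfK f0).
  move=> i; case: (eqVneq i 0) => [->|/is1 ->]; first exact: (y0Y.2 aY).
  apply: (alg_over_rootn n0); rewrite y1E.
  exact: (alg_overM (alg_overM (alg_overV (kA k)) (h 1)) (alg_overV af)).
have aY := y0Y.1 (h 0).
move=> i; case: (eqVneq i 0) => [->|/is1 ->]; first exact: (xY aY).
rewrite x1E; exact: (alg_overM (alg_overM (kA k) (alg_overX n (h 1))) (fY aY)).
Qed.
End Isogeny.

(** * Commensurability *)

Section Relation.
Variables (F K : fieldType) (kc : {rmorphism F -> K}) (x : 'I_2 -> K).
Local Notation gens := (range kc `|` range x).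

Let ev1 : {rmorphism {poly F} -> K} := horner_eval (x 0) \o map_poly kc.
Let ev : {rmorphism {poly {poly F}} -> K} := horner_eval (x 1) \o map_poly ev1.

Lemma evE (P : {poly {poly F}}) n : (size P <= n)%N -> (forall j, (size (P`_j)%R <= n)%N) ->
  ev P = \sum_(j < n) (\sum_(i < n) kc (P`_j`_i) * x 0 ^+ i) * x 1 ^+ j.
Proof.
move=> sP sPj; have -> : ev P = (map_poly ev1 P).[x 1] by [].
rewrite (@horner_coef_wide _ n); last first.
  by apply: leq_trans sP; exact: size_poly.
apply: eq_bigr => j _; rewrite -/ev1 (coef_map ev1); congr (_ * _).
rewrite /ev1 /= /horner_eval (@horner_coef_wide _ n); last first.
  by apply: leq_trans (sPj j); exact: size_poly.
by apply: eq_bigr => i _; rewrite coef_map.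
Qed.

Lemma evC p : ev p%:P = ev1 p.
Proof. exact: (etrans (congr1 (horner_eval (x 1)) (map_polyC ev1 p)) (hornerC _ _)). Qed.

Lemma ev1C c : ev1 c%:P = kc c.
Proof. exact: (etrans (congr1 (horner_eval (x 0)) (map_polyC kc c)) (hornerC _ _)). Qed.

Lemma ev1X : ev1 'X = x 0.
Proof. exact: (etrans (congr1 (horner_eval (x 0)) (map_polyX kc)) (hornerX _)). Qed.

Lemma evX : ev 'X = x 1.
Proof. exact: (etrans (congr1 (horner_eval (x 1)) (map_polyX ev1)) (hornerX _)). Qed.

Lemma ev_den1 b P : b = ev P -> exists P Q, ev Q != 0 /\ b * ev Q = ev P.
Proof.
move=> bP; have e1 : ev 1 = 1 := rmorph1 ev.
have n1 : ev 1 != 0 by rewrite e1; exact: oner_neq0.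
by exists P, 1; apply: (conj n1); rewrite e1 bP; exact: mulr1.
Qed.

(** Every element of the generated field is a quotient of polynomials in [x 0] and [x 1], the outer
    variable of [{poly {poly F}}] being [x 1]. *)
Lemma gen_sub_ev b : gen_sub (gens) b -> exists P Q, ev Q != 0 /\ b * ev Q = ev P.
Proof.
elim=> [_ [[c _ <-]|[i _ <-]]||b1 b2 _ [P1 [Q1 [q1 h1]]] _ [P2 [Q2 [q2 h2]]]|b1 _ [P1 [Q1 [q1 h1]]]
   |b1 b2 _ [P1 [Q1 [q1 h1]]] _ [P2 [Q2 [q2 h2]]]|b1 _ [P1 [Q1 [q1 h1]]]].
- by apply: (ev_den1 (P := c%:P%:P)); rewrite evC ev1C.
- apply: (ev_den1 (P := if i == 0 then 'X%:P else 'X)).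
  case: (eqVneq i 0) => [->|i0]; first by rewrite evC ev1X.
  have -> : i = 1 by case: i i0 => [[|[|//]] hi] // _; exact: val_inj.
  by rewrite evX.
- by apply: (ev_den1 (P := 1)); rewrite rmorph1.
- exists (P1 * Q2 + P2 * Q1), (Q1 * Q2); rewrite rmorphD !rmorphM; split; first exact: mulf_neq0.
  by rewrite -h1 -h2; move: (ev Q1) (ev Q2) => u v; ring.
- by exists (- P1), Q1; split; [exact: q1 | rewrite rmorphN -h1; exact: mulNr].
- exists (P1 * P2), (Q1 * Q2); rewrite !rmorphM; split; first exact: mulf_neq0.
  by rewrite -h1 -h2; exact: mulrACA.
have [b0|b0] := eqVneq b1 0.
  by apply: (ev_den1 (P := 0)); rewrite b0 invr0 rmorph0.
exists Q1, P1; rewrite -h1; split; first exact: mulf_neq0.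
exact: mulKf.
Qed.

Lemma alg_relation (y : K) : alg_over (gens) y -> exists D (Q : 'I_D -> 'I_D -> 'I_D -> F),
  (exists i j k, Q i j k != 0) /\
  \sum_(j < D) (\sum_(i < D) (\sum_(k < D) kc (Q i j k) * y ^+ k) * x 0 ^+ i) * x 1 ^+ j = 0.
Proof.
move=> [q q0 qy].
have /choice[PQ hPQ] : forall k, exists PQ : {poly {poly F}} * {poly {poly F}},
    ev PQ.2 != 0 /\ val (q`_k) * ev PQ.2 = ev PQ.1.
  by move=> k; have [P [Q [h1 h2]]] := gen_sub_ev (genKP q`_k); exists (P, Q).
pose n := size q.
(* A common denominator of the coefficients of [q]; [P k] is the [k]-th coefficient after
   multiplication by [B]. *)
pose B := \prod_(k < n) (PQ k).2.
have B0 : ev B != 0.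
  by rewrite rmorph_prod; apply/prodf_neq0 => k _; have [] := hPQ k.
pose P (k : 'I_n) := (PQ k).1 * \prod_(l < n | l != k) (PQ l).2.
have PE k : ev (P k) = val (q`_k) * ev B.
  have -> : B = (PQ k).2 * \prod_(l < n | l != k) (PQ l).2 by rewrite /B (bigD1 k).
  rewrite /P !(rmorphM ev) mulrA; congr (_ * _).
  by have [_ ->] := hPQ k.
have n0 : (0 < n)%N by rewrite size_poly_gt0.
have k0n : (n.-1 < n)%N by rewrite prednK.
pose k0 := Ordinal k0n.
have Pk0 : P k0 != 0.
  apply/eqP => h; have := PE k0; rewrite h rmorph0 => /esym/eqP.
  rewrite mulf_eq0 (negbTE B0) orbF => /eqP hv.
  have /eqP : q`_n.-1 = 0 by exact: val_inj.
  by rewrite -lead_coefE lead_coef_eq0 (negbTE q0).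
have [j0 [i0 Q0]] : exists j0 i0, (P k0)`_j0`_i0 != 0.
  apply: contrapT => h; move/eqP: Pk0; apply; apply/polyP => j; apply/polyP => i.
  by rewrite !coef0; apply/eqP/negPn/negP => e; apply: h; exists j, i.
(* One bound for the degrees in all three variables, so that a single index type ['I_D] serves. *)
pose D := (n + \sum_(k < n) (size (P k) + \sum_(j < size (P k)) size ((P k)`_j)%R))%N.
have sPD k : (size (P k) + \sum_(j < size (P k)) size ((P k)`_j)%R <= D)%N.
  by rewrite /D (bigD1 k) //= addnCA leq_addr.
have sP k : (size (P k) <= D)%N by apply: leq_trans (sPD k); rewrite leq_addr.
have sPj k j : (size ((P k)`_j)%R <= D)%N.
  have [jk|jk] := ltnP j (size (P k)); last by rewrite nth_default // size_poly0.
  apply: leq_trans (sPD k); rewrite (bigD1 (Ordinal jk)) //= addnCA leq_addr //.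
have nD : (n <= D)%N by rewrite leq_addr.
pose Pn (k : nat) : {poly {poly F}} := if insub k is Some k' then P k' else 0.
have PnE k (h : (k < n)%N) : Pn k = P (Ordinal h) by rewrite /Pn insubT.
exists D, (fun i j k => (Pn k)`_j`_i); split.
  have j0D : (j0 < D)%N.
    apply: leq_trans (sP k0); rewrite ltnNge; apply: contra Q0 => h.
    by rewrite [(P k0)`_j0]nth_default // coef0.
  have i0D : (i0 < D)%N.
    by apply: leq_trans (sPj k0 j0); rewrite ltnNge; apply: contra Q0 => h; rewrite nth_default.
  exists (Ordinal i0D), (Ordinal j0D), (widen_ord nD k0) => /=.
  by rewrite (PnE _ k0n).
transitivity (\sum_(k < D) (\sum_(j < D) (\sum_(i < D) kc ((Pn k)`_j`_i) * x 0 ^+ i) * x 1 ^+ j) * y ^+ k).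
  under [RHS]eq_bigr do rewrite mulr_suml.
  rewrite [RHS]exchange_big /=; apply: eq_bigr => j _.
  rewrite mulr_suml; under [RHS]eq_bigr do rewrite mulr_suml mulr_suml.
  rewrite [RHS]exchange_big /=; apply: eq_bigr => i _.
  by rewrite !mulr_suml; apply: eq_bigr => k _; ring.
apply: (mulIf B0); rewrite mul0r mulr_suml.
move/eqP: qy; rewrite (@horner_coef_wide _ n); last by exact: size_poly.
move=> qy; transitivity (\sum_(k < n) val (q`_k) * y ^+ k * ev B * ev B); last first.
  rewrite -!mulr_suml (eq_bigr (fun k : 'I_n => (map_poly val q)`_k * y ^+ k)) ?qy ?mul0r //.
  by move=> k _; rewrite coef_map.
rewrite (big_ord_widen_cond D xpredT (fun k => val (q`_k) * y ^+ k * ev B * ev B)) //.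
rewrite [RHS]big_mkcond; apply: eq_bigr => k _; case: ifP => kn.
  rewrite (PnE _ kn) -evE // PE /=; ring.
rewrite /Pn insubF // big1 ?mul0r // => j _; rewrite big1 ?mul0r // => i _.
by rewrite !coef0 rmorph0 mul0r.
Qed.
End Relation.

(** * Accumulating zeros, unbounded values and the pigeonhole principle *)

Section Density.
Variable R : realType.
Local Notation C := R[i].
Implicit Types (f : C -> C) (S : set C).

(** Once the coefficients below [k] vanish, a zero [u] with [nm u <= 1 / 2] gives
    [nm (a k) <= 2 * B * nm u], the rest of the series being geometric; and [u] may be taken
    arbitrarily small. *)
Lemma entire_acc f : entire f ->
  (forall e, 0 < e -> exists u, [/\ u != 0, nm u <= e & f u = 0]) -> forall u, f u = 0.
Proof.
move=> ef hf; have [a ta] := entire_taylor ef.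
have [B B0 hB] := entire_bounded 1 ef.
have aB j : nm (a j) <= B.
  have h1 : 0 < 1 :> R by lra.
  have hM u : nm u = 1 -> nm (f u) <= B by move=> u1; apply: hB; rewrite /disc /= u1.
  by have := taylor_cauchy j h1 ta hM; rewrite expr1n mulr1.
apply: (taylor_eq0 ta) => k; elim/ltn_ind: k => k IH; apply: nm_eps0 => e e0.
pose d := Num.min (1 / 2) (e / (2 * B + 1)).
have B1 : 0 < 2 * B + 1 by lra.
have d0 : 0 < d by rewrite lt_min !divr_gt0.
have [u [u0 ud fu]] := hf d d0; set t := nm u.
have t0 : 0 < t by rewrite nm_gt0.
have t2 : t <= 1 / 2 by apply: le_trans ud _; rewrite ge_min lexx.
have te : 2 * B * t <= e.
  have : t <= e / (2 * B + 1) by apply: le_trans ud _; rewrite ge_min lexx orbT.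
  by rewrite ler_pdivlMr; lra.
have partial n : (k < n)%N ->
    nm (\sum_(j < n) a j * u ^+ j - a k * u ^+ k) <= 2 * B * (t ^+ k.+1 - t ^+ n).
  elim: n => // n IHn; rewrite ltnS leq_eqVlt => /orP[/eqP <-|kn].
    rewrite big_ord_recr /= big1 ?add0r ?subrr ?nm0 ?mulr0 // => j _.
    by rewrite IH ?mul0r.
  rewrite big_ord_recr /= addrAC; apply: le_trans (nmD _ _) _.
  have h1 := IHn kn; have h2 : nm (a n * u ^+ n) <= B * t ^+ n.
    by rewrite nmM nmX ler_wpM2r ?exprn_ge0 // ltW.
  have h3 : t ^+ n.+1 <= t ^+ n / 2.
    by rewrite exprS mulrC ler_wpM2l ?exprn_ge0 ?(ltW t0) //; lra.
  have := ler_wpM2l B0 h3; lra.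
have key : nm (a k) * t ^+ k <= e * t ^+ k.
  apply: le_trans (_ : 2 * B * t ^+ k.+1 <= _); last first.
    by rewrite exprS mulrA ler_wpM2r ?exprn_ge0 // ltW.
  apply/ler_addgt0Pr => c c0; have [N hN] := ta t c t0 c0.
  have := hN (maxn N k.+1) (leq_maxl _ _) u (lexx _).
  have := partial (maxn N k.+1); rewrite leq_max ltnSn orbT => /(_ isT).
  set s := \sum_(j < _) _; rewrite fu sub0r nmN => h1 h2.
  have := nmBge (a k * u ^+ k) s; rewrite nmBC nmM nmX -/t.
  have : 0 <= 2 * B * t ^+ maxn N k.+1 by rewrite !mulr_ge0 ?exprn_ge0 // ltW.
  by lra.
by move: key; rewrite ler_pM2r ?exprn_gt0.
Qed.

(** All roots of a nonzero polynomial are bounded by the sum of their moduli. *)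
Lemma poly_unbdd D (c : 'I_D -> C) :
  (forall M : R, exists t, M <= nm t /\ \sum_(j < D) c j * t ^+ j = 0) -> forall j, c j = 0.
Proof.
move=> h; pose p := \sum_(j < D) c j *: 'X^j.
have pE t : p.[t] = \sum_(j < D) c j * t ^+ j.
  by rewrite horner_sum; apply: eq_bigr => j _; rewrite hornerZ hornerXn.
have p0 : p = 0.
  apply/eqP/negPn/negP => p0; have [s ps] := closed_field_poly_normal p.
  have [t [ht pt]] := h (\sum_(z <- s) nm z + 1).
  move/eqP: pt; rewrite -pE ps hornerZ mulf_eq0 lead_coef_eq0 (negbTE p0) /=.
  rewrite horner_prod prodf_seq_eq0 => /hasP[z zs /=].
  rewrite hornerXsubC subr_eq0 => /eqP tz.
  move: ht; rewrite tz (big_rem z) //=.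
  have : 0 <= \sum_(y <- rem z s) nm y by apply: sumr_ge0 => y _; exact: nm_ge0.
  by lra.
move=> j; have /(congr1 (fun q : {poly C} => q`_j)) := p0.
rewrite coef0 coef_sum (bigD1 j) //= coefZ coefXn eqxx mulr1 big1 ?addr0 // => i ij.
by rewrite coefZ coefXn eq_sym (inj_eq val_inj) (negbTE ij) mulr0.
Qed.

Lemma poly2_unbdd D (c : 'I_D -> 'I_D -> C) :
  (forall M : R, exists t, M <= nm t /\ forall M' : R, exists s, M' <= nm s /\
     \sum_(i < D) (\sum_(k < D) c i k * s ^+ k) * t ^+ i = 0) -> forall i k, c i k = 0.
Proof.
move=> h i k; apply: (@poly_unbdd D (fun i => c i k)) i => M.
have [t [Mt ht]] := h M; exists t; split=> //.
apply: (@poly_unbdd D (fun k => \sum_(i < D) c i k * t ^+ i)) k => M'.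
have [s [Ms hs]] := ht M'; exists s; split=> //; apply: etrans hs.
under eq_bigr do rewrite mulr_suml.
rewrite exchange_big; apply: eq_bigr => i' _; rewrite mulr_suml.
by apply: eq_bigr => k _; rewrite mulrAC.
Qed.

(** Dirichlet's argument: reduced modulo [S] to the disc of radius [r], two of [M * M + 1] multiples
    of [y] fall into one of [M * M] squares of side [e / 2]. *)
Lemma latt_pigeon S y (e : R) : latt S -> 0 < e ->
  exists n l, [/\ (0 < n)%N, S l & nm (n%:R * y - l) <= e].
Proof.
move=> [_ _ SB [r r0 hr]] e0; have e20 : 0 < e / 2 by lra.
have /choice[L hL] : forall n : nat, exists l, S l /\ nm (n%:R * y - l) <= r.
  by move=> n; have [l] := hr (n%:R * y); exists l.
pose x n : C := n%:R * y - L n.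
pose box (t : R) := Num.truncn ((t + r) / (e / 2)).
have [M hM] := nat_ge (2 * r / (e / 2) + 1).
have boxM t : `|t| <= r -> (box t < M)%N.
  rewrite ler_norml => /andP[t1 t2].
  have h0 : 0 <= (t + r) / (e / 2) by rewrite divr_ge0 //; lra.
  have /andP[h1 _] := truncn_itv h0; rewrite -(ltr_nat R); apply: le_lt_trans h1 _.
  apply: lt_le_trans (hM M (leqnn M)).
  have : (t + r) / (e / 2) <= 2 * r / (e / 2) by rewrite ler_pM2r ?invr_gt0 //; lra.
  by lra.
have boxE t t' : `|t| <= r -> `|t'| <= r -> box t = box t' -> `|t - t'| <= e / 2.
  move=> ht ht' hb; have g0 s : `|s| <= r -> 0 <= (s + r) / (e / 2).
    by rewrite ler_norml => /andP[s1 s2]; rewrite divr_ge0 //; lra.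
  have := truncn_itv (g0 _ ht); have := truncn_itv (g0 _ ht'); rewrite -/(box t) -/(box t') hb -!(natr1 (box t')).
  move: (box t')%:R => b /andP[a1 a2] /andP[a3 a4].
  move: a1 a2 a3 a4; rewrite !(ler_pdivlMr _ _ e20) !(ltr_pdivrMr _ _ e20) !mulrDl !mul1r.
  by rewrite ler_norml => a1 a2 a3 a4; apply/andP; split; lra.
have xr n : nm (x n) <= r by have [] := hL n.
have reM n : (box (complex.Re (x n)) < M)%N by apply: boxM; apply: le_trans (nm_Re _) (xr n).
have imM n : (box (complex.Im (x n)) < M)%N by apply: boxM; apply: le_trans (nm_Im _) (xr n).
pose f (n : 'I_(M * M).+1) := (Ordinal (reM n), Ordinal (imM n)).
have /injectivePn[m [n mn fmn]] : ~~ injectiveb f.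
  apply/negP => /injectiveP/leq_card; rewrite card_prod !card_ord.
  by rewrite ltnn.
wlog lt_mn : m n mn fmn / (m < n)%N.
  move=> H; have [|//|/val_inj e1] := ltngtP m n; first exact: H.
    by apply: H; rewrite // eq_sym.
  by rewrite e1 eqxx in mn.
exists (n - m)%N, (L n - L m); split; first by rewrite subn_gt0.
  by apply: SB; [have [] := hL n | have [] := hL m].
have -> : (n - m)%:R * y - (L n - L m) = x n - x m by rewrite natrB ?(ltnW lt_mn) // /x; ring.
case: fmn => /boxE h1 /boxE h2.
rewrite nmBC; apply: le_trans (nm_ReIm _) _; rewrite [leRHS]splitr.
have -> : complex.Re (x m - x n) = complex.Re (x m) - complex.Re (x n) by rewrite raddfB.
have -> : complex.Im (x m - x n) = complex.Im (x m) - complex.Im (x n) by rewrite raddfB.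
have hRe i : `|complex.Re (x i)| <= r := le_trans (nm_Re _) (xr i).
have hIm i : `|complex.Im (x i)| <= r := le_trans (nm_Im _) (xr i).
by apply: lerD; [exact: h1|exact: h2].
Qed.

Lemma latt_halfplane S (q : C) : latt S -> q != 0 -> exists2 l, S l & 0 < complex.Re (l / q).
Proof.
move=> [_ _ _ [r r0 hr]] q0; have nq : 0 < nm q by rewrite nm_gt0.
(* A lattice point within [r] of [q * c] has [Re (l / q)] at least [c - r / nm q = 1]. *)
pose c : R := r / nm q + 1.
have [l Sl hl] := hr (q * c%:C%C); exists l => //.
have h : nm (c%:C%C - l / q) <= r / nm q.
  rewrite ler_pdivlMr // -nmM mulrBl divfK // mulrC //.
have := le_trans (nm_Re _) h; rewrite raddfB /= ler_norml /c => /andP[_]; lra.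
Qed.
End Density.

Section Commensurable.
Variable R : realType.
Local Notation C := R[i].
Local Notation K := {fraction (ent2 R)}.
Variables (S1 S2 : set C) (xi : C) (D : nat) (Q : 'I_D -> 'I_D -> 'I_D -> C).
Hypotheses (l1 : latt S1) (l2 : latt S2).

(** The coefficient of the [j]-th power of the exponential coordinate, with [u] and [w] independent;
    the relation at hand only concerns [w = p * u + q * v]. *)
Definition wp_rel j (u w : C) : C :=
  \sum_(i < D) (\sum_(k < D) Q i j k * wp S2 w ^+ k) * wp S1 u ^+ i.

Lemma PiS_add S (u l : C) : latt S -> S l -> PiS S u != 0 -> PiS S (u + l) != 0.
Proof.
move=> lS Sl; have [s3 _ SB _] := lS; apply: contraNneq => /(PiS_eq0 _ s3) h.
by apply/eqP/(PiS_eq0 u s3); rewrite -(addrK l u); exact: SB.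
Qed.

Lemma latt_muln S (l : C) n : latt S -> S l -> S (n%:R * l).
Proof.
move=> lS Sl; elim: n => [|n IH]; first by rewrite mul0r; have [] := lS.
by rewrite -natr1 mulrDl mul1r; exact: lattD.
Qed.

Lemma latt_wp_period S (u l : C) : latt S -> S l -> wp S (u + l) = wp S u.
Proof. by move=> [s3 S0 SB _] Sl; exact: wp_period. Qed.

(** Both wp-functions take arbitrarily large values at admissible points, chosen independently,
    which no nonzero polynomial in two variables annihilates. *)
Lemma wp_rel_free : (exists i j k, Q i j k != 0) ->
  exists j u w, [/\ PiS S1 u != 0, PiS S1 (u - xi) != 0, PiS S2 w != 0 & wp_rel j u w != 0].
Proof.
move=> [i [j [k Q0]]]; apply: contrapT => h; move/eqP: Q0; apply.
apply: (@poly2_unbdd R D (fun i k => Q i j k)) => M.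
have [u [u1 u2 u3]] := wp_unbounded M l1 (PiS_shift_entire xi l1) (PiS_shift_neq0 xi l1).
exists (wp S1 u); split=> // M'.
have n1 : exists v : C, (fun=> 1 : C) v != 0 by exists 0; exact: oner_neq0.
have [w [w1 _ w2]] := wp_unbounded M' l2 (@entire_cst R 1) n1.
exists (wp S2 w); split=> //; apply/eqP/negPn/negP => n0.
by apply: h; exists j, u, w.
Qed.

Variables (p q : C).
Hypothesis Q0 : exists i j k, Q i j k != 0.
Hypothesis rel : forall u v, PiS S1 u != 0 -> PiS S2 (p * u + q * v) != 0 ->
  \sum_(j < D) wp_rel j u (p * u + q * v) *
    (cexp v * (PiS S1 (u - xi) / PiS S1 u)) ^+ j = 0.

Lemma cexp_large (M B : R) (g : C) : g != 0 ->
  exists2 r : R, 0 <= r & forall v, r <= complex.Re v -> M <= nm (cexp v * g).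
Proof.
rewrite -nm_gt0 => g0; exists `|M / nm g| => // v hv.
rewrite nmM nm_cexp -ler_pdivrMr //; apply: le_trans (ler_norm _) (le_trans hv _).
by apply: le_trans (expR_ge1Dx _); rewrite lerDr.
Qed.

(* If [q != 0], moving [w] by multiples of a period [l] of [S2] leaves [u] and the
   values of both wp's unchanged, while [cexp v] grows without bound. *)
Lemma second_coord_free : q = 0.
Proof.
apply/eqP/negPn/negP => q0; have [j [u [w [u1 u2 w1]]]] := wp_rel_free Q0.
have g0 : PiS S1 (u - xi) / PiS S1 u != 0 by rewrite mulf_neq0 // invr_eq0.
move/eqP; apply; apply: (@poly_unbdd R D (fun j => wp_rel j u w)) => M.
have [r r0 hr] := cexp_large M 0 g0.
have [l Sl lq] := latt_halfplane l2 q0.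
pose B := complex.Re ((w - p * u) / q).
have [n hn] := nat_ge ((r - B) / complex.Re (l / q)).
have {}hn := hn n (leqnn n); rewrite ler_pdivrMr // in hn.
have Snl := latt_muln n l2 Sl.
pose v := (w + n%:R * l - p * u) / q.
have vE : p * u + q * v = w + n%:R * l by rewrite /v [q * _]mulrC divfK // addrC subrK.
have rv : r <= complex.Re v.
  have -> : v = (w - p * u) / q + (l / q) *+ n.
    by rewrite /v -mulr_natl; field.
  by rewrite raddfD raddfMn /= -/B -mulr_natl; lra.
exists (cexp v * (PiS S1 (u - xi) / PiS S1 u)); split; first exact: hr.
have := rel (v := v) u1; rewrite vE => /(_ (PiS_add l2 Snl w1)) e.
apply: etrans e; apply: eq_bigr => i _; congr (_ * _).
by rewrite /wp_rel latt_wp_period.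
Qed.

(** With [q = 0] the variable [v] is free, and a polynomial in the unbounded [cexp v] has zero
    coefficients. *)
Lemma wp_rel_diag j u : PiS S1 u != 0 -> PiS S1 (u - xi) != 0 -> PiS S2 (p * u) != 0 ->
  wp_rel j u (p * u) = 0.
Proof.
move=> u1 u2 w1; have g0 : PiS S1 (u - xi) / PiS S1 u != 0 by rewrite mulf_neq0 // invr_eq0.
apply: (@poly_unbdd R D (fun j => wp_rel j u (p * u))) j => M.
have [r r0 hr] := cexp_large M 0 g0.
exists (cexp r%:C%C * (PiS S1 (u - xi) / PiS S1 u)); split; first exact: hr.
by have := rel (v := r%:C%C) u1; rewrite second_coord_free mul0r addr0; apply.
Qed.

(* Otherwise the points [n p l] modulo [S2] accumulate at 0; shifting [u] by [n l]
   does not change [wp S1 u], so the relation between [wp S1 u] and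
   [wp S2 (p u)] becomes one between [wp S1 u] and [wp S2 w], with [w] free. *)
Lemma commensurable l : S1 l -> exists2 n, (0 < n)%N & S2 (n%:R * (p * l)).
Proof.
move=> Sl; apply: contrapT => hn; have [j [u [w [u1 u2 w1 /eqP]]]] := wp_rel_free Q0; apply.
have [H eH hH] := latt_wp l2; have [s3 _ _ _] := l2.
(* Multiplication by [PiS S2 ^+ (2 * D)] clears the poles: [Phi] is entire, so accumulation of zeros
   can be used. *)
pose T i z := \sum_(k < D) Q i j k * (H z ^+ k * PiS S2 z ^+ (2 * (D - k))).
pose Phi z := \sum_(i < D) T i (z + p * u) * wp S1 u ^+ i.
have PhiE z : PiS S2 (z + p * u) != 0 ->
    Phi z = PiS S2 (z + p * u) ^+ (2 * D) * wp_rel j u (z + p * u).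
  move=> Pz; rewrite mulr_sumr; apply: eq_bigr => i _; rewrite mulrA; congr (_ * _).
  rewrite mulr_sumr; apply: eq_bigr => k _; rewrite hH // exprMn -exprM.
  have -> : (2 * D = 2 * k + 2 * (D - k))%N by have := ltn_ord k; lia.
  rewrite exprD; move: (PiS _ _ ^+ _) (wp _ _ ^+ _) (PiS _ _ ^+ _) => a b c; ring.
have ePhi : entire Phi.
  apply: entire_sum => i _; apply: entireM; last exact: entire_cst.
  apply: (@entire_eq R (fun z => T i (1 * z + p * u))) => [z|]; first by rewrite mul1r.
  apply: entire_affine; apply: entire_sum => k _; apply: entireM; first exact: entire_cst.
  by apply: entireM; apply: entireX => //; exact: latt_entire.
have Phi0 : forall z, Phi z = 0.
  apply: entire_acc => // e e0; have [n [m [n0 Sm hm]]] := latt_pigeon (p * l) l2 e0.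
  exists (n%:R * (p * l) - m); split=> //.
    by apply/eqP => /subr0_eq h; apply: hn; exists n; rewrite ?h.
  set z := _ - m; have [Pz|Pz] := eqVneq (PiS S2 (z + p * u)) 0.
    (* At a zero of sigma every exponent [2 * (D - k)] is positive, as [k < D], so each term of
       [Phi] vanishes. *)
    rewrite /Phi big1 // => i _; rewrite /T big1 ?mul0r // => k _.
    by rewrite Pz expr0n muln_eq0 subn_eq0 leqNgt ltn_ord !mulr0.
  rewrite PhiE //; have Snl := latt_muln n l1 Sl.
  have zE : z + p * u + m = p * (u + n%:R * l) by rewrite /z; ring.
  have := @wp_rel_diag j (u + n%:R * l) (PiS_add l1 Snl u1).
  rewrite addrAC => /(_ (PiS_add l1 Snl u2)); rewrite -zE => /(_ (PiS_add l2 Sm Pz)).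
  by rewrite /wp_rel (latt_wp_period _ l1 Snl) (latt_wp_period _ l2 Sm) => ->; rewrite mulr0.
have := PhiE (w - p * u); rewrite subrK Phi0 => /(_ w1)/esym/eqP.
by rewrite mulf_eq0 expf_eq0 (negbTE w1) andbF => /eqP.
Qed.
End Commensurable.

(** * From commensurability to integer matrices *)

Section Assembly.
Variable R : realType.
Local Notation C := R[i].
Local Notation K := {fraction (ent2 R)}.
Implicit Types S : set C.

Lemma algebraic_commensurable S1 S2 xi1 xi2 (a : 'M[C]_2) : latt S1 -> latt S2 -> a \in unitmx ->
  algebraic_map (wp_sigmat S1 xi1) (wp_sigmat S2 xi2 \o mulmx a) ->
  exists2 p : C, p != 0 & forall l, S1 l -> exists2 n, (0 < n)%N & S2 (n%:R * (p * l)).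
Proof.
move=> l1 l2 ua; have [x hx] := regs_ex xi1 l1 (unitmx1 C 2); have [y hy] := regs_ex xi2 l2 ua.
move=> /(algebraic_mapP l1 l2 ua hx hy)/(_ 0) /alg_relation[D [Q [Q0 rel]]].
have {}rel u v : PiS S1 u != 0 -> PiS S2 (a 0 0 * u + a 0 1 * v) != 0 ->
    \sum_(j < D) wp_rel S1 S2 Q j u (a 0 0 * u + a 0 1 * v) *
      (cexp v * (PiS S1 (u - xi1) / PiS S1 u)) ^+ j = 0.
  move=> u1 w1; pose z : 'cV[C]_2 := \col_i (if i == 0 then u else v).
  have z0 : z 0 0 = u by rewrite mxE.
  have z1 : z 1 0 = v by rewrite mxE.
  have zE : row_form a 0 z = a 0 0 * u + a 0 1 * v by rewrite row_formE /lform z0 z1.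
  have x0 : reg z (x 0) (wp S1 u).
    by have := hx 0 z; rewrite wp_sigmat0 /row_form mul1mx z0; apply.
  have x1 : reg z (x 1) (cexp v * (PiS S1 (u - xi1) / PiS S1 u)).
    by have := hx 1 z; rewrite wp_sigmat1 // /row_form mul1mx z0 z1; apply.
  have y0 : reg z (y 0) (wp S2 (a 0 0 * u + a 0 1 * v)).
    by have := hy 0 z; rewrite wp_sigmat0 -/(row_form a 0 z) zE; apply.
  apply: (@reg0 R z); move: rel => <-; apply: reg_sum => j.
  apply: regM; last exact: regX.
  apply: reg_sum => i; apply: regM; last exact: regX.
  apply: reg_sum => k; apply: regM; last exact: regX.
  exact: reg_cst.
have a01 := second_coord_free l1 l2 Q0 rel.
exists (a 0 0); last first.
  by move=> l Sl; have h := commensurable l1 l2 Q0 rel Sl; exact h.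
(* The first row of an invertible matrix cannot be zero. *)
apply/eqP => a00; have [z [hz _]] := unitmx_surj ua 1 0.
by move/eqP: hz; rewrite row_formE /lform a00 a01 !mul0r addr0 eq_sym oner_eq0.
Qed.

(** Left multiplication by the matrix [g] of [isogeny_alg] exchanges the matrices suited to [S2] and
    [xi2] with those suited to [S1] and [mu * xi2]. *)
Lemma algebraic_isogeny S1 S2 xi1 xi2 (mu : C) : latt S1 -> latt S2 -> mu != 0 ->
  [set w | S2 (w / mu)] `<=` S1 ->
  (exists alpha : 'M[C]_2, alpha \in unitmx /\
     algebraic_map (wp_sigmat S1 xi1) (wp_sigmat S2 xi2 \o mulmx alpha)) <->
  Xi S1 xi1 (mu * xi2).
Proof.
move=> l1 l2 mu0 sub; have [g ug hg] := isogeny_alg xi2 l1 l2 mu0 sub.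
have [x hx] := regs_ex xi1 l1 (unitmx1 C 2).
have transfer a : a \in unitmx ->
    algebraic_map (wp_sigmat S1 xi1) (wp_sigmat S1 (mu * xi2) \o mulmx (g *m a)) <->
    algebraic_map (wp_sigmat S1 xi1) (wp_sigmat S2 xi2 \o mulmx a).
  move=> ua; have uga : g *m a \in unitmx by rewrite unitmx_mul ug.
  have [y hy] := regs_ex xi2 l2 ua; have [y' hy'] := regs_ex (mu * xi2) l1 uga.
  have cA : range (@kcst R) `<=` gens x by move=> c hc; left.
  have h := hg a y' y ua hy' hy (gens x) cA.
  apply: iff_trans (algebraic_mapP l1 l1 uga hx hy') _.
  exact: iff_trans h (iff_sym (algebraic_mapP l1 l2 ua hx hy)).
split=> [[a [ua ha]]|[b [ub hb]]].
  exists (g *m a); split; first by rewrite unitmx_mul ug.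
  exact: (transfer a ua).2.
have ua : invmx g *m b \in unitmx by rewrite unitmx_mul unitmx_inv ug.
exists (invmx g *m b); split; first exact: ua.
have e : g *m (invmx g *m b) = b by rewrite mulmxA (mulmxV ug) mul1mx.
have t := (transfer _ ua).1; rewrite e in t; exact: (t hb).
Qed.

Lemma int_comb_eq0 (w : C) (m n : int) : w \isn't Num.real ->
  m%:~R + n%:~R * w = 0 -> m = 0 /\ n = 0.
Proof.
move=> hw h; have n0 : n = 0.
  apply/eqP/negPn/negP => n0; move/negP: hw; apply.
  have -> : w = - m%:~R / n%:~R.
    by apply: (canRL (mulfK _)); rewrite ?intr_eq0 // mulrC; apply/eqP; rewrite -addr_eq0 addrC h.
  by rewrite rpred_div ?rpredN ?realz.
split=> //; move/eqP: h; rewrite n0 mul0r addr0 intr_eq0; exact/eqP.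
Qed.

Lemma lattice_sub_scaled (w1 w2 mu : C) (a b c d : int) : mu != 0 ->
  mu = c%:~R * w1 + d%:~R -> mu * w2 = a%:~R * w1 + b%:~R ->
  [set w | lattice 1 w2 (w / mu)] `<=` lattice 1 w1.
Proof.
move=> mu0 muE w2E w [m [n h]]; exists (m * d + n * b), (m * c + n * a).
rewrite -[w](divfK mu0) h mulr1 mulrDl -mulrA [w2 * _]mulrC w2E muE.
by rewrite !intrD !intrM; ring.
Qed.

(** A multiple [P] of [p] can be chosen so that [P] and [P * w1] both lie in the lattice of [w2]:
    [P = d + c w2] and [P w1 = b + a w2]. Eliminating [P] gives the Moebius matrix with rows
    [(- d, b)] and [(c, - a)]. *)
Lemma commensurable_moebius (w1 w2 p : C) : w1 \isn't Num.real -> w2 \isn't Num.real ->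
  p != 0 -> (forall l, lattice 1 w1 l -> exists2 n, (0 < n)%N & lattice 1 w2 (n%:R * (p * l))) ->
  exists a b c d : int, a * d - b * c != 0 /\
    w2 = (a%:~R * w1 + b%:~R) / (c%:~R * w1 + d%:~R).
Proof.
move=> h1 h2 p0 h; have l2 := latt_lattice h2.
have [|n1 n1_gt0 hn1] := h 1; first by exists 1, 0; rewrite mul0r addr0 mulr1.
have [|n2 n2_gt0 hn2] := h w1; first by exists 0, 1; rewrite mul0r add0r mul1r.
pose P : C := n2%:R * (n1%:R * (p * 1)).
have P0 : P != 0 by rewrite /P mulr1 !mulf_neq0 // pnatr_eq0 -lt0n.
have [d [c PE]] : lattice 1 w2 P by exact: latt_muln.
have [b [a PwE]] : lattice 1 w2 (P * w1).
  by rewrite (_ : P * w1 = n1%:R * (n2%:R * (p * w1))); [exact: latt_muln|rewrite /P; ring].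
rewrite mulr1 in PE; rewrite mulr1 PE in PwE.
have rel : w2 * (c%:~R * w1 - a%:~R) = - d%:~R * w1 + b%:~R.
  by apply/eqP; rewrite -subr_eq0; apply/eqP; transitivity ((d%:~R + c%:~R * w2) * w1 - (b%:~R + a%:~R * w2)); [ring|rewrite PwE subrr].
have cd0 : ~ (c = 0 /\ d = 0) by move=> [c0 d0]; move: P0; rewrite PE c0 d0 mul0r addr0 eqxx.
have den0 : c%:~R * w1 - a%:~R != 0.
  apply/eqP => e; have [|a0 c0] := @int_comb_eq0 w1 (- a) c h1; first by rewrite rmorphN addrC.
  have [|b0 d0] := @int_comb_eq0 w1 b (- d) h1; first by rewrite rmorphN /= addrC -rel e mulr0.
  by apply: cd0; split=> //; apply/eqP; rewrite -oppr_eq0 d0.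
exists (- d), b, c, (- a); split; last first.
  by apply: (canRL (mulfK _)); rewrite !rmorphN.
(* [(d + c w2) (c w1 - a)] is minus the determinant, so a zero determinant would force [P = 0]. *)
apply/eqP => det0; apply: cd0.
have [|d0 c0] := @int_comb_eq0 w2 d c h2; last by [].
apply: (mulIf den0); rewrite mul0r.
have : (- d * - a - b * c)%:~R = 0 :> C by rewrite det0.
rewrite intrB !intrM !rmorphN /= => e.
transitivity (d%:~R * (c%:~R * w1 - a%:~R) + c%:~R * (w2 * (c%:~R * w1 - a%:~R)) : C); first by ring.
rewrite rel; transitivity (- (- (d%:~R : C) * - a%:~R - b%:~R * c%:~R)); first by ring.
by rewrite e oppr0.
Qed.
End Assembly.

Theorem proposition4p12 (R : realType) (omega1 omega2 xi1 xi2 : R[i])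
    (homega1 : omega1 \isn't Num.real) (homega2 : omega2 \isn't Num.real) :
  (exists alpha : 'M[R[i]]_2, alpha \in unitmx /\
     algebraic_map (wp_sigmat (lattice 1 omega1) xi1)
                   (wp_sigmat (lattice 1 omega2) xi2 \o mulmx alpha))
  <->
  (exists a b c d : int,
     [/\ a * d - b * c != 0,
         omega2 = (a%:~R * omega1 + b%:~R) / (c%:~R * omega1 + d%:~R) &
         Xi (lattice 1 omega1) xi1 ((c%:~R * omega1 + d%:~R) * xi2)]).
Proof.
have l1 := latt_lattice homega1; have l2 := latt_lattice homega2.
have key (a b c d : int) : a * d - b * c != 0 ->
    omega2 = (a%:~R * omega1 + b%:~R) / (c%:~R * omega1 + d%:~R) ->
    (exists alpha : 'M[R[i]]_2, alpha \in unitmx /\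
       algebraic_map (wp_sigmat (lattice 1 omega1) xi1)
                     (wp_sigmat (lattice 1 omega2) xi2 \o mulmx alpha)) <->
    Xi (lattice 1 omega1) xi1 ((c%:~R * omega1 + d%:~R) * xi2).
  move=> det0 w2E; have mu0 : c%:~R * omega1 + d%:~R != 0.
    apply: contra det0 => /eqP; rewrite addrC => /(int_comb_eq0 homega1)[-> ->].
    by rewrite !mulr0 subrr.
  apply: algebraic_isogeny => //.
  apply: (lattice_sub_scaled (a := a) (b := b) mu0 erefl).
  by rewrite w2E mulrC divfK.
split=> [hex|[a [b [c [d [det0 w2E hXi]]]]]]; last first.
  exact: ((key a b c d det0 w2E).2 hXi).
have [alpha [ua ha]] := hex.
have [p p0 hp] := algebraic_commensurable l1 l2 ua ha.
have [a [b [c [d [det0 w2E]]]]] := commensurable_moebius homega1 homega2 p0 hp.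
exists a, b, c, d; split; [exact: det0|exact: w2E|].
exact: ((key a b c d det0 w2E).1 hex).
Qed.
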